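(* Let $T:X_{ius}\to X_{ius}$ be a bounded linear operator. Then there exists $\lambda\in\mathbb{R}$ such that $T-\lambda I$ is strictly singular.
   Context: $I$ is the identity operator; an operator is strictly singular if its restriction to any infinite dimensional closed subspace is not an isomorphism onto its image. Scalars are real, $\mathbb{N}=\{1,2,\dots\}$. $c_{00}$ is the space of finitely supported sequences, with standard basis $(e_n)$, also written $(e_n^* )$ when its elements are viewed as functionals; $f(x)=\langle f,x\rangle=\sum_n f(n)x(n)$, $\|f\|_\infty=\max_n|f(n)|$. $\operatorname{supp}x=\{n:x(n)\ne 0\}$, $\operatorname{range}(x)$ is the smallest interval of $\mathbb{N}$ containing $\operatorname{supp}x$. For sets, $A<B$ means $\max A<\min B$; $x<y$ means $\operatorname{supp}x<\operatorname{supp}y$. For an interval $E\subset\mathbb{N}$, $Ex$ is the restriction of $x$ to $E$. Fix positive integers $m_j,n_j,s_j$ with $m_1=2$, $m_{j+1}=m_j^5$, $n_1=4$, $n_{j+1}=(4n_j)^{s_j}$, $2^{s_j}\ge m_{j+1}^3$. Let $\mathbf{Q}$ be the set of sequences with finite nonempty support, rational coordinates, all of modulus at most $1$, and $\mathbf{Q_s}$ the set of all $(x_1,f_1,\dots,x_n,f_n)$ with $x_i,f_i\in\mathbf{Q}$ and $\operatorname{range}(x_i)\cup\operatorname{range}(f_i)<\operatorname{range}(x_{i+1})\cup\operatorname{range}(f_{i+1})$ for $i<n$. Fix an injection $\sigma:\mathbf{Q_s}\to\{2j:j\in\mathbb{N}\}$ such that for every $\phi=(x_1,f_1,\dots,x_n,f_n)\in\mathbf{Q_s}$: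 $\sigma(x_1,f_1,\dots,x_{n-1},f_{n-1})<\sigma(\phi)$ and $\max\{\operatorname{range}(x_n)\cup\operatorname{range}(f_n)\}\le m_{\sigma(\phi)}^{1/2}$. Special sequences: $\phi=(x_1,f_1,\dots,x_{2k},f_{2k})\in\mathbf{Q_s}$, with $\phi_i=(x_1,f_1,\dots,x_i,f_i)$, is a special sequence of length $2k$ if: (1) for some $j\in\mathbb{N}$ with $m_{2j}^{1/2}>2k$, $x_1=\frac1{n_{2j}}\sum_{l=1}^{n_{2j}}e_{1,l}$ and $f_1=\frac1{m_{2j}}\sum_{l=1}^{n_{2j}}e^*_{1,l}$, where $(e_{1,l})_l$ are $n_{2j}$ distinct standard basis vectors; (2) for $1\le i\le k$, $\|f_{2i}\|_\infty\le\frac1{m_{\sigma(\phi_{2i-1})}}$ and $|f_{2i}(x_{2i})|\le\frac1{m_{\sigma(\phi_{2i-1})}}$; (3) for $1\le i<k$, with $p=\sigma(\phi_{2i})$, $x_{2i+1}=\frac1{n_p}\sum_{l=1}^{n_p}e_{2i+1,l}$ and $f_{2i+1}=\frac1{m_p}\sum_{l=1}^{n_p}e^*_{2i+1,l}$, where $(e_{2i+1,l})_l$ are $n_p$ distinct standard basis vectors. Norming set: $K_0=K_0^0=\{\pm e_n^*:n\in\mathbb{N}\}$, $K_0^j=\emptyset$ for $j\ge1$, and $K_n^0=K_0$ for all $n$. For $n\ge1$, $j\in\mathbb{N}$: $K_n^{2j}=K_{n-1}^{2j}\cup\{\frac1{m_{2j}}\sum_{i=1}^d f_i:d\le n_{2j},\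 f_1<\dots<f_d,\ f_i\in K_{n-1}\}$. For a special sequence $\phi=(x_1,f_1,\dots,x_{n_{2j+1}},f_{n_{2j+1}})$ of length $n_{2j+1}$ with $f_{2i}\in K_{n-1}^{\sigma(\phi_{2i-1})}$ for $i\le n_{2j+1}/2$, $K_{n,\phi}^{2j+1}$ is the set of all $\frac{\pm1}{m_{2j+1}}E\bigl(\sum_{i=1}^{n_{2j+1}/2}(\lambda_{f'_{2i}}f_{2i-1}+f'_{2i})\bigr)$, where $E$ is an interval, $f'_{2i}\in K_{n-1}^{\sigma(\phi_{2i-1})}$, $\operatorname{supp}f'_{2i}=\operatorname{supp}f_{2i}$, $|g(x_{2i})|\le\frac1{m_{\sigma(\phi_{2i-1})}}$ for all $g\in K_{n-1}^{\sigma(\phi_{2i-1})}$, and $\lambda_{f'_{2i}}=f'_{2i}(m_{\sigma(\phi_{2i-1})}x_{2i})$ if $f'_{2i}(x_{2i})\ne0$, $\lambda_{f'_{2i}}=\pm\frac1{n_{2j+1}^2}$ otherwise. $K_n^{2j+1}$ is the union of $K_{n-1}^{2j+1}$ and all $K_{n,\phi}^{2j+1}$, $\phi$ a special sequence of length $n_{2j+1}$. $K_n=\bigcup_jK_n^j$, $K=\bigcup_nK_n$. $X_{ius}$ is the completion of $c_{00}$ under $\|x\|=\|x\|_K=\sup\{f(x):f\in K\}$. *)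

(* Defs.v *)
From HB Require Import structures.
From mathcomp Require Import all_boot all_order all_algebra.
From mathcomp Require Import all_classical all_reals all_analysis.

Set Implicit Arguments.
Unset Strict Implicit.
Unset Printing Implicit Defensive.

Import Order.TTheory GRing.Theory Num.Theory.
Import numFieldNormedType.Exports.

Local Open Scope classical_set_scope.
Local Open Scope ring_scope.

Section C00.
Variable R : realType.

(* The positions are 1, 2, ...: coordinate 0 is a dummy that always vanishes,
   so that indices here are the indices of the mathematical text. *)
Definition finsupp : {pred nat -> R} :=
  mem [set x : nat -> R | x 0%N = 0 /\ finite_set [set k | x k != 0]].

Lemma finsupp_submod_closed : submod_closed finsupp.
Proof.
split=> [|a x y]; rewrite !inE /=.
  split=> //; apply: (sub_finite_set _ (finite_set0 nat)) => k /=.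
  by rewrite eqxx.
move=> [x0 fx] [y0 fy]; split.
  by rewrite -[LHS]/(a * x 0%N + y 0%N) x0 y0 mulr0 addr0.
have fxy : finite_set ([set k | x k != 0] `|` [set k | y k != 0]).
  by rewrite finite_setU.
apply: (sub_finite_set _ fxy) => k /=.
rewrite -[(a *: x + y) k]/(a * x k + y k).
have [->|xk _] := eqVneq (x k) 0; last by left.
by rewrite mulr0 add0r => yk; right.
Qed.

HB.instance Definition _ :=
  GRing.isSubmodClosed.Build R (nat -> R) finsupp finsupp_submod_closed.

Record c00 := C00 { c00_fun :> nat -> R ; c00P : c00_fun \in finsupp }.

HB.instance Definition _ := [isSub for c00_fun].
HB.instance Definition _ := [Choice of c00 by <:].
HB.instance Definition _ := [SubChoice_isSubLmodule of c00 by <:].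

Lemma basis_vec_subproof (n : nat) :
  (fun k => ((0 < k) && (k == n))%N%:R : R) \in finsupp.
Proof.
rewrite inE /=; split=> //; apply: (sub_finite_set _ (finite_set1 n)) => k /=.
by have [->//|_] := eqVneq k n; rewrite andbF eqxx.
Qed.

(* e_n for n >= 1. Functionals are elements of c00 too, so this is also e_n^*. *)
Definition basis_vec (n : nat) : c00 := C00 (basis_vec_subproof n).

Lemma restr_subproof (E : interval nat) (x : c00) :
  (fun k => if k \in E then x k else 0) \in finsupp.
Proof.
move: (c00P x); rewrite !inE /= => -[x0 fx]; split; first by rewrite x0 if_same.
by apply: (sub_finite_set _ fx) => k /=; case: ifP => //; rewrite eqxx.
Qed.

Definition restr (E : interval nat) (x : c00) : c00 := C00 (restr_subproof E x).

Implicit Types (x f : c00).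

Definition pairing f x : R := \sum_(k \in [set: nat]) f k * x k.

Definition norm_oo f : R := sup [set `|f k| | k in [set: nat]].

Definition supp x : set nat := [set k | x k != 0].

Definition hull_supp x : set nat :=
  [set k | exists i j, [/\ supp x i, supp x j & (i <= k <= j)%N]].

Definition set_lt (A B : set nat) : Prop :=
  forall a b, A a -> B b -> (a < b)%N.

Definition Qset : set c00 :=
  [set x | supp x !=set0 /\
           forall k, (exists q : rat, x k = ratr q) /\ `|x k| <= 1].

(* A sequence (x_1, f_1, ..., x_n, f_n) is the list of the pairs (x_i, f_i);
   its entries are accessed with 1 <= i <= n. *)
Definition xs (phi : seq (c00 * c00)) (i : nat) : c00 := (nth (0, 0) phi i.-1).1.
Definition fs (phi : seq (c00 * c00)) (i : nat) : c00 := (nth (0, 0) phi i.-1).2.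

Definition Qs : set (seq (c00 * c00)) :=
  [set phi |
    [/\ (0 < size phi)%N,
        (forall i, (1 <= i <= size phi)%N -> Qset (xs phi i) /\ Qset (fs phi i)) &
        (forall i, (1 <= i < size phi)%N ->
          set_lt (hull_supp (xs phi i) `|` hull_supp (fs phi i))
                 (hull_supp (xs phi i.+1) `|` hull_supp (fs phi i.+1)))]].

End C00.

Record growth (m n s : nat -> nat) : Prop := Growth {
  growth_pos : forall j, (1 <= j)%N -> [/\ (0 < m j)%N, (0 < n j)%N & (0 < s j)%N];
  growth_m1 : m 1%N = 2%N;
  growth_mS : forall j, (1 <= j)%N -> m j.+1 = (m j ^ 5)%N;
  growth_n1 : n 1%N = 4%N;
  growth_nS : forall j, (1 <= j)%N -> n j.+1 = ((4 * n j) ^ s j)%N;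
  growth_s : forall j, (1 <= j)%N -> (m j.+1 ^ 3 <= 2 ^ s j)%N }.

(* Only the values of sigma on Qs matter. *)
Record coding (R : realType) (m : nat -> nat)
    (sigma : seq (c00 R * c00 R) -> nat) : Prop := Coding {
  coding_even : forall phi, Qs phi ->
    exists2 j, (1 <= j)%N & sigma phi = (2 * j)%N;
  coding_inj : set_inj (@Qs R) sigma;
  coding_mono : forall phi, Qs phi -> (1 < size phi)%N ->
    (sigma (take (size phi).-1 phi) < sigma phi)%N;
  coding_bound : forall phi, Qs phi -> forall k,
    (hull_supp (xs phi (size phi)) `|` hull_supp (fs phi (size phi))) k ->
    k%:R <= Num.sqrt (m (sigma phi))%:R :> R }.

Section NormingSet.
Variables (R : realType) (m n : nat -> nat).
Variable sigma : seq (c00 R * c00 R) -> nat.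

(* x = (1/n_p) \sum_l e_l and f = (1/m_p) \sum_l e_l^*, for the same n_p distinct
   basis vectors e_l. *)
Definition basis_average (p : nat) (x f : c00 R) : Prop :=
  exists L : seq nat,
    [/\ uniq L /\ size L = n p,
        (forall l, l \in L -> (1 <= l)%N),
        x = (n p)%:R^-1 *: \sum_(l <- L) basis_vec R l &
        f = (m p)%:R^-1 *: \sum_(l <- L) basis_vec R l].

(* Special sequences of length 2k; phi_i is take i phi. *)
Definition special_seq (k : nat) (phi : seq (c00 R * c00 R)) : Prop :=
  [/\ Qs phi /\ size phi = (2 * k)%N,
      (exists j, [/\ (1 <= j)%N,
         (2 * k)%:R < Num.sqrt (m (2 * j))%:R :> R &
         basis_average (2 * j) (xs phi 1) (fs phi 1)]),
      (forall i, (1 <= i <= k)%N ->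
         let q := sigma (take (2 * i).-1 phi) in
         norm_oo (fs phi (2 * i)) <= (m q)%:R^-1 /\
         `|pairing (fs phi (2 * i)) (xs phi (2 * i))| <= (m q)%:R^-1) &
      (forall i, (1 <= i < k)%N ->
         basis_average (sigma (take (2 * i) phi))
           (xs phi (2 * i).+1) (fs phi (2 * i).+1))].

Definition K0 : set (c00 R) :=
  [set f | exists2 l, (1 <= l)%N & f = basis_vec R l \/ f = - basis_vec R l].

(* In even_part, odd_part and K_step, L j stands for K_{n-1}^j. *)
Definition even_part (L : nat -> set (c00 R)) (p : nat) : set (c00 R) :=
  [set h | exists d (g : nat -> c00 R),
    [/\ (1 <= d <= n p)%N,
        (forall i, (1 <= i <= d)%N -> (\bigcup_j L j) (g i)),
        (forall i i', (1 <= i)%N -> (i < i')%N -> (i' <= d)%N ->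
           set_lt (supp (g i)) (supp (g i'))) &
        h = (m p)%:R^-1 *: \sum_(1 <= i < d.+1) g i]].

Definition odd_part (L : nat -> set (c00 R)) (p : nat)
    (phi : seq (c00 R * c00 R)) : set (c00 R) :=
  [set h | exists k (b : bool) (E : interval nat)
                  (f' : nat -> c00 R) (lam : nat -> R),
    let q i := sigma (take (2 * i).-1 phi) in
    [/\ n p = (2 * k)%N /\ special_seq k phi,
        (forall i, (1 <= i <= k)%N -> L (q i) (fs phi (2 * i))),
        (forall i, (1 <= i <= k)%N ->
           [/\ L (q i) (f' i), supp (f' i) = supp (fs phi (2 * i)) &
               forall g, L (q i) g ->
                 `|pairing g (xs phi (2 * i))| <= (m (q i))%:R^-1]),
        (forall i, (1 <= i <= k)%N ->
           if pairing (f' i) (xs phi (2 * i)) != 0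
           then lam i = pairing (f' i) ((m (q i))%:R *: xs phi (2 * i))
           else lam i = (n p ^ 2)%:R^-1 \/ lam i = - (n p ^ 2)%:R^-1) &
        h = ((-1) ^+ b / (m p)%:R) *:
            restr E (\sum_(1 <= i < k.+1)
                       (lam i *: fs phi (2 * i).-1 + f' i))]].

(* The odd families are K^3, K^5, ...; K^1 is empty. *)
Definition K_step (L : nat -> set (c00 R)) (p : nat) : set (c00 R) :=
  if p == 0%N then K0
  else if ~~ odd p then L p `|` even_part L p
  else if (3 <= p)%N then L p `|` \bigcup_(phi in [set: seq (c00 R * c00 R)])
                                    odd_part L p phi
  else set0.

(* Kset i j is K_i^j. *)
Fixpoint Kset (i : nat) : nat -> set (c00 R) :=
  if i is i'.+1 then K_step (Kset i')
  else fun j => if j == 0%N then K0 else set0.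

Definition norming_set : set (c00 R) := \bigcup_i \bigcup_j Kset i j.

Definition norm_K (x : c00 R) : \bar R := ereal_sup [set (pairing f x)%:E | f in norming_set].

End NormingSet.

Definition is_completion (R : realType) (V : lmodType R) (N : V -> \bar R)
    (X : completeNormedModType R) (iota : {linear V -> X}) : Prop :=
  (forall v, `|iota v|%:E = N v) /\ dense (range iota).

Section StrictlySingular.
Variables (R : realType) (X Z : normedModType R).

Definition finite_dim (Y : set X) : Prop :=
  exists (d : nat) (v : 'I_d -> X),
    (forall i, Y (v i)) /\
    (forall y, Y y -> exists a : 'I_d -> R, y = \sum_i a i *: v i).

Definition iso_onto_image (Y : set X) (f : X -> Z) : Prop :=
  {within Y, continuous f} /\
  exists g : Z -> X,
    (forall y, Y y -> g (f y) = y) /\ {within f @` Y, continuous g}.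

Definition strictly_singular (f : {linear X -> Z}) : Prop :=
  forall Y : set X, submod_closed [in Y] -> closed Y -> ~ finite_dim Y ->
    ~ iso_onto_image Y f.

End StrictlySingular.

(* Main.v *)
Require Import Defs.
From mathcomp Require Import all_boot all_order all_algebra.
From mathcomp Require Import all_classical all_reals all_analysis.
From mathcomp Require Import zify ring lra.

Set Implicit Arguments.
Unset Strict Implicit.
Unset Printing Implicit Defensive.

Import Order.TTheory GRing.Theory Num.Theory.
Import numFieldNormedType.Exports.

Local Open Scope classical_set_scope.
Local Open Scope ring_scope.

(** The norm makes certain sums of averages nearly cancel, while the two halves of such
    a sum, and also vectors that lie beside it, keep a large norm. An operator T that
    treats the two halves differently, or moves the sum to the side, cannot be bounded.

    Averages. Let p be an index and let y_1 < ... < y_(n_p) be vectors of norm at most 1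
    on which functionals of foreign weights are small. Since n_p is huge compared with
    the earlier parameters, a functional of weight w < p meets few of the y_k with more
    than one of its pieces, and unfolding such functionals about log m_p times shows that
    the average, multiplied by m_p, reacts to functionals of weight w < p like a basis
    vector and hardly reacts to those of weight w > p; only functionals of index p can
    norm it ([split_estimate], [ris_estimate], [average_exact]).

    Dependent sequences. Let q be odd, n_q = 2 k, and let (x_1, f_1, ..., x_(2k), f_(2k))
    be a special sequence whose odd entries are basis averages and whose even entries
    are averages as above. With rho = 1 or rho = 0 the vector

      sum over i of  rho m x_(2i-1) - m x_(2i),

    where m is the parameter m_j of the index j of the respective entry, has norm of
    order k / m_q ^ 2, not k / m_q. Indeed, let f be a functional of index q, built on a
    special sequence. As the coding is injective, that sequence has a common initial
    segment with the given one, and beyond it all weights are foreign. On the common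
    segment f acts pair by pair through lambda f_(2i-1) + f', where f' has the support of
    f_(2i) and lambda = f' (m x_(2i)); this gives 0, or at most 1 / n_q ^ 2, if rho = 1, and also
    if rho = 0 and f_(2i) has support off x_(2i) ([special_bound], [dependent_estimate]).
    On the other hand the functional H = 1 / m_q times the sum of the
    lambda f_(2i-1) + f_(2i) is in the norming set, and it takes values of order k / m_q
    on sums of vectors that the f_(2i) norm ([dependent_pair]). The two orders of magnitude are used twice.

    First use, rho = 0. Suppose that T e_l stays away from the line of e_l for all large
    l. Then functionals that vanish at l norm the off-diagonal part of T e_l. Averaging
    them gives even entries x_(2i), f_(2i) of disjoint supports such that f_(2i) is large
    on T (m x_(2i)). So T maps a vector of norm of order k / m_q ^ 2 to one that is as
    large as k / m_q on H, and for m_q large T is not bounded. Therefore T e_l is close to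
    a_l e_l for infinitely many l, with a_l bounded ([near_diagonal]); for a cluster value
    lambda of the a_l the operator S = T - lambda I is small on infinitely many basis
    vectors.

    Second use, rho = 1. If S were an isomorphism on a closed subspace Y of infinite
    dimension, it would be bounded below on a space W of finitely supported vectors
    that is close to a subspace of Y ([block_subspace]), and W contains normed averages
    as above ([l1_average], [subspace_average]). Take these for the even entries and
    averages of basis vectors on which S is small for the odd ones. The sum O of the odd
    and the sum V of the even part differ by a vector of norm of order k / m_q ^ 2, and
    S O is as small as desired, so S V is small compared with k / m_q. But V has norm of
    order k / m_q, a contradiction ([not_bounded_below], [strictly_singular_of_small]). *)

(** * Finitely supported vectors and their pairing *)

Section Coordinates.
Variable R : realType.
Implicit Types (x y f g : c00 R) (E : interval nat).

Lemma c00_ext x y : (forall k, x k = y k) -> x = y.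
Proof. by move=> xy; apply: val_inj; apply/funext => k; exact: xy. Qed.

Lemma c00_at0 x : x 0%N = 0.
Proof. by have := c00P x; rewrite inE => -[]. Qed.

Lemma c00_DE x y k : (x + y) k = x k + y k. Proof. by []. Qed.

Lemma c00_ZE a x k : (a *: x) k = a * x k. Proof. by []. Qed.

Lemma c00_NE x k : (- x) k = - x k. Proof. by []. Qed.

Lemma c00_sumE (I : Type) (r : seq I) (P : pred I) (F : I -> c00 R) k :
  (\sum_(i <- r | P i) F i) k = \sum_(i <- r | P i) F i k.
Proof. by elim/big_rec2: _ => // i a b _ <-. Qed.

Lemma restrE E x k : restr E x k = if k \in E then x k else 0.
Proof. by []. Qed.

Lemma basis_vecE l k : basis_vec R l k = ((0 < k) && (k == l))%N%:R.
Proof. by []. Qed.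

Lemma c00_bounded x : exists N, forall k, (N <= k)%N -> x k = 0.
Proof.
have := c00P x; rewrite inE => -[_ /finite_seqP[r rE]].
exists (\max_(i <- r) i).+1 => k kr; apply/eqP/negPn/negP => xk.
have : (k \in r) by have : [set i | x i != 0] k by []; rewrite rE.
by move=> kr0; have := @leq_bigmax_seq _ r xpredT id k kr0 isT; rewrite leqNgt kr.
Qed.

Definition bound x : nat := xget 0%N [set N | forall k, (N <= k)%N -> x k = 0].

Lemma boundP x k : (bound x <= k)%N -> x k = 0.
Proof.
by rewrite /bound; case: xgetP => [N _ /= H|/=]; [exact: H|have [N H /(_ N)] := c00_bounded x].
Qed.

Lemma suppE x k : supp x k = (x k != 0) :> Prop. Proof. by []. Qed.

Lemma supp_lt_bound x k : supp x k -> (k < bound x)%N.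
Proof. by rewrite ltnNge => xk; apply/negP => /boundP x0; rewrite /supp/= x0 eqxx in xk. Qed.

Lemma suppPn x k : ~ supp x k -> x k = 0.
Proof. by move=> xk; apply/eqP/negPn/negP. Qed.

Lemma nsuppP x k : x k = 0 -> ~ supp x k.
Proof. by rewrite /supp /= => ->; rewrite eqxx. Qed.

Lemma supp_nonempty x : x != 0 -> supp x !=set0.
Proof.
move=> /eqP x0; apply/set0P/negP => /eqP sx; apply: x0; apply: c00_ext => k.
by apply: suppPn; rewrite sx.
Qed.

Lemma pairingE N f x :
  (forall k, (N <= k)%N -> f k * x k = 0) -> pairing f x = \sum_(k < N) f k * x k.
Proof.
move=> fx; rewrite (@fsbig_ord R 0 (@GRing.add R) N (fun k => f k * x k)).
symmetry; apply: fsbig_widen => // k [_ /=] kN.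
by apply: fx; rewrite leqNgt; apply/negP.
Qed.

Lemma pairing_ord N f x : (bound x <= N)%N -> pairing f x = \sum_(k < N) f k * x k.
Proof. by move=> xN; apply: pairingE => k Nk; rewrite (boundP (leq_trans xN Nk)) mulr0. Qed.

Lemma pairingC f x : pairing f x = pairing x f.
Proof. by apply: eq_fsbigr => k _; rewrite mulrC. Qed.

Lemma pairingDl f g x : pairing (f + g) x = pairing f x + pairing g x.
Proof.
rewrite !(@pairing_ord (bound x)) // -big_split /=.
by apply: eq_bigr => k _; exact: mulrDl.
Qed.

Lemma pairingZl a f x : pairing (a *: f) x = a * pairing f x.
Proof.
rewrite !(@pairing_ord (bound x)) // mulr_sumr.
by apply: eq_bigr => k _; rewrite mulrA.
Qed.

Lemma pairingDr f x y : pairing f (x + y) = pairing f x + pairing f y.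
Proof. by rewrite !(pairingC f) pairingDl. Qed.

Lemma pairingZr a f x : pairing f (a *: x) = a * pairing f x.
Proof. by rewrite !(pairingC f) pairingZl. Qed.

Lemma pairingNl f x : pairing (- f) x = - pairing f x.
Proof. by rewrite -scaleN1r pairingZl mulN1r. Qed.

Lemma pairingNr f x : pairing f (- x) = - pairing f x.
Proof. by rewrite -scaleN1r pairingZr mulN1r. Qed.

Lemma pairing0l x : pairing (0 : c00 R) x = 0.
Proof. by rewrite -(scale0r (0 : c00 R)) pairingZl mul0r. Qed.

Lemma pairing0r f : pairing f (0 : c00 R) = 0.
Proof. by rewrite pairingC pairing0l. Qed.

Lemma pairing_suml (I : Type) (r : seq I) (P : pred I) (F : I -> c00 R) x :
  pairing (\sum_(i <- r | P i) F i) x = \sum_(i <- r | P i) pairing (F i) x.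
Proof.
elim/big_rec2: _ => [|i a b _ <-]; first exact: pairing0l.
exact: pairingDl.
Qed.

Lemma pairing_sumr (I : Type) (r : seq I) (P : pred I) (F : I -> c00 R) f :
  pairing f (\sum_(i <- r | P i) F i) = \sum_(i <- r | P i) pairing f (F i).
Proof. by rewrite pairingC pairing_suml; apply: eq_bigr => i _; rewrite pairingC. Qed.

Lemma pairing_basisr f l : pairing f (basis_vec R l) = f l.
Proof.
rewrite (@pairingE l.+1) => [|k lk].
  rewrite big_ord_recr /= big1 ?add0r => [|k _].
    by rewrite eqxx andbT; case: l => [|l]; rewrite ?c00_at0 ?mulr0 ?mulr1.
  by rewrite ltn_eqF ?andbF ?mulr0.
by rewrite basis_vecE gtn_eqF ?andbF ?mulr0.
Qed.

Lemma pairing_basisl x l : pairing (basis_vec R l) x = x l.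
Proof. by rewrite pairingC pairing_basisr. Qed.

Lemma pairing_eq0 f x : (forall k, supp f k -> supp x k -> False) -> pairing f x = 0.
Proof.
move=> fx; rewrite (@pairing_ord (bound x)) // big1 // => k _.
have [fk|/suppPn ->] := pselect (supp f k); last by rewrite mul0r.
by have [xk|/suppPn ->] := pselect (supp x k); [case: (fx k)|rewrite mulr0].
Qed.

Lemma pairing_restr E f x : pairing (restr E f) x = pairing f (restr E x).
Proof.
rewrite !(@pairing_ord (maxn (bound x) (bound (restr E x)))) ?leq_maxl ?leq_maxr //.
by apply: eq_bigr => k _; rewrite !restrE; case: ifP; rewrite ?mul0r ?mulr0.
Qed.

Lemma pairing_restr_id E f x : (forall k, supp x k -> k \in E) ->
  pairing (restr E f) x = pairing f x.
Proof.
move=> xE; rewrite pairing_restr; congr pairing; apply: c00_ext => k.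
by rewrite restrE; case: ifPn => // kE; rewrite suppPn // => /xE; apply/negP.
Qed.

Lemma pairing_bound b f x : (forall k, `|f k| <= b) -> (forall k, `|x k| <= 1) ->
  `|pairing f x| <= b * (bound x)%:R.
Proof.
move=> fb x1; rewrite (pairing_ord _ (leqnn _)).
apply: (le_trans (ler_norm_sum _ _ _)).
have : \sum_(i < bound x) `|f i * x i| <= \sum_(i < bound x) b.
  by apply: ler_sum => i _; rewrite normrM -[b]mulr1 ler_pM.
by rewrite sumr_const card_ord mulr_natr.
Qed.

Lemma restrD E x y : restr E (x + y) = restr E x + restr E y.
Proof. by apply: c00_ext => k; rewrite !c00_DE !restrE; case: ifP; rewrite ?addr0. Qed.

Lemma restrZ E a x : restr E (a *: x) = a *: restr E x.
Proof. by apply: c00_ext => k; rewrite !c00_ZE !restrE; case: ifP; rewrite ?mulr0. Qed.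

Lemma restr0 E : restr E (0 : c00 R) = 0.
Proof. by apply: c00_ext => k; rewrite restrE if_same. Qed.

Lemma restr_sum (I : Type) (r : seq I) (P : pred I) (F : I -> c00 R) E :
  restr E (\sum_(i <- r | P i) F i) = \sum_(i <- r | P i) restr E (F i).
Proof.
elim/big_rec2: _ => [|i a b _ <-]; first exact: restr0.
exact: restrD.
Qed.

Lemma restr_restr E E' x : restr E (restr E' x) = restr (Order.meet E E') x.
Proof.
by apply: c00_ext => k; rewrite !restrE in_itvI; do 2 case: (k \in _).
Qed.

Lemma supp_restr E x k : supp (restr E x) k -> k \in E /\ supp x k.
Proof. by rewrite /supp /=; case: ifP => // _; rewrite eqxx. Qed.

Lemma suppZ a x k : supp (a *: x) k -> supp x k.
Proof. by rewrite !suppE c00_ZE mulf_eq0 negb_or => /andP[]. Qed.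

Lemma suppN x : supp (- x) = supp x.
Proof. by apply/seteqP; split => k; rewrite !suppE c00_NE oppr_eq0. Qed.

Lemma suppD x y k : supp (x + y) k -> supp x k \/ supp y k.
Proof.
have [xk|/suppPn xk] := pselect (supp x k); first by left.
by rewrite !suppE c00_DE xk add0r; right.
Qed.

Lemma supp_sum (I : choiceType) (r : seq I) (P : pred I) (F : I -> c00 R) k :
  supp (\sum_(i <- r | P i) F i) k -> exists i, [/\ i \in r, P i & supp (F i) k].
Proof.
rewrite !suppE c00_sumE => /negP H; apply: contrapT => nF; apply: H.
rewrite big_seq_cond big1 // => i /andP[ir Pi].
by apply: contrapT => Fi; apply: nF; exists i; split => //; apply/negP => /eqP.
Qed.

Lemma supp_basis l k : supp (basis_vec R l) k -> k = l.
Proof. by rewrite /supp /= => H; apply/eqP; apply: contraNT H => /negbTE ->; rewrite andbF. Qed.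

Lemma c00_expand x N : (forall c, (N <= c)%N -> x c = 0) -> x = \sum_(c < N) x c *: basis_vec R c.
Proof.
move=> x0; apply: c00_ext => c; rewrite c00_sumE.
have [cN|Nc] := ltnP c N.
  rewrite (bigD1 (Ordinal cN)) // big1 ?Monoid.mulm1.
    apply/esym/(etrans (c00_ZE (x c) (basis_vec R c) c)); rewrite basis_vecE eqxx andbT.
    by case: (c) => [|c']; rewrite ?c00_at0 ?mulr1 ?mul0r.
  move=> i; rewrite -val_eqE /= => ic; apply: (etrans (c00_ZE (x i) (basis_vec R i) c)).
  by rewrite basis_vecE [c == i]eq_sym (negbTE ic) andbF mulr0.
rewrite big1 ?x0 // => i _; apply: (etrans (c00_ZE (x i) (basis_vec R i) c)).
by rewrite basis_vecE gtn_eqF ?andbF ?mulr0 //; apply: leq_trans Nc.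
Qed.

Lemma hull_suppS x k : supp x k -> hull_supp x k.
Proof. by move=> xk; exists k, k; rewrite !leqnn. Qed.

Lemma set_ltS (A A' B B' : set nat) : A `<=` A' -> B `<=` B' -> set_lt A' B' -> set_lt A B.
Proof. by move=> AA BB AB a b /AA Aa /BB; exact: AB. Qed.

(** Successive families have disjoint supports, so that at each coordinate
    at most one of them contributes. *)
Lemma succ_sum_le d (h : nat -> c00 R) (b : R) k :
  0 <= b -> (forall i, (i < d)%N -> `|h i k| <= b) ->
  (forall i i', (i < i' < d)%N -> set_lt (supp (h i)) (supp (h i'))) ->
  `|(\sum_(i < d) h i) k| <= b.
Proof.
move=> b0 hb hs; rewrite c00_sumE.
have [/existsP[i hi]|/existsPn H] := boolP [exists i : 'I_d, h i k != 0]; last first.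
  by rewrite big1 ?normr0 // => i _; apply/eqP/negPn/H.
rewrite (bigD1 i) //= big1 ?addr0; first exact: hb.
move=> j ji; apply/eqP/negPn/negP => hj.
move: ji; rewrite -val_eqE /= neq_ltn => /orP[] ij.
  by have := hs j i; rewrite ij ltn_ord => /(_ isT k k hj hi); rewrite ltnn.
by have := hs i j; rewrite ij ltn_ord => /(_ isT k k hi hj); rewrite ltnn.
Qed.

End Coordinates.

(** * Rational vectors *)

Section Rationals.
Variable R : realType.

Definition ratnum : set R := [set a | exists q : rat, a = ratr q].

Lemma ratnum0 : ratnum 0. Proof. by exists 0; rewrite rmorph0. Qed.
Lemma ratnum1 : ratnum 1. Proof. by exists 1; rewrite rmorph1. Qed.

Lemma ratnumD a b : ratnum a -> ratnum b -> ratnum (a + b).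
Proof. by move=> [p ->] [q ->]; exists (p + q); rewrite rmorphD. Qed.

Lemma ratnumM a b : ratnum a -> ratnum b -> ratnum (a * b).
Proof. by move=> [p ->] [q ->]; exists (p * q); rewrite rmorphM. Qed.

Lemma ratnumN a : ratnum a -> ratnum (- a).
Proof. by move=> [p ->]; exists (- p); rewrite rmorphN. Qed.

Lemma ratnumV a : ratnum a -> ratnum a^-1.
Proof. by move=> [p ->]; exists (p^-1); rewrite fmorphV. Qed.

Lemma ratnum_nat k : ratnum k%:R.
Proof. by exists k%:R; rewrite rmorph_nat. Qed.

Lemma ratnum_sum (I : Type) (r : seq I) (P : pred I) (F : I -> R) :
  (forall i, P i -> ratnum (F i)) -> ratnum (\sum_(i <- r | P i) F i).
Proof. by move=> H; elim/big_rec: _ => [|i a /H]; [exact: ratnum0|exact: ratnumD]. Qed.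

(** Only vectors with rational coordinates can be entries of a coded sequence,
    so every vector that is going to be coded has to be kept rational. *)
Definition ratvec (x : c00 R) : Prop := forall k, ratnum (x k).

Lemma ratvecZ a x : ratnum a -> ratvec x -> ratvec (a *: x).
Proof. by move=> ra rx k; rewrite c00_ZE; apply: ratnumM. Qed.

Lemma ratvecN x : ratvec x -> ratvec (- x).
Proof. by move=> rx k; rewrite c00_NE; apply: ratnumN. Qed.

Lemma ratvecD x y : ratvec x -> ratvec y -> ratvec (x + y).
Proof. by move=> rx ry k; rewrite c00_DE; apply: ratnumD. Qed.

Lemma ratvec_sum (I : choiceType) (r : seq I) (P : pred I) (F : I -> c00 R) :
  (forall i, i \in r -> P i -> ratvec (F i)) -> ratvec (\sum_(i <- r | P i) F i).
Proof.
move=> H k; rewrite c00_sumE big_seq_cond; apply: ratnum_sum => i /andP[ir Pi].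
exact: H.
Qed.

Lemma ratvec_restr E x : ratvec x -> ratvec (restr E x).
Proof. by move=> rx k; rewrite restrE; case: ifP => _ //; exact: ratnum0. Qed.

Lemma ratvec_basis l : ratvec (basis_vec R l).
Proof. by move=> k; rewrite basis_vecE; apply: ratnum_nat. Qed.

Lemma ratnum_pairing f x : ratvec f -> ratvec x -> ratnum (pairing f x).
Proof.
move=> rf rx; rewrite (pairing_ord _ (leqnn _)).
by apply: ratnum_sum => i _; apply: ratnumM.
Qed.

End Rationals.

(** * Growth of the parameters *)

Ltac linlia :=
  repeat match goal with
  | H : ?T |- _ =>
    lazymatch T with
    | nat => fail
    | context [expn _ _] => clear H
    | is_true (leq _ _) => fail
    | is_true (andb (leq _ _) (leq _ _)) => fail
    | @eq _ ?a _ => let _ := constr:(a : nat) in fail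
    | is_true (negb (_ == _)) => fail
    | _ => clear H
    end
  end; lia.

Section Growth.
Variables (m n s : nat -> nat) (G : growth m n s).
Local Open Scope nat_scope.

Lemma m_exp j : 0 < j -> m j = 2 ^ (5 ^ j.-1).
Proof.
case: j => // j _; elim: j => [|j IH]; first by rewrite (growth_m1 G).
by rewrite (growth_mS G) // IH -expnM /= expnSr.
Qed.

Lemma m_gt0 j : 0 < j -> 0 < m j.
Proof. by move=> /(growth_pos G)[]. Qed.

Lemma n_gt0 j : 0 < j -> 0 < n j.
Proof. by move=> /(growth_pos G)[]. Qed.

Lemma m_ge2 j : 0 < j -> 2 <= m j.
Proof. by move=> j0; rewrite m_exp // -{1}(expn1 2) leq_exp2l // expn_gt0. Qed.

Lemma m_mono i j : 0 < i -> i <= j -> m i <= m j.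
Proof.
move=> i0 ij; rewrite !m_exp ?(leq_trans i0) // leq_exp2l // leq_exp2l //.
by rewrite -!subn1 leq_sub2r.
Qed.

Lemma m5_le i j : 0 < i -> i < j -> m i ^ 5 <= m j.
Proof. by move=> i0 ij; rewrite -(growth_mS G) // m_mono. Qed.

Lemma m_gt j : 0 < j -> j < m j.
Proof.
move=> j0; rewrite m_exp //; apply: (@leq_ltn_trans (5 ^ j.-1)); last exact: ltn_expl.
by case: j j0 => // j _ /=; exact: ltn_expl.
Qed.

(** As m_q = 2 ^ t with t = 5 ^ (q-1), this gives n_q >= (4 n_(q-1)) ^ (3 t), which leaves
    room for unfolding functionals of index below q some t or 2 t times. *)
Lemma s_ge q : 1 < q -> 3 * 5 ^ q.-1 <= s q.-1.
Proof.
case: q => // -[//|q] _ /=; have := growth_s G (isT : 0 < q.+1).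
by rewrite m_exp // -expnM leq_exp2l // mulnC.
Qed.

Lemma nE q : 1 < q -> n q = (4 * n q.-1) ^ s q.-1.
Proof. by case: q => // -[//|q] _; rewrite (growth_nS G). Qed.

Lemma n_step j : 0 < j -> 4 * n j <= n j.+1.
Proof.
move=> j0; rewrite (growth_nS G) // -[X in X <= _]expn1 leq_pexp2l ?muln_gt0 ?n_gt0 //.
by have [_ _] := growth_pos G j0.
Qed.

Lemma n_mono i j : 0 < i -> i <= j -> n i <= n j.
Proof.
move=> i0; elim: j => [|j IH]; first by rewrite leqn0 => /eqP <-.
rewrite leq_eqVlt => /orP[/eqP -> //|ij]; apply: (leq_trans (IH ij)).
by apply: leq_trans (n_step (leq_trans i0 ij)); rewrite leq_pmull.
Qed.

Lemma m6_le_n q : 1 < q -> m q ^ 6 <= n q.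
Proof.
move=> q1; rewrite nE // m_exp ?(ltnW q1) //.
apply: (@leq_trans (4 ^ s q.-1)); last first.
  by rewrite leq_exp2r ?leq_pmulr ?n_gt0 //; case: q q1 => [|[]] // q _;
     have [] := growth_pos G (isT : 0 < q.+1).
rewrite -expnM -[4]/(2 ^ 2) -expnM leq_exp2l //.
have := s_ge q1; move: (5 ^ _) (s _) => a b; lia.
Qed.

Lemma m2_le_n j : 0 < j -> m j ^ 2 <= n j.
Proof.
case: j => // -[_|j _]; first by rewrite (growth_m1 G) (growth_n1 G).
by apply: leq_trans (m6_le_n _) => //; rewrite leq_pexp2l ?m_gt0.
Qed.

Lemma n_sqr_le i j : 0 < i -> i < j -> n i * n i <= n j.
Proof.
move=> i0 ij; apply: leq_trans (n_mono _ ij) => //; rewrite (growth_nS G) //.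
apply: (@leq_trans ((4 * n i) ^ 2)).
  by rewrite expnS expn1 leq_mul // leq_pmull.
rewrite leq_pexp2l ?muln_gt0 ?n_gt0 //.
have := @s_ge i.+1 i0; have : 0 < 5 ^ i.+1.-1 by rewrite expn_gt0.
by move=> /=; lia.
Qed.

Lemma n_even q : 1 < q -> ~~ odd (n q).
Proof.
move=> q1; rewrite nE // oddX negb_or; apply/andP; split; last by rewrite oddM.
have := s_ge q1; have : 0 < 5 ^ q.-1; first by rewrite expn_gt0.
by move: (5 ^ _) (s _) => a b; lia.
Qed.

Lemma pow3_le_n q : 1 < q -> (4 * n q.-1) ^ (3 * 5 ^ q.-1) <= n q.
Proof.
move=> q1; rewrite (nE q1) leq_pexp2l ?s_ge // muln_gt0 n_gt0 //.
by rewrite -ltnS prednK // ltnW.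
Qed.

Lemma m2_le_pow q : 1 < q -> m q ^ 2 <= (4 * n q.-1) ^ 5 ^ q.-1.
Proof.
move=> q1; rewrite m_exp ?(ltnW q1) // -expnM mulnC expnM leq_exp2r ?expn_gt0 //.
by rewrite leq_pmulr // n_gt0 // -ltnS prednK // ltnW.
Qed.

End Growth.

(** * Decomposition of the norming set *)

Section NormingSetStructure.
Variables (R : realType) (m n s : nat -> nat).
Variable sigma : seq (c00 R * c00 R) -> nat.
Hypotheses (G : growth m n s) (C : coding m sigma).
Implicit Types (x y f g h : c00 R) (phi : seq (c00 R * c00 R)).

Notation Kset := (Kset m n sigma).
Notation K := (norming_set m n sigma).
Notation basis_average := (basis_average m n).
Notation special_seq := (special_seq m n sigma).

Lemma sum_pairs (c : nat -> c00 R) k :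
  \sum_(l < 2 * k) c l = \sum_(1 <= i < k.+1) (c (2 * i).-2 + c (2 * i).-1).
Proof.
elim: k => [|k IH]; first by rewrite big_ord0 big_geq.
rewrite big_nat_recr //= -IH mulnS addnC addn2 !big_ord_recr /= addrA.
by congr (_ + c _ + c _); lia.
Qed.

Lemma Kset_mono1 i p : Kset i p `<=` Kset i.+1 p.
Proof.
rewrite /= /K_step; case: eqP => [->|p0]; first by case: i => [|i] /=.
case: ifP => [_|/negbFE op]; first by move=> f; left.
case: ifP => [_|p3]; first by move=> f; left.
have -> : p = 1%N by case: p p0 op p3 => [|[|[|]]].
by case: i => [|i] //=; rewrite /K_step.
Qed.

Lemma Kset_mono i i' p : (i <= i')%N -> Kset i p `<=` Kset i' p.
Proof.
move=> /subnK <-; elim: (i' - i)%N => [|d IH] //= f /IH; exact: Kset_mono1.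
Qed.

Lemma Kset_K i p f : Kset i p f -> K f.
Proof. by move=> Kf; exists i => //; exists p. Qed.

Lemma K_basis l : (0 < l)%N -> K (basis_vec R l).
Proof. by move=> l0; apply: (@Kset_K 0 0) => /=; exists l => //; left. Qed.

Lemma Qs_take phi i : Qs phi -> (0 < i)%N -> Qs (take i phi).
Proof.
move=> [p0 pQ pl] i0; have [ilt|] := ltnP i (size phi); last by move=> /take_oversize ->.
have st : size (take i phi) = i by rewrite size_take ilt.
have nt j : (j <= i)%N -> (0 < j)%N -> nth (0, 0) (take i phi) j.-1 = nth (0, 0) phi j.-1.
  by move=> ji j0; rewrite nth_take //; lia.
split; rewrite ?st // => j jr; rewrite /xs /fs !nt; try lia.
  by apply: pQ; lia.
by apply: pl; lia.
Qed.

Lemma coding_ge2 phi : Qs phi -> exists2 j, (0 < j)%N & sigma phi = j.*2.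
Proof. by move=> /(coding_even C)[j j0 ->]; exists j => //; rewrite mul2n. Qed.

Lemma coding_gt1 phi : Qs phi -> (1 < sigma phi)%N /\ ~~ odd (sigma phi).
Proof. by move=> /coding_ge2[j j0 ->]; rewrite odd_double; split => //; lia. Qed.

Definition hull2 phi i : set nat := hull_supp (xs phi i) `|` hull_supp (fs phi i).

Lemma Qs_lt phi i j : Qs phi -> (1 <= i)%N -> (i < j)%N -> (j <= size phi)%N ->
  set_lt (hull2 phi i) (hull2 phi j).
Proof.
move=> [p0 pQ pl] i1; elim: j => // j IH; rewrite ltnS leq_eqVlt => /orP[/eqP <-|ij] jp.
  by apply: pl; rewrite i1.
have [] := pQ j; first by lia.
move=> [[c xc] _] _; have hc : hull2 phi j c by left; apply: hull_suppS.
move=> a b ha hb; apply: (@ltn_trans c); first by apply: (IH ij) => //; lia.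
by apply: (pl j) => //; lia.
Qed.

Lemma Qs_supp_lt phi i j : Qs phi -> (1 <= i)%N -> (i < j)%N -> (j <= size phi)%N ->
  set_lt (supp (fs phi i)) (supp (fs phi j)).
Proof.
move=> pQ i1 ij jp; apply: set_ltS (Qs_lt pQ i1 ij jp) => k kf; right; exact: hull_suppS.
Qed.

Lemma basis_average_K p x f : (1 < p)%N -> ~~ odd p -> basis_average p x f -> Kset 1 p f.
Proof.
move=> p1 ep [L [[uL sL] L1 _ ->]].
rewrite /= /K_step ep /=; case: eqP => [p0|_]; first by rewrite p0 in p1.
right; exists (n p), (fun i => basis_vec R (nth 0%N (sort leq L) i.-1)).
have ss : size (sort leq L) = n p by rewrite size_sort.
split.
- by rewrite (n_gt0 G) ?(ltnW p1) ?leqnn.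
- move=> i ir; exists 0%N => //; exists (nth 0%N (sort leq L) i.-1); last by left.
  by apply: L1; rewrite -(mem_sort leq) mem_nth // ss; lia.
- move=> i i' i1 ii' i'd a b /supp_basis -> /supp_basis ->.
  have so : sorted ltn (sort leq L).
    by rewrite ltn_sorted_uniq_leq sort_uniq uL sort_sorted //; exact: leq_total.
  by apply: (sorted_ltn_nth ltn_trans 0%N so); rewrite ?inE ?ss; lia.
- congr (_ *: _); rewrite -(perm_big _ (permEl (perm_sort leq L))) /=.
  by rewrite (big_nth 0%N) ss big_add1.
Qed.

(** The pieces of a functional, one step down in its generation: in the odd case
    they are cut by the interval E and carry the coefficients lambda, which takes
    them out of the norming set. *)
Definition subfunctional i h : Prop := exists (t : R) E j g,
  [/\ `|t| <= 1, Kset i j g & h = t *: restr E g].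

Lemma subfunctional_id i j g : Kset i j g -> subfunctional i g.
Proof.
move=> Kg; exists 1, `]-oo, +oo[, j, g; rewrite normr1 scale1r; split => //.
by apply: c00_ext => k; rewrite restrE in_itv.
Qed.

Definition successive d (h : nat -> c00 R) : Prop :=
  forall i i', (i < i' < d)%N -> set_lt (supp (h i)) (supp (h i')).

Lemma special_q k phi : special_seq k phi -> forall i, (0 < i <= k)%N ->
  (1 < sigma (take (2 * i).-1 phi))%N /\ ~~ odd (sigma (take (2 * i).-1 phi)).
Proof.
by move=> [[pQ _] _ _ _] i ik; apply: coding_gt1; apply: Qs_take => //; lia.
Qed.

Lemma special_odd k phi : special_seq k phi -> forall i, (0 < i <= k)%N -> exists p,
  [/\ (1 < p)%N, ~~ odd p, basis_average p (xs phi (2 * i).-1) (fs phi (2 * i).-1),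
      (1 < i)%N -> p = sigma (take (2 * i).-2 phi) &
      i = 1%N -> (2 * k)%:R < Num.sqrt (m p)%:R :> R].
Proof.
move=> [[pQ sp] [j [j1 jk b1]] _ bi] i /andP[i0 ik].
have [->|i1] := eqVneq i 1%N; first by exists (2 * j)%N; split => //; lia.
have i2 : (1 < i)%N by lia.
have [] := @coding_gt1 (take (2 * i).-2 phi); first by apply: Qs_take => //; lia.
move=> q1 q2; exists (sigma (take (2 * i).-2 phi)); split => // [|ei]; last by lia.
have := bi i.-1; have -> : (2 * i.-1)%N = (2 * i).-2 by lia.
have -> : (2 * i).-2.+1 = (2 * i).-1 by lia.
by apply; lia.
Qed.

(** The condition imposed on x_(2i), against all functionals of the index of f_(2i),
    is what keeps the coefficients lambda bounded by 1. *)
Lemma lam_le1 q k psi (L : nat -> set (c00 R)) (g : nat -> c00 R) (lam : nat -> R) a :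
  (1 < q)%N -> special_seq k psi -> (0 < a <= k)%N ->
  L (sigma (take (2 * a).-1 psi)) (g a) ->
  (forall h, L (sigma (take (2 * a).-1 psi)) h ->
     `|pairing h (xs psi (2 * a))| <= (m (sigma (take (2 * a).-1 psi)))%:R^-1) ->
  (if pairing (g a) (xs psi (2 * a)) != 0
   then lam a = pairing (g a) ((m (sigma (take (2 * a).-1 psi)))%:R *: xs psi (2 * a))
   else lam a = (n q ^ 2)%:R^-1 \/ lam a = - (n q ^ 2)%:R^-1) ->
  `|lam a| <= 1.
Proof.
move=> q1 sp ak Lg gx; have {}gx := gx _ Lg.
have [p1 _] := special_q sp ak.
have m0 : (0 : R) < (m (sigma (take (2 * a).-1 psi)))%:R by rewrite ltr0n (m_gt0 G) //; lia.
case: ifP => [_ ->|_ H].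
  by rewrite pairingZr normrM gtr0_norm // -ler_pdivlMl // mulr1.
have n0 : (1 : R) <= (n q ^ 2)%:R by rewrite ler1n expn_gt0 (n_gt0 G) //; lia.
have -> : `|lam a| = (n q ^ 2)%:R^-1.
  by case: H => ->; rewrite ?normrN ger0_norm // invr_ge0 ler0n.
by rewrite invf_le1 // (lt_le_trans ltr01).
Qed.

(** One step of the generation of the norming set. In the odd case the averages
    f_(2i-1) are functionals of the previous level because that level is at
    least 1, as it contains some functional of even index. *)
Lemma Kset_decomp i p f : Kset i p f -> (0 < p)%N -> exists i' d (h : nat -> c00 R),
  [/\ (i' < i)%N, (1 < p)%N /\ (0 < d <= n p)%N, forall l, (l < d)%N -> subfunctional i' (h l),
      successive d h & f = (m p)%:R^-1 *: \sum_(l < d) h l].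
Proof.
elim: i => [|i IH] /=; first by case: eqP => // ->.
rewrite /K_step => + p0; have -> : (p == 0)%N = false by lia.
have old : Kset i p f -> exists i' d (h : nat -> c00 R),
  [/\ (i' < i.+1)%N, (1 < p)%N /\ (0 < d <= n p)%N, forall l, (l < d)%N -> subfunctional i' (h l),
      successive d h & f = (m p)%:R^-1 *: \sum_(l < d) h l].
  move=> /IH /(_ p0)[i' [d [h [ii' ? ? ? ?]]]]; exists i', d, h; split => //.
  exact: (ltn_trans ii').
case: ifP => [ep [//|[d [g [dn gK gs ->]]]]|/negbFE op].
  exists i, d, (fun l => g l.+1); split => //; first by split; lia.
  - by move=> l ld; have [|j _ /subfunctional_id] := gK l.+1; rewrite ?ltnS.
  - by move=> a b /andP[ab bd]; apply: gs.
  - by rewrite big_add1 big_mkord.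
case: ifP => // p3 [//|[phi _ [k [b [E [g [lam [[nk sp] Kf Kg lamE ->]]]]]]]].
have [[pQ szp] _ _ _] := sp.
pose c l := if odd l then g l./2.+1 else lam l./2.+1 *: fs phi l.+1.
have lam1 a : (0 < a <= k)%N -> `|lam a| <= 1.
  move=> ak; have [Lg _ gx] := Kg a ak.
  exact: lam_le1 (ltnW p3) sp ak Lg gx (lamE a ak).
have suppc l : (l < 2 * k)%N -> supp (c l) `<=` supp (fs phi l.+1).
  move=> lk a; rewrite /c; case: ifP => ol; last exact: suppZ.
  have [|_ -> _] := Kg l./2.+1; first by lia.
  by have -> // : (2 * l./2.+1)%N = l.+1 by lia.
have i_gt0 : (0 < 2 * k)%N -> (0 < i)%N.
  move=> k0; have [|+ _ _] := Kg 1%N; first by lia.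
  have [|q1 _] := special_q sp (i := 1%N); first by lia.
  by case: (i) => //=; case: eqP => // q0; rewrite q0 in q1.
pose sg : R := (-1) ^+ b.
exists i, (2 * k)%N, (fun l => sg *: restr E (c l)); split => //.
- by rewrite -nk (n_gt0 G) // leqnn; split => //; lia.
- move=> l lk; rewrite /c; case: ifP => ol.
    exists sg, E, (sigma (take (2 * l./2.+1).-1 phi)), (g l./2.+1).
    have [|Lg _ _] := Kg l./2.+1; first by lia.
    by split => //; rewrite /sg normrX normrN normr1 expr1n.
  have [|p' [p'1 p'2 bA _ _]] := special_odd sp (i := l./2.+1); first by lia.
  exists (sg * lam l./2.+1), E, p', (fs phi l.+1); split.
  + by rewrite normrM /sg normrX normrN normr1 expr1n mul1r; apply: lam1; lia.
  + apply: (@Kset_mono 1); first by apply: i_gt0; lia.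
    have -> : l.+1 = (2 * l./2.+1).-1 by lia.
    exact: basis_average_K bA.
  + by rewrite restrZ scalerA.
- move=> a a' /andP[aa' a'k]; apply: set_ltS (@Qs_supp_lt phi a.+1 a'.+1 pQ _ _ _) => //.
  + by move=> e /suppZ /supp_restr[_]; apply: suppc; lia.
  + by move=> e /suppZ /supp_restr[_]; apply: suppc; lia.
  + by rewrite szp.
- rewrite -scaler_sumr -restr_sum scalerA mulrC; congr (_ *: restr _ _).
  rewrite sum_pairs; apply: eq_big_nat => a a1; rewrite /c.
  have -> : odd (2 * a).-2 = false by lia.
  have -> : odd (2 * a).-1 by lia.
  have -> : (2 * a).-2./2.+1 = a by lia.
  have -> : (2 * a).-1./2.+1 = a by lia.
  by have -> : (2 * a).-2.+1 = (2 * a).-1 by lia.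
Qed.

End NormingSetStructure.

(** * Closure properties of the norming set and of its polar *)

Section NormingSetClosure.
Variables (R : realType) (m n s : nat -> nat).
Variable sigma : seq (c00 R * c00 R) -> nat.
Hypotheses (G : growth m n s) (C : coding m sigma).
Implicit Types (x y f g h : c00 R) (phi : seq (c00 R * c00 R)).

Notation Kset := (Kset m n sigma).
Notation K := (norming_set m n sigma).

Lemma Kset_opp i p f : Kset i p f -> Kset i p (- f).
Proof.
have K0N : @K0 R `<=` [set g | @K0 R (- g)].
  move=> g [l l1 [->|->]]; exists l => //; first by right.
  by left; rewrite opprK.
elim: i p f => [|i IH] p f /=; first by case: eqP => // _; exact: K0N.
rewrite /K_step; case: ifP => _; first exact: K0N.
case: ifP => _.
  case=> [/IH|[d [g [dn gK gs ->]]]]; first by left.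
  right; exists d, (fun l => - g l); split => //.
  - by move=> l ld; have [j _ /IH] := gK l ld; exists j.
  - by move=> l l' l1 ll ld; rewrite !suppN; apply: gs.
  - by rewrite sumrN scalerN.
case: ifP => // _ [/IH|[phi _ [k [b [E [g [lam [? ? ? ? ->]]]]]]]]; first by left.
right; exists phi => //; exists k, (~~ b), E, g, lam; split => //.
by rewrite -scaleNr -mulNr; case: b => /=; rewrite expr1 expr0 ?opprK.
Qed.

Lemma K_opp f : K f -> K (- f).
Proof. by move=> [i _ [p _ /Kset_opp Kf]]; exact: Kset_K Kf. Qed.

Lemma even_part_seq (L : nat -> set (c00 R)) p (r : seq (c00 R)) :
  (0 < size r <= n p)%N -> (forall g, g \in r -> (\bigcup_j L j) g) ->
  pairwise (fun f g => `[< set_lt (supp f) (supp g) >]) r ->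
  even_part m n L p ((m p)%:R^-1 *: \sum_(g <- r) g).
Proof.
have [N sN] : exists N, size r = N by exists (size r).
rewrite sN => Nn rL /(pairwiseP 0) rs; exists N, (fun i => nth 0 r i.-1); split => //.
- by move=> i ir; apply: rL; apply: mem_nth; rewrite sN; lia.
- by move=> i i' i1 ii' ir; apply/asboolP; apply: rs; rewrite ?inE ?sN; lia.
- by rewrite (big_nth 0) sN big_add1.
Qed.

Lemma Kset_restr i p f E : Kset i p f -> Kset i p (restr E f) \/ restr E f = 0.
Proof.
have K0E g : @K0 R g -> @K0 R (restr E g) \/ restr E g = 0.
  case=> l l1 gE; have [lE|lE] := boolP (l \in E).
    left; suff -> : restr E g = g by exists l.
    apply: c00_ext => k; rewrite restrE; case: ifPn => // kE; apply/esym/suppPn.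
    by case: gE => ->; rewrite ?suppN => /supp_basis kl; rewrite kl lE in kE.
  right; apply: c00_ext => k; rewrite restrE; case: ifP => // kE; apply/suppPn.
  by case: gE => ->; rewrite ?suppN => /supp_basis kl; rewrite -kl kE in lE.
elim: i p f => [|i IH] p f /=; first by case: eqP => // _ /K0E.
rewrite /K_step; case: ifP => _; first exact: K0E.
case: ifP => _.
  case=> [/IH[]|[d [g [dn gK gs ->]]]]; [by left; left|by right|].
  pose r := [seq f <- [seq restr E (g l) | l <- iota 1 d] | f != 0].
  have -> : restr E ((m p)%:R^-1 *: \sum_(1 <= l < d.+1) g l) = (m p)%:R^-1 *: \sum_(h <- r) h.
    rewrite restrZ restr_sum /r big_filter; congr (_ *: _).
    rewrite [RHS]big_mkcond /= big_map /index_iota subn1 /=.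
    by apply: eq_bigr => l _; case: eqP => //= ->.
  have [r0|r0] := posnP (size r); first by right; rewrite (size0nil r0) big_nil scaler0.
  left; right; apply: even_part_seq.
  - rewrite r0 size_filter; apply: (leq_trans (count_size _ _)).
    by rewrite size_map size_iota; lia.
  - move=> h; rewrite mem_filter => /andP[/eqP h0 /mapP[l]]; rewrite mem_iota => lr hE.
    have [|j _ /IH] := gK l; first by lia.
    by move=> []; rewrite -hE // => Kh; exists j.
  - apply: (subseq_pairwise (filter_subseq _ _)).
    rewrite pairwise_map; apply/(pairwiseP 0%N) => a b; rewrite !inE size_iota => ad bd ab.
    rewrite !nth_iota // !add1n /=.
    apply: (@set_ltS _ (supp (g a.+1)) _ (supp (g b.+1)));
      by [move=> k /supp_restr[]|move=> k /supp_restr[]|apply: gs].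
case: ifP => // _ [/IH[]|[phi _ [k [b [E' [g [lam [? ? ? ? ->]]]]]]]].
- by left; left.
- by right.
left; right; exists phi => //; exists k, b, (Order.meet E E'), g, lam; split => //.
by rewrite restrZ restr_restr.
Qed.

Lemma Kset_rat i p f : Kset i p f -> ratvec f.
Proof.
have K0r g : @K0 R g -> ratvec g.
  by case=> l _ [->|->]; [|apply: ratvecN]; exact: ratvec_basis.
have mr q : ratnum (q%:R^-1 : R) by apply/ratnumV/ratnum_nat.
elim: i p f => [|i IH] p f /=; first by case: eqP => // _; exact: K0r.
rewrite /K_step; case: ifP => _; first exact: K0r.
case: ifP => _.
  case=> [/IH //|[d [g [dn gK gs ->]]]].
  apply: ratvecZ => //; apply: ratvec_sum => l; rewrite mem_index_iota => ld _.
  by have [j _ /IH] := gK l ld.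
case: ifP => // _ [/IH //|[phi _ [k [b [E' [g [lam [[nk [[[_ pQ _] sp] _ _ _]] _ Kg lamE ->]]]]]]]].
apply: ratvecZ; first by apply: ratnumM => //; case: b; rewrite ?expr1 ?expr0;
  [apply: ratnumN|]; exact: ratnum1.
apply/ratvec_restr/ratvec_sum => l; rewrite mem_index_iota ltnS => ld _.
have [/IH rg _ _] := Kg l ld.
have Qr a : (0 < a <= 2 * k)%N -> ratvec (xs phi a) /\ ratvec (fs phi a).
  by rewrite -sp => /pQ[[_ rx] [_ rf]]; split => c; [have [] := rx c|have [] := rf c].
apply: ratvecD => //; apply: ratvecZ; last by have [] := Qr (2 * l).-1; first by lia.
have := lamE l ld; case: ifP => _.
  move=> ->; apply: ratnum_pairing => //; apply: ratvecZ; first exact: ratnum_nat.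
  by have [] := Qr (2 * l)%N; first by lia.
by case=> ->; [|apply: ratnumN]; exact: mr.
Qed.

(** The inequality norm_K x <= b, without extended real numbers. *)
Definition nle x (b : R) : Prop := forall f, K f -> `|pairing f x| <= b.

(** The polar of the unit ball. Pieces of functionals of odd index need not be in
    the norming set; membership in the polar is the property that they retain. *)
Definition polar_ball f : Prop := forall x b, nle x b -> `|pairing f x| <= b.

(** Functionals of weight w, described by their action only. Unlike the members of
    index w of the norming set they are stable under scalars of modulus at most 1,
    so that the terms lambda f_(2i-1) of an odd functional are among them. *)
Definition weighted w f : Prop := exists d (g : nat -> c00 R),
  [/\ (d <= n w)%N, forall l, (l < d)%N -> polar_ball (g l), successive d g &
      f = (m w)%:R^-1 *: \sum_(l < d) g l].

Lemma K_ball f : K f -> polar_ball f.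
Proof. by move=> Kf x b; apply. Qed.

Lemma nle_ge0 x b : nle x b -> 0 <= b.
Proof. by move=> /(_ _ (@K_basis R m n sigma 1 isT)); apply: le_trans. Qed.

Lemma nle_coord x b k : nle x b -> `|x k| <= b.
Proof.
case: k => [|k] xb; first by rewrite c00_at0 normr0 (nle_ge0 xb).
by rewrite -pairing_basisl; apply/xb/K_basis.
Qed.

Lemma nle_restr x b E : nle x b -> nle (restr E x) b.
Proof.
move=> xb f [i _ [p _ Kf]]; rewrite -pairing_restr.
have [/Kset_K/xb //|->] := Kset_restr E Kf.
by rewrite pairing0l normr0 (nle_ge0 xb).
Qed.

Lemma nle_le x b c : b <= c -> nle x b -> nle x c.
Proof. by move=> bc xb f /xb; move/le_trans; apply. Qed.

Lemma nleD x y b c : nle x b -> nle y c -> nle (x + y) (b + c).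
Proof.
move=> xb yc f Kf; rewrite pairingDr; apply: (le_trans (ler_normD _ _)).
by apply: lerD; [exact: xb|exact: yc].
Qed.

Lemma nleZ a x b : nle x b -> nle (a *: x) (`|a| * b).
Proof. by move=> xb f /xb xf; rewrite pairingZr normrM ler_wpM2l. Qed.

Lemma nle0 b : 0 <= b -> nle 0 b.
Proof. by move=> b0 f _; rewrite pairing0r normr0. Qed.

Lemma nle_sum (I : Type) (r : seq I) (P : pred I) (F : I -> c00 R) (b : I -> R) :
  (forall i, P i -> nle (F i) (b i)) ->
  nle (\sum_(i <- r | P i) F i) (\sum_(i <- r | P i) b i).
Proof.
move=> Fb; elim/big_rec2: _ => [|i c x Pi xc]; first exact: nle0.
by apply: nleD => //; exact: Fb.
Qed.

Lemma ball_restr f E : polar_ball f -> polar_ball (restr E f).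
Proof. by move=> Bf x b /(nle_restr E) /Bf; rewrite pairing_restr. Qed.

Lemma ballZ f t : `|t| <= 1 -> polar_ball f -> polar_ball (t *: f).
Proof.
move=> t1 Bf x b xb; rewrite pairingZl normrM -[leRHS]mul1r.
by apply: ler_pM => //; exact: Bf.
Qed.

Lemma subfunctional_ball i h : subfunctional m n sigma i h -> polar_ball h.
Proof.
move=> [t [E [j [g [t1 Kg ->]]]]]; apply/ballZ/ball_restr/K_ball => //.
exact: Kset_K Kg.
Qed.

Lemma Kset_weighted i w f : (0 < w)%N -> Kset i w f -> (1 < w)%N /\ weighted w f.
Proof.
move=> w0 /(Kset_decomp G C) /(_ w0)[i' [d [h [_ [w1 dn] hs hd ->]]]]; split => //.
exists d, h; split => //; first by case/andP: dn.
by move=> l /hs /subfunctional_ball.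
Qed.

Lemma K_cases f : K f ->
  (exists2 l, (0 < l)%N & f = basis_vec R l \/ f = - basis_vec R l) \/
  exists w i, [/\ (1 < w)%N, Kset i w f & weighted w f].
Proof.
case=> i _ [[|w] _].
  by case: i => [|i] /=; left.
by move=> Kf; have [] := Kset_weighted (ltn0Sn w) Kf; right; exists w.+1, i.
Qed.

Lemma minv_le1 w : (m w)%:R^-1 <= 1 :> R.
Proof.
case: (m w) => [|k]; first by rewrite invr0.
by rewrite invf_le1 ?ltr0n // ler1n.
Qed.

(** Induction on the level: the pieces of a functional have disjoint supports, so
    that they do not add up at a coordinate. *)
Lemma K_coord_le1 f k : K f -> `|f k| <= 1.
Proof.
case=> i _ [p _]; elim/ltn_ind: i p f => i IH [|p] f.
  have -> : Kset i 0 = @K0 R by case: i {IH}.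
  case=> l _ fE; have : `|basis_vec R l k| <= 1.
    by rewrite basis_vecE normr_nat; case: (_ && _).
  by case: fE => -> //; rewrite c00_NE normrN.
move=> /(Kset_decomp G C) /(_ isT)[i' [d [h [ii' [p1 dn] hs hd ->]]]].
rewrite c00_ZE normrM -[leRHS]mulr1 ger0_norm ?invr_ge0 //.
apply: ler_pM; rewrite ?invr_ge0 ?minv_le1 //.
apply: (@succ_sum_le R d h) => // l /hs[t [E [j [g [t1 Kg ->]]]]].
rewrite c00_ZE normrM -[leRHS]mulr1; apply: ler_pM => //.
by rewrite restrE; case: ifP => _; rewrite ?normr0 //; apply: IH Kg.
Qed.

Lemma nle_basis l : nle (basis_vec R l) 1.
Proof. by move=> f Kf; rewrite pairing_basisr; apply: K_coord_le1. Qed.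

Lemma ball_coord f k : polar_ball f -> `|f k| <= 1.
Proof. by move=> /(_ _ _ (nle_basis k)); rewrite pairing_basisr. Qed.

Lemma weighted_coord w f k : weighted w f -> `|f k| <= (m w)%:R^-1.
Proof.
move=> [d [g [dn gB gs ->]]]; rewrite c00_ZE normrM ger0_norm ?invr_ge0 //.
rewrite -[leRHS]mulr1 ler_wpM2l ?invr_ge0 //; apply: succ_sum_le => // l ld.
exact/ball_coord/gB.
Qed.

Lemma weightedZ w f t : `|t| <= 1 -> weighted w f -> weighted w (t *: f).
Proof.
move=> t1 [d [g [dn gB gs ->]]]; exists d, (fun l => t *: g l); split => //.
- by move=> l /gB; exact: ballZ.
- by move=> a b ab; apply: set_ltS (gs a b ab) => k; exact: suppZ.
- by rewrite -scaler_sumr !scalerA mulrC.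
Qed.

End NormingSetClosure.

(** * Splitting a sum along the pieces of a functional *)

Section Splitting.
Variables (R : realType) (m n s : nat -> nat).
Variable sigma : seq (c00 R * c00 R) -> nat.
Hypotheses (G : growth m n s) (C : coding m sigma).
Implicit Types (x f g h : c00 R) (y : nat -> c00 R) (P Q : pred nat).

Notation Kset := (Kset m n sigma).
Notation K := (norming_set m n sigma).
Notation nle := (nle m n sigma).
Notation polar_ball := (polar_ball m n sigma).
Notation weighted := (weighted m n sigma).

Definition cnt N P : R := \sum_(k < N | P k) 1.

Lemma cnt_ge0 N P : 0 <= cnt N P.
Proof. by apply: sumr_ge0. Qed.

Lemma cnt_le N P Q : (forall k, (k < N)%N -> P k -> Q k) -> cnt N P <= cnt N Q.
Proof.
move=> PQ; rewrite /cnt [leLHS]big_mkcond [leRHS]big_mkcond /=; apply: ler_sum => k _.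
by case: ifP => [/PQ -> //|_]; case: ifP.
Qed.

Lemma cntT N : cnt N xpredT = N%:R.
Proof. by rewrite /cnt sumr_const card_ord. Qed.

Lemma cnt_leN N P : cnt N P <= N%:R.
Proof. by rewrite -cntT; apply: cnt_le. Qed.

Lemma cnt_inj N P d (c : nat -> nat) :
  (forall k, (k < N)%N -> P k -> (c k < d)%N) ->
  (forall k k', (k < k' < N)%N -> P k -> P k' -> c k <> c k') -> cnt N P <= d%:R.
Proof.
move=> cd cinj; have -> : cnt N P = (\sum_(k < N | P k) 1)%N%:R by rewrite natr_sum.
rewrite -(big_mkord P (fun=> 1%N)) /= ler_nat sum1_count.
rewrite /index_iota subn0 -size_filter -(size_map c) -[leqRHS](size_iota 0).
apply: uniq_leq_size.
  rewrite map_inj_in_uniq ?filter_uniq ?iota_uniq //.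
  move=> k k'; rewrite !mem_filter !mem_iota => /andP[Pk kN] /andP[Pk' k'N] cc.
  apply/eqP; apply/negPn/negP; rewrite neq_ltn => /orP[] kk.
    by apply: (cinj k k') => //; lia.
  by apply: (cinj k' k) => //; lia.
move=> a /mapP[k]; rewrite mem_filter mem_iota => /andP[Pk kN] ->.
by rewrite mem_iota; apply: cd => //; lia.
Qed.

Lemma cnt_le1 N P : (forall k k', (k < k' < N)%N -> P k -> P k' -> False) -> cnt N P <= 1.
Proof. by move=> H; apply: (@cnt_inj _ _ 1 (fun=> 0%N)) => // k k' kk Pk /(H k k' kk Pk). Qed.

Lemma weighted_bound w f x b : weighted w f -> nle x b ->
  `|pairing f x| <= (m w)%:R^-1 * ((n w)%:R * b).
Proof.
move=> [d [g [dn gB _ ->]]] xb; rewrite pairingZl normrM ger0_norm ?invr_ge0 //.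
rewrite ler_wpM2l ?invr_ge0 // pairing_suml; apply: (le_trans (ler_norm_sum _ _ _)).
apply: (@le_trans _ _ (\sum_(l < d) b)).
  by apply: ler_sum => l _; apply: (gB l (ltn_ord l)).
by rewrite sumr_const card_ord -[leLHS]mulr_natl ler_wpM2r ?(nle_ge0 xb) // ler_nat.
Qed.

(** Each vector y_k that meets two of the pieces of f is charged to the first
    piece that it meets; two vectors cannot be charged to the same piece, so that
    at most n_w of the vectors are estimated with the weak bound beta. Each of the
    remaining vectors is seen by one piece only. *)
Lemma split_estimate w f N y P (beta A B : R) :
  (0 < w)%N -> weighted w f -> 0 <= beta -> 0 <= A -> 0 <= B ->
  (forall k, (k < N)%N -> P k -> `|pairing f (y k)| <= beta) -> successive N y ->
  (forall Q, (forall k, Q k -> P k) -> nle (\sum_(k < N | Q k) y k) (A + B * cnt N Q)) ->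
  `|pairing f (\sum_(k < N | P k) y k)| <=
    (n w)%:R * beta + (m w)%:R^-1 * ((n w)%:R * A + B * cnt N P).
Proof.
move=> w0 [d [g [dn gB gs fE]]] b0 A0 B0 fb ys yQ.
pose meets i k := `[< exists a, supp (g i) a /\ supp (y k) a >].
pose first k := find (meets^~ k) (iota 0 d).
pose split k := [exists i : 'I_d, (first k < i)%N && meets i k].
have firstP k i : (i < d)%N -> meets i k -> (first k <= i)%N /\ meets (first k) k.
  move=> id mi; have hm : has (meets^~ k) (iota 0 d).
    by apply/hasP; exists i; rewrite ?mem_iota.
  have := nth_find 0%N hm; have fd : (first k < d)%N by rewrite -[d in leqRHS](size_iota 0) -has_find.
  rewrite nth_iota // add0n; split => //; rewrite leqNgt; apply/negP => /(before_find 0%N).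
  by rewrite nth_iota // add0n mi.
have dn' : (d%:R : R) <= (n w)%:R by rewrite ler_nat.
have n0 : (0 : R) <= (m w)%:R^-1 by rewrite invr_ge0.
rewrite pairing_sumr (bigID (fun k : 'I_N => split k)) /=.
apply: (le_trans (ler_normD _ _)); apply: lerD.
  apply: (@le_trans _ _ (cnt N split * beta)).
    rewrite /cnt mulr_suml; apply: (le_trans (ler_norm_sum _ _ _)).
    rewrite [leLHS]big_mkcond [leRHS]big_mkcond /=; apply: ler_sum => k _.
    have [/andP[Pk ->]|/nandP H] := ifP; first by rewrite mul1r; apply: fb.
    by case: ifP => _ //; rewrite mul1r.
  apply: ler_wpM2r => //; apply: le_trans dn'; apply: (@cnt_inj _ _ _ first).
    move=> k kN /existsP[i /andP[fi _]]; exact: (ltn_trans fi).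
  move=> k k' /andP[kk k'N] /existsP[i /andP[ki mi]] /existsP[i' /andP[ki' mi']] fkk.
  have [a [ga ya]] := asboolW mi.
  have [_ /asboolP[b [gb yb]]] := firstP k' i' (ltn_ord i') mi'.
  have ab : (a < b)%N by apply: (ys k k') => //; rewrite kk.
  have ba : (b < a)%N by apply: (gs (first k) i) => //; rewrite ?ki //= fkk.
  by have := ltn_trans ab ba; rewrite ltnn.
have -> : \sum_(k < N | P k && ~~ split k) pairing f (y k) =
    (m w)%:R^-1 * \sum_(i < d) pairing (g i) (\sum_(k < N | [&& P k, ~~ split k & meets i k]) y k).
  rewrite (eq_bigr (fun k : 'I_N => (m w)%:R^-1 * \sum_(i < d) pairing (g i) (y k))); last first.
    by move=> k _; rewrite fE pairingZl pairing_suml.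
  rewrite -mulr_sumr exchange_big /=; congr (_ * _); apply: eq_bigr => i _.
  rewrite pairing_sumr [RHS]big_mkcond [LHS]big_mkcond /=; apply: eq_bigr => k _.
  case: (P k); case: (split k) => //; rewrite ?andbT ?andTb; case: ifPn => // /asboolPn mik.
  by apply: pairing_eq0 => a ga ya; apply: mik; exists a.
rewrite normrM ger0_norm //; apply: ler_wpM2l => //.
apply: (le_trans (ler_norm_sum _ _ _)).
have : \sum_(i < d) `|pairing (g i) (\sum_(k < N | [&& P k, ~~ split k & meets i k]) y k)| <=
    \sum_(i < d) (A + B * cnt N [pred k | [&& P k, ~~ split k & meets i k]]).
  apply: ler_sum => i _; apply: (gB i (ltn_ord i)).
  by apply: (yQ [pred k | [&& P k, ~~ split k & meets i k]]) => k /andP[].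
move/le_trans; apply; rewrite big_split /= sumr_const card_ord -mulr_sumr.
apply: lerD; first by rewrite -[leLHS]mulr_natl ler_wpM2r.
apply: ler_wpM2l => //; rewrite /cnt.
have -> : \sum_(i < d) \sum_(k < N | [pred k | [&& P k, ~~ split k & meets i k]] k) (1 : R) =
    \sum_(k < N | P k) (if split k then 0 else \sum_(i < d | meets i k) 1).
  rewrite (eq_bigr (fun i : 'I_d => \sum_(k < N | P k) if ~~ split k && meets i k then 1 else 0)).
    rewrite exchange_big /=; apply: eq_bigr => k _.
    by case: (split k) => /=; [rewrite big1|rewrite -big_mkcond].
  by move=> i _; rewrite -big_mkcondr.
apply: ler_sum => k _; case: ifPn => // /existsPn ns.
apply: (@cnt_le1 d (meets^~ k)) => i i' /andP[ii' i'd] mi mi'.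
have := ns (Ordinal i'd); rewrite /= mi' andbT => /negP; apply.
have [fi _] := firstP k i (ltn_trans ii' i'd) mi; exact: (leq_ltn_trans fi).
Qed.

(** Induction on the depth u up to which functionals are unfolded: unfolding once
    a functional of index w < q, for which m_w >= 2, at least halves the average part
    and multiplies the number of exceptional vectors by at most 4 n_(q-1). *)
Lemma ris_estimate q t N y (c : R) : (1 < q)%N -> 0 <= c -> successive N y ->
  (forall k, (k < N)%N -> nle (y k) c) ->
  (forall k w f, (k < N)%N -> (1 < w < q)%N -> weighted w f ->
    `|pairing f (y k)| <= c / (m w)%:R) ->
  (forall w i f P, (q <= w)%N -> Kset i w f ->
    `|pairing f (\sum_(k < N | P k) y k)| <= c * (1 + cnt N P / 2 ^+ t)) ->
  forall u P, (u <= t)%N ->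
  nle (\sum_(k < N | P k) y k) (c * ((4 * n q.-1)%:R ^+ u + cnt N P / 2 ^+ u)).
Proof.
move=> q1 c0 ys yc yw ybig; set M : R := (4 * n q.-1)%:R.
have M1 : 1 <= M by rewrite ler1n muln_gt0 (n_gt0 G); lia.
have Mu u : 1 <= M ^+ u by apply: exprn_ege1.
have half u : (0 : R) <= (2 ^+ u)^-1 by rewrite invr_ge0 exprn_ge0.
elim=> [|u IH] P ut.
  rewrite !expr0 divr1; apply: (@nle_le _ _ _ _ _ (\sum_(k < N | P k) c)).
    by rewrite mulrDr mulr1 /cnt mulr_sumr; under [in leRHS]eq_bigr do rewrite mulr1; rewrite lerDr.
  by apply: nle_sum => k _; exact: yc.
have {}IH Q := IH Q (ltnW ut).
move=> f Kf; have [[l l0 fE]|[w [i [w1 Kwf wf]]]] := K_cases G C Kf.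
  apply: (@le_trans _ _ c); last first.
    rewrite -[leLHS]mulr1 ler_wpM2l // -[leLHS]addr0 lerD //.
    by rewrite mulr_ge0 ?cnt_ge0.
  have -> : `|pairing f (\sum_(k < N | P k) y k)| =
      `|(\sum_(k < N) (if P k then y k else 0)) l|.
    by rewrite -big_mkcond; case: fE => ->; rewrite ?pairingNl ?normrN pairing_basisl.
  apply: (@succ_sum_le R N (fun k => if P k then y k else 0)) => //.
    move=> k kN; case: ifP => _; last by rewrite normr0.
    exact: nle_coord (yc k kN).
  move=> k k' kk a b; case: ifP => [_|_ /nsuppP //]; case: ifP => [_|_ _ /nsuppP //].
  exact: ys.
have [wq|qw] := ltnP w q; last first.
  apply: (le_trans (ybig _ _ _ _ qw Kwf)); rewrite ler_wpM2l // lerD //.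
  rewrite ler_wpM2l ?cnt_ge0 // lef_pV2 ?posrE ?exprn_gt0 //.
  by rewrite ler_eXn2l // ltr1n.
have mw2 : (2 : R) <= (m w)%:R by rewrite ler_nat (m_ge2 G) //; lia.
have mw0 : (0 : R) < (m w)%:R by apply: lt_le_trans mw2.
have nw : (4 * (n w)%:R : R) <= M by rewrite /M natrM ler_wpM2l // ler_nat (n_mono G); linlia.
have mwi : (m w)%:R^-1 <= 2^-1 :> R by rewrite lef_pV2 ?posrE.
have mwi0 : (0 : R) <= (m w)%:R^-1 by rewrite invr_ge0 ltW.
have -> : c * (M ^+ u.+1 + cnt N P / 2 ^+ u.+1) =
    2^-1 * (c * (2 * M * M ^+ u)) + 2^-1 * (c * (cnt N P / 2 ^+ u)).
  by rewrite !exprS invfM; field.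
have c1 : 0 <= c / (m w)%:R by rewrite divr_ge0 // ltW.
have c2 : 0 <= c * M ^+ u by rewrite mulr_ge0 // (le_trans ler01).
have c3 : 0 <= c / 2 ^+ u by rewrite mulr_ge0.
have w0 : (0 < w)%N by apply: ltnW.
apply: (le_trans (split_estimate w0 wf c1 c2 c3 _ ys _)).
- by move=> k kN _; apply: yw => //; rewrite w1.
- move=> Q _; by apply: nle_le (IH Q); rewrite mulrDr [cnt N Q / _]mulrC mulrA.
rewrite mulrDr addrA; apply: lerD; last first.
  rewrite [c / _ * _]mulrAC -mulrA ler_wpM2r ?mulr_ge0 ?cnt_ge0 //.
have -> : (n w)%:R * (c / (m w)%:R) + (m w)%:R^-1 * ((n w)%:R * (c * M ^+ u)) =
    (m w)%:R^-1 * (c * ((n w)%:R * (1 + M ^+ u))) by ring.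
apply: ler_pM => //; first by rewrite !mulr_ge0 // ?addr_ge0 // (le_trans ler01).
rewrite ler_wpM2l //; apply: (@le_trans _ _ ((n w)%:R * (4 * M ^+ u))).
  by rewrite ler_wpM2l //; have := Mu u; lra.
by rewrite mulrA [_ * 4]mulrC ler_wpM2r ?(le_trans ler01) //; move: nw M1; lra.
Qed.

End Splitting.

(** * Averages of length n_p *)

Section Averages.
Variables (R : realType) (m n s : nat -> nat).
Variable sigma : seq (c00 R * c00 R) -> nat.
Hypotheses (G : growth m n s) (C : coding m sigma).
Implicit Types (x f g h : c00 R) (y : nat -> c00 R) (P Q : pred nat).

Notation Kset := (Kset m n sigma).
Notation nle := (nle m n sigma).
Notation polar_ball := (polar_ball m n sigma).
Notation weighted := (weighted m n sigma).
Notation cnt := (@cnt R).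

(** A vector that at the scale p plays the part of a basis vector: a functional of
    weight w < p acts on it with size of order 1 / m_w, functionals of weight w > p
    hardly see it, and only those of weight p can norm it. *)
Definition exact_vec p (c : R) x : Prop :=
  [/\ nle x c,
      (forall w f, (1 < w < p)%N -> weighted w f -> `|pairing f x| <= c / (m w)%:R) &
      (forall w f, (p < w)%N -> polar_ball f -> weighted w f -> `|pairing f x| <= c / (m p)%:R ^+ 4)].

Lemma exact_vecZ p c x a : exact_vec p c x -> exact_vec p (`|a| * c) (a *: x).
Proof.
move=> [xc xw xp]; split; first exact: nleZ.
  by move=> w f wp /(xw _ _ wp) fx; rewrite pairingZr normrM -mulrA ler_wpM2l.
by move=> w f wp Bf /(xp _ _ wp Bf) fx; rewrite pairingZr normrM -mulrA ler_wpM2l.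
Qed.

Lemma exact_vec0 p c : 0 <= c -> exact_vec p c 0.
Proof.
by move=> c0; split=> [|w f _ _|w f _ _ _]; first exact: nle0;
  rewrite pairing0r normr0 ?mulr_ge0 // invr_ge0 ?exprn_ge0.
Qed.

Lemma exact_vec_le p c d x : c <= d -> exact_vec p c x -> exact_vec p d x.
Proof.
move=> cd [xc xw xp]; split; first exact: nle_le xc.
  by move=> w f wp /(xw _ _ wp)/le_trans; apply; rewrite ler_wpM2r ?invr_ge0.
by move=> w f wp Bf /(xp _ _ wp Bf)/le_trans; apply; rewrite ler_wpM2r ?invr_ge0 ?exprn_ge0.
Qed.

(** With 2 ^ t = m_p, unfolding functionals t times leaves M ^ t exceptional vectors,
    M = 4 n_(p-1), and since n_p >= M ^ (3 t) these disappear in an average of length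
    n_p. For a weight w < p one more splitting along the pieces gains the
    factor 1 / m_w. *)
Lemma average_exact p y (c : R) : (1 < p)%N -> 0 <= c -> successive (n p) y ->
  (forall k, (k < n p)%N -> nle (y k) c) ->
  (forall k w f, (k < n p)%N -> (1 < w < p)%N -> weighted w f ->
    `|pairing f (y k)| <= c / (m w)%:R) ->
  (forall f P, polar_ball f -> weighted p f ->
    `|pairing f (\sum_(k < n p | P k) y k)| <= c * (1 + cnt (n p) P / (m p)%:R)) ->
  (forall w f P, (p < w)%N -> polar_ball f -> weighted w f ->
    `|pairing f (\sum_(k < n p | P k) y k)| <= c * (1 + cnt (n p) P / (m p)%:R ^+ 5)) ->
  exact_vec p (2 * c) (((m p)%:R / (n p)%:R) *: \sum_(k < n p) y k).
Proof.
move=> p1 c0 ys yc yw yp ybig.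
have p0 : (0 < p)%N by apply: ltnW.
have mp1 : (1 : R) <= (m p)%:R by rewrite ler1n (m_gt0 G).
have mp0 : (0 : R) < (m p)%:R by apply: lt_le_trans mp1.
have np0 : (0 : R) < (n p)%:R by rewrite ltr0n (n_gt0 G).
pose e := (5 ^ p.-1)%N; pose M : R := (4 * n p.-1)%:R.
have M4 : 4 <= M.
  rewrite /M natrM -{1}[4]mulr1 ler_wpM2l // ler1n (n_gt0 G) //; lia.
have M0 : 0 < M by apply: lt_le_trans M4.
have M1 : 1 <= M by apply: le_trans M4; rewrite ler1n.
have mE : (m p)%:R = 2 ^+ e :> R by rewrite (m_exp G p0) natrX.
have npM : M ^+ (3 * e) <= (n p)%:R by rewrite /M -natrX ler_nat (pow3_le_n G).
have mpM : (m p)%:R <= M ^+ e.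
  apply: (@le_trans _ _ ((m p)%:R ^+ 2)); first by rewrite expr2 ler_peMr // ltW.
  by rewrite /M -!natrX ler_nat (m2_le_pow G).
have e0 : (0 < e)%N by rewrite expn_gt0.
have small : (m p)%:R / (n p)%:R * M ^+ e.+1 <= 1.
  rewrite mulrAC ler_pdivrMr // mul1r; apply: le_trans npM.
  apply: (@le_trans _ _ (M ^+ e * M ^+ e.+1)); first by rewrite ler_wpM2r // exprn_ge0 // ltW.
  by rewrite -exprD ler_weXn2l //; lia.
have small0 : (m p)%:R / (n p)%:R * M ^+ e <= 1.
  apply: le_trans small; apply: ler_wpM2l; first by rewrite divr_ge0 // ltW.
  by rewrite ler_weXn2l.
have yK P : nle (\sum_(k < n p | P k) y k) (c * (M ^+ e + cnt (n p) P / (m p)%:R)).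
  rewrite mE; apply: (ris_estimate G C p1 c0 ys yc yw) (leqnn _) => w i f Q pw Kf.
  have [_ wf] := Kset_weighted G C (leq_trans p0 pw) Kf.
  have Bf : polar_ball f by apply: K_ball; exact: Kset_K Kf.
  move: pw; rewrite leq_eqVlt => /orP[/eqP pw|pw].
    by rewrite -mE; apply: yp => //; rewrite pw.
  apply: (le_trans (ybig _ _ _ pw Bf wf)); rewrite ler_wpM2l // lerD // -mE.
  rewrite ler_wpM2l ?cnt_ge0 // lef_pV2 ?posrE ?exprn_gt0 //.
  by rewrite exprS ler_peMr ?(ltW mp0) // exprn_ege1.
split.
- move=> f Kf; rewrite pairingZr normrM ger0_norm; last by rewrite divr_ge0 // ltW.
  have := yK xpredT f Kf; rewrite cntT => H.
  apply: le_trans; first by apply: ler_wpM2l H; rewrite divr_ge0 // ltW.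
  have -> : (m p)%:R / (n p)%:R * (c * (M ^+ e + (n p)%:R / (m p)%:R)) =
      c * ((m p)%:R / (n p)%:R * M ^+ e + 1) by field; rewrite !gt_eqF.
  by rewrite mulrC ler_wpM2r //; lra.
- move=> w f /andP[w1 wp] wf; rewrite pairingZr normrM ger0_norm; last by rewrite divr_ge0 // ltW.
  have w0 : (0 < w)%N by apply: ltnW.
  have mw0 : (0 : R) < (m w)%:R by rewrite ltr0n (m_gt0 G).
  have := @split_estimate R m n sigma w f (n p) y xpredT (c / (m w)%:R) (c * M ^+ e)
     (c / (m p)%:R) w0 wf.
  rewrite divr_ge0 ?(ltW mw0) // mulr_ge0 ?exprn_ge0 ?(ltW M0) // divr_ge0 ?(ltW mp0) //.
  move=> /(_ isT isT isT) H.
  have {}H : `|pairing f (\sum_(k < n p) y k)| <= (n w)%:R * (c / (m w)%:R) +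
     (m w)%:R^-1 * ((n w)%:R * (c * M ^+ e) + c / (m p)%:R * (n p)%:R).
    rewrite -(cntT R (n p)); apply: H => //.
      by move=> k kn _; apply: yw => //; rewrite w1.
    by move=> Q _; apply: nle_le (yK Q); rewrite mulrDr [cnt _ _ / _]mulrC mulrA.
  apply: le_trans; first by apply: ler_wpM2l H; rewrite divr_ge0 // ltW.
  have -> : (m p)%:R / (n p)%:R * ((n w)%:R * (c / (m w)%:R) +
     (m w)%:R^-1 * ((n w)%:R * (c * M ^+ e) + c / (m p)%:R * (n p)%:R)) =
     c / (m w)%:R * ((m p)%:R / (n p)%:R * ((n w)%:R * (1 + M ^+ e)) + 1).
    by field; rewrite !gt_eqF.
  have -> : 2 * c / (m w)%:R = c / (m w)%:R * 2 by ring.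
  apply: ler_wpM2l; first by rewrite divr_ge0 // ltW.
  suff : (m p)%:R / (n p)%:R * ((n w)%:R * (1 + M ^+ e)) <= 1 :> R by lra.
  apply: le_trans small; apply: ler_wpM2l; first by rewrite divr_ge0 // ltW.
  have nw : 4 * (n w)%:R <= M by rewrite /M natrM ler_wpM2l // ler_nat (n_mono G); linlia.
  have Me : 1 <= M ^+ e by apply: exprn_ege1.
  apply: (@le_trans _ _ ((n w)%:R * (4 * M ^+ e))); first by rewrite ler_wpM2l //; lra.
  by rewrite mulrA [_ * 4]mulrC exprS ler_wpM2r // (le_trans ler01).
- move=> w f pw Bf wf; rewrite pairingZr normrM ger0_norm; last by rewrite divr_ge0 // ltW.
  have := ybig w f xpredT pw Bf wf; rewrite cntT => H.
  apply: le_trans; first by apply: ler_wpM2l H; rewrite divr_ge0 // ltW.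
  have -> : (m p)%:R / (n p)%:R * (c * (1 + (n p)%:R / (m p)%:R ^+ 5)) =
     c * ((m p)%:R / (n p)%:R + 1 / (m p)%:R ^+ 4) by field; rewrite !gt_eqF.
  have : (m p)%:R / (n p)%:R <= 1 / (m p)%:R ^+ 4 :> R.
    rewrite ler_pdivrMr // mulrAC mul1r ler_pdivlMr ?exprn_gt0 // -exprS -natrX ler_nat.
    apply: leq_trans (m6_le_n G p1); rewrite leq_pexp2l //; exact: m_gt0 G _ p0.
  by move=> H1; rewrite [2 * c]mulrC -mulrA ler_wpM2l //; move: H1; rewrite mul1r; lra.
Qed.

End Averages.

(** * Codes of special sequences *)

Section SpecialSequences.
Variables (R : realType) (m n s : nat -> nat).
Variable sigma : seq (c00 R * c00 R) -> nat.
Hypotheses (G : growth m n s) (C : coding m sigma).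
Implicit Types (x f g h : c00 R) (phi psi : seq (c00 R * c00 R)).

Notation Kset := (Kset m n sigma).
Notation special_seq := (special_seq m n sigma).

Lemma ltr_sqrt_nat a b : (a%:R < Num.sqrt b%:R :> R) -> (a ^ 2 < b)%N.
Proof.
move=> ab; rewrite -(ltr_nat R) natrX -[ltRHS]sqr_sqrtr //.
by rewrite ltrXn2r // ?nnegrE // sqrtr_ge0.
Qed.

Lemma ler_sqrt_nat a b : (a%:R <= Num.sqrt b%:R :> R) -> (a ^ 2 <= b)%N.
Proof.
move=> ab; rewrite -(ler_nat R) natrX -[leRHS]sqr_sqrtr //.
by rewrite lerXn2r // ?nnegrE // sqrtr_ge0.
Qed.

Lemma take_size (T : Type) k (r : seq T) : (k <= size r)%N -> size (take k r) = k.
Proof. by rewrite size_take; case: ltnP => // kr rk; apply/eqP; rewrite eqn_leq rk kr. Qed.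

Lemma code_lt psi a b : Qs psi -> (0 < a < b)%N -> (b <= size psi)%N ->
  (sigma (take a psi) < sigma (take b psi))%N.
Proof.
move=> pQ /andP[a0]; elim: b => // b IH; rewrite ltnS => ab bs.
have lt1 : (sigma (take b psi) < sigma (take b.+1 psi))%N.
  have := coding_mono C (@Qs_take _ psi b.+1 pQ isT).
  by rewrite take_size //= take_takel // => /(_ _); apply; lia.
move: ab; rewrite leq_eqVlt => /orP[/eqP -> //|ab].
by apply: ltn_trans lt1; apply: IH => //; lia.
Qed.

Lemma supp_basis_sum (L : seq nat) l : l \in L -> (forall l, l \in L -> (1 <= l)%N) ->
  (\sum_(i <- L) basis_vec R i) l != 0.
Proof.
move=> lL L1; rewrite c00_sumE (big_rem l) // basis_vecE (L1 _ lL) eqxx.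
rewrite gt_eqF // ltr_pwDl // sumr_ge0 //.
Qed.

Lemma big_element (L : seq nat) N : uniq L -> size L = N -> (0 < N)%N ->
  (forall l, l \in L -> (1 <= l)%N) -> exists2 l, l \in L & (N <= l)%N.
Proof.
move=> uL sL N0 L1; apply: contrapT => H.
have : (size L <= size (iota 1 N.-1))%N.
  apply: uniq_leq_size => // l lL; rewrite mem_iota (L1 _ lL) /=.
  have /negP := fun lN => H (ex_intro2 _ _ l lL lN); lia.
by rewrite sL size_iota; lia.
Qed.

(** The first average is supported on n_p points, so its code, which bounds its
    range, has to be much larger than p. *)
Lemma code_first psi k p : special_seq k psi -> (0 < k)%N -> (1 < p)%N ->
  basis_average m n p (xs psi 1) (fs psi 1) -> (p < sigma (take 1 psi))%N.
Proof.
move=> [[pQ sp] _ _ _] k0 p1 [L [[uL sL] L1 xE _]].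
have pQ1 := @Qs_take _ psi 1 pQ isT.
have [s1 _] := coding_gt1 C pQ1.
have st : size (take 1 psi) = 1%N by rewrite take_size //; lia.
have np0 : (0 < n p)%N by rewrite (n_gt0 G) //; lia.
have [l lL nl] := big_element uL sL np0 L1.
have := coding_bound C pQ1 (k := l); rewrite st.
have -> : xs (take 1 psi) 1 = xs psi 1 by rewrite /xs nth_take.
move=> H; have {}H : l%:R <= Num.sqrt (m (sigma (take 1 psi)))%:R :> R.
  apply: H; left; apply: hull_suppS; rewrite suppE xE c00_ZE mulf_neq0 //.
    by rewrite invr_eq0 pnatr_eq0 -lt0n.
  exact: supp_basis_sum.
have {}H := ler_sqrt_nat H; rewrite ltnNge; apply/negP => sp'.
have m1 : (m (sigma (take 1 psi)) <= m p)%N by apply: (m_mono G) => //; lia.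
have m2 := m6_le_n G p1; have mg := m_ge2 G (ltnW p1).
have m3 : (m p < m p ^ 6)%N by rewrite -{1}(expn1 (m p)) ltn_exp2l.
have m4 : (n p <= l ^ 2)%N by apply: (leq_trans nl); rewrite expnS expn1 leq_pmulr //; lia.
by lia.
Qed.

(** The first index p satisfies m_p > (2k) ^ 2 by definition, and the codes increase
    from p on. *)
Lemma special_weight psi k i : special_seq k psi -> (0 < i <= 2 * k)%N ->
  ((2 * k) ^ 2 <= m (sigma (take i psi)))%N.
Proof.
move=> sp ik; have k0 : (0 < k)%N by lia.
have [|p [p1 ep ba _ pk]] := special_odd C sp (i := 1%N); first by lia.
have pk2 := ltr_sqrt_nat (pk erefl).
have ps := code_first sp k0 p1 ba; have [[pQ szp] _ _ _] := sp.
have pi : (p < sigma (take i psi))%N.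
  have [->//|i1] := eqVneq i 1%N; apply: (ltn_trans ps); apply: code_lt => //; lia.
apply: (leq_trans (ltnW pk2)); apply: (m_mono G); lia.
Qed.

(** Injectivity of the coding; a coded sequence determines its own length. *)
Lemma code_eq phi psi k a b : special_seq k phi -> special_seq k psi ->
  (0 < a <= 2 * k)%N -> (0 < b <= 2 * k)%N ->
  sigma (take a phi) = sigma (take b psi) -> a = b /\ take a phi = take a psi.
Proof.
move=> [[fQ szf] _ _ _] [[pQ szp] _ _ _] /andP[a0 ak] /andP[b0 bk] e.
have /= E : take a phi = take b psi.
  by apply: (coding_inj C) e; rewrite inE; apply: Qs_take.
have ab : a = b by have := congr1 size E; rewrite !take_size ?szf ?szp.
by split => //; rewrite E ab.
Qed.

Lemma Kset_odd i q f : Kset i q f -> odd q -> (2 < q)%N ->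
  exists i' psi, odd_part m n sigma (Kset i') q psi f.
Proof.
elim: i => [|i IH] /=; first by case: eqP => // -> _ _.
rewrite /K_step => + oq q2; have -> : (q == 0)%N = false by lia.
rewrite oq q2 /= => -[/IH /(_ oq q2) //|[psi _ H]]; by exists i, psi.
Qed.

End SpecialSequences.

(** * The norm of a dependent sequence *)

Section DependentSequences.
Variables (R : realType) (m n s : nat -> nat).
Variable sigma : seq (c00 R * c00 R) -> nat.
Hypotheses (G : growth m n s) (C : coding m sigma).
Implicit Types (x f g h : c00 R) (P : pred nat).

Notation Kset := (Kset m n sigma).
Notation nle := (nle m n sigma).
Notation polar_ball := (polar_ball m n sigma).
Notation weighted := (weighted m n sigma).
Notation exact_vec := (exact_vec m n sigma).
Notation special_seq := (special_seq m n sigma).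
Notation cnt := (@cnt R).

(** An interval cuts at most two members of a successive family: one at each
    of its ends. *)
Lemma cut_le2 N (y : nat -> c00 R) (E : interval nat) (bad : pred nat) :
  successive N y ->
  (forall k, (k < N)%N -> bad k ->
     (exists a, supp (y k) a /\ a \in E) /\ (exists b, supp (y k) b /\ b \notin E)) ->
  cnt N bad <= 2.
Proof.
case: E => l r ys badP.
have lmono a b : (a < b)%N -> (l <= BLeft a)%O -> (l <= BLeft b)%O.
  by move=> ab /le_trans; apply; rewrite bnd_simp; exact: ltnW.
have rmono a b : (a < b)%N -> (BRight b <= r)%O -> (BRight a <= r)%O.
  by move=> ab; apply: le_trans; rewrite bnd_simp; exact: ltnW.
pose low k := `[< (exists a, supp (y k) a /\ (l <= BLeft a)%O) /\
                  exists b, supp (y k) b /\ ~~ (l <= BLeft b)%O >].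
pose upp k := `[< (exists a, supp (y k) a /\ (BRight a <= r)%O) /\
                  exists b, supp (y k) b /\ ~~ (BRight b <= r)%O >].
have lows : cnt N low <= 1.
  apply: cnt_le1 => k k' kk /asboolP[[a [ya la]] _] /asboolP[_ [b [yb lb]]].
  by move: lb; rewrite (lmono a b) // (ys k k').
have upps : cnt N upp <= 1.
  apply: cnt_le1 => k k' kk /asboolP[_ [b [yb rb]]] /asboolP[[a [ya ra]] _].
  by move: rb; rewrite (rmono b a) // (ys k k').
apply: (@le_trans _ _ (cnt N low + cnt N upp)); last by lra.
rewrite /cnt (big_mkcond (fun k : 'I_N => bad k)) (big_mkcond (fun k : 'I_N => low k)).
rewrite (big_mkcond (fun k : 'I_N => upp k)) -big_split /=; apply: ler_sum => k _.
case: ifP => [bk|_]; last by case: (low k); case: (upp k) => /=; lra.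
have [[a [ya aE]] [b [yb bE]]] := badP k (ltn_ord k) bk.
move: aE bE; rewrite !itv_boundlr negb_and => /andP[la ra] /orP[lb|rb].
  have -> : low k by apply/asboolP; split; [exists a|exists b].
  by case: (upp k) => /=; lra.
have -> : upp k by apply/asboolP; split; [exists a|exists b].
by case: (low k) => /=; lra.
Qed.

Section Estimate.
(* In the application z_l is the entry x_l of the special sequence phi, multiplied by
   m_(j_l) and by 1, -1 or 0, and y runs through the sums over pairs. By zcancel the
   pieces that a functional of index q builds on the pair (2i-1, 2i) of phi itself are
   negligible on that pair. *)
Variables (q k : nat) (phi : seq (c00 R * c00 R)) (z : nat -> c00 R) (j : nat -> nat).
Hypotheses (oq : odd q) (q2 : (2 < q)%N) (nq : n q = (2 * k)%N).
Hypothesis sphi : special_seq k phi.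
Hypotheses (j1 : (1 < j 1)%N) (jk : ((2 * k) ^ 2 <= m (j 1))%N) (j12 : (j 1 < sigma (take 1 phi))%N).
Hypothesis jE : forall l, (1 < l <= 2 * k)%N -> j l = sigma (take l.-1 phi).
Hypothesis zex : forall l, (0 < l <= 2 * k)%N -> exact_vec (j l) 2 (z l).
Hypothesis zsupp : forall l a, (0 < l <= 2 * k)%N -> supp (z l) a -> hull2 phi l a.
Hypothesis zcancel : forall i i' g l, (0 < i <= k)%N -> Kset i' (j (2 * i)) g ->
  supp g = supp (fs phi (2 * i)) ->
  (if pairing g (xs phi (2 * i)) != 0
   then l = pairing g ((m (j (2 * i)))%:R *: xs phi (2 * i))
   else l = (n q ^ 2)%:R^-1 \/ l = - (n q ^ 2)%:R^-1) ->
  `|pairing (l *: fs phi (2 * i).-1 + g) (z (2 * i).-1 + z (2 * i))| <= (n q ^ 2)%:R^-1.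

Local Notation y := (fun l => z (2 * l).+1 + z (2 * l).+2).

Lemma j_lt a b : (0 < a < b)%N -> (b <= 2 * k)%N -> (j a < j b)%N.
Proof.
have [[pQ szp] _ _ _] := sphi.
have H c d : (1 < c < d)%N -> (d <= 2 * k)%N -> (j c < j d)%N.
  by move=> cd dk; rewrite !jE; try lia; apply: (code_lt C) => //; rewrite ?szp; lia.
move=> ab bk; have [a1|a1] := eqVneq a 1%N; last by apply: H; lia.
rewrite a1; have [b2|b2] := eqVneq b 2; first by rewrite b2 (jE (l := 2)) //; lia.
apply: (@ltn_trans (j 2)); last by apply: H; lia.
by rewrite (jE (l := 2)) //; lia.
Qed.

Lemma j_weight a : (0 < a <= 2 * k)%N -> (1 < j a)%N /\ ((2 * k) ^ 2 <= m (j a))%N.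
Proof.
move=> ak; have [->|a1] := eqVneq a 1%N; first by [].
have ja : (j 1 < j a)%N by apply: j_lt; lia.
by split; [lia|apply: (leq_trans jk); apply: (m_mono G); lia].
Qed.

Lemma y_hull a c : (a < k)%N -> supp (y a) c ->
  exists l, [/\ (2 * a < l)%N, (l <= (2 * a).+2)%N & hull2 phi l c].
Proof.
move=> ak /suppD[] yc; [exists (2 * a).+1|exists (2 * a).+2]; split; try lia;
by apply: zsupp yc; lia.
Qed.

Lemma y_succ : successive k y.
Proof.
have [[pQ szp] _ _ _] := sphi.
move=> a b /andP[ab bk] c d /(y_hull (ltn_trans ab bk))[a' [a'1 a'2 ha]].
move=> /(y_hull bk)[b' [b'1 b'2 hb]].
by apply: (Qs_lt pQ _ _ _ ha hb); lia.
Qed.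

Local Notation N2 := ((n q ^ 2)%:R : R).

Lemma N2_gt0 : 0 < N2.
Proof. by rewrite ltr0n expn_gt0 (n_gt0 G) //; lia. Qed.

Lemma n_gt0R : (0 : R) < (n q)%:R.
Proof. by rewrite ltr0n (n_gt0 G) //; lia. Qed.

(** Only the vector z_l of the same index can react to a functional of large
    weight. *)
Lemma weighted_z w g l (eta : R) : 2 / (m w)%:R <= eta -> 2 / (m (j l))%:R ^+ 4 <= eta ->
  (1 < w)%N -> polar_ball g -> weighted w g ->
  (0 < l <= 2 * k)%N -> `|pairing g (z l)| <= (if j l == w then 2 else 0) + eta.
Proof.
move=> mw mj w1 Bg wg lk; have [ze zw zp] := zex lk.
have i0 : 0 <= eta by apply: le_trans mw; rewrite divr_ge0.
have [jw|jw|jw] := ssrnat.ltngtP (j l) w; rewrite ?add0r.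
- exact: (le_trans (zp _ _ jw Bg wg)).
- have wr : (1 < w < j l)%N by rewrite w1.
  exact: (le_trans (zw _ _ wr wg)).
- have : `|pairing g (z l)| <= 2 by apply: Bg ze.
  by move/le_trans; apply; lra.
Qed.

(** Hence such a functional sees at most one vector z_l of each parity. *)
Lemma weighted_sum w g P (eta : R) : 2 / (m w)%:R <= eta ->
  (forall l, (0 < l <= 2 * k)%N -> 2 / (m (j l))%:R ^+ 4 <= eta) ->
  (1 < w)%N -> polar_ball g -> weighted w g ->
  `|pairing g (\sum_(a < k | P a) y a)| <= 4 + 2 * eta * cnt k P /\
  ((forall a, P a -> a != 0%N) -> (forall l, (1 < l <= 2 * k)%N -> j l != w) ->
    `|pairing g (\sum_(a < k | P a) y a)| <= 2 * eta * cnt k P).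
Proof.
move=> mw mj w1 Bg wg.
pose e a : R := (if P a && (j (2 * a).+1 == w) then 2 else 0) +
                (if P a && (j (2 * a).+2 == w) then 2 else 0).
have main : `|pairing g (\sum_(a < k | P a) y a)| <= \sum_(a < k) e a + 2 * eta * cnt k P.
  have -> : 2 * eta * cnt k P = \sum_(a < k) (if P a then 2 * eta else 0) :> R.
    by rewrite /cnt mulr_sumr [LHS]big_mkcond /=; apply: eq_bigr => a _; rewrite mulr1.
  rewrite -big_split /= pairing_sumr; apply: (le_trans (ler_norm_sum _ _ _)).
  rewrite big_mkcond /=; apply: ler_sum => a _.
  rewrite /e; case: (boolP (P a)) => Pa /=; last by rewrite !addr0.
  rewrite pairingDr; apply: (le_trans (ler_normD _ _)).
  have ak := ltn_ord a.
  have b1 : (0 < (2 * a).+1 <= 2 * k)%N by lia.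
  have b2 : (0 < (2 * a).+2 <= 2 * k)%N by lia.
  have z1 := weighted_z mw (mj _ b1) w1 Bg wg b1.
  have z2 := weighted_z mw (mj _ b2) w1 Bg wg b2.
  by apply: (le_trans (lerD z1 z2)); rewrite addrACA lerD2l; lra.
split.
  apply: (le_trans main); rewrite lerD2r /e big_split /=.
  have c1 : cnt k (fun a => P a && (j (2 * a).+1 == w)) <= 1.
    apply: cnt_le1 => a b ab /andP[_ /eqP ja] /andP[_ /eqP jb].
    have := @j_lt (2 * a).+1 (2 * b).+1; rewrite ja jb ltnn => H.
    by have := H ltac:(lia) ltac:(lia).
  have c2 : cnt k (fun a => P a && (j (2 * a).+2 == w)) <= 1.
    apply: cnt_le1 => a b ab /andP[_ /eqP ja] /andP[_ /eqP jb].
    have := @j_lt (2 * a).+2 (2 * b).+2; rewrite ja jb ltnn => H.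
    by have := H ltac:(lia) ltac:(lia).
  have cE (Q : pred nat) : \sum_(a < k) (if Q a then 2 else 0) = 2 * cnt k Q.
    by rewrite /cnt mulr_sumr -big_mkcond /=; apply: eq_bigr => i _; rewrite mulr1.
  rewrite (cE (fun a => P a && (j (2 * a).+1 == w))).
  by rewrite (cE (fun a => P a && (j (2 * a).+2 == w))); lra.
move=> P0 jw; apply: (le_trans main); rewrite big1 ?add0r // => a _; rewrite /e.
have ak := ltn_ord a; case: (boolP (P a)) => [/P0 a0|_] /=; last by rewrite addr0.
have a1 : (0 < a)%N by rewrite lt0n.
by rewrite !ifN ?addr0 //; apply: jw; lia.
Qed.

Lemma y_nle a : (a < k)%N -> nle (y a) 4.
Proof.
move=> ak; have -> : (4 : R) = 2 + 2 by lra.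
have [z1 _ _] := @zex (2 * a).+1 ltac:(lia); have [z2 _ _] := @zex (2 * a).+2 ltac:(lia).
exact: nleD.
Qed.

Lemma k_gt0 : (0 < k)%N.
Proof. by have := n_gt0 G (ltnW (ltnW q2)); lia. Qed.

Lemma weight_small v : ((2 * k) ^ 2 <= v)%N -> 2 / v%:R <= 2 / N2 :> R.
Proof.
move=> kv; rewrite ler_wpM2l // lef_pV2 ?posrE ?N2_gt0 ?ler_nat ?nq //.
by rewrite ltr0n; apply: leq_trans kv; rewrite expn_gt0; have := k_gt0; lia.
Qed.

Lemma j_small l : (0 < l <= 2 * k)%N -> 2 / (m (j l))%:R ^+ 4 <= 2 / N2 :> R.
Proof.
move=> /j_weight[j0 jl]; rewrite -natrX; apply: weight_small; apply: (leq_trans jl).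
by rewrite -{1}(expn1 (m _)) leq_pexp2l // (m_gt0 G) //; lia.
Qed.

(** The critical estimate. The part of the functional built along the common
    initial segment of the two special sequences acts on each pair separately and
    cancels there; beyond it the codes are different, so that every weight is
    foreign to the z_l; what remains is one pair. The bound is 4 * 3 for the bad
    pairs, 8 for the pair where the sequences part and 2 for all other pieces. *)
Lemma special_bound i f P : Kset i q f ->
  `|pairing f (\sum_(a < k | P a) y a)| <= 22.
Proof.
move=> Kf; have [i' [psi [k' [b [E [g [lam [[nk' sp] Kfs Kg lamE fE]]]]]]]] := Kset_odd Kf oq q2.
have kk : k' = k by linlia.
subst k'; have [[pQ szp] _ _ _] := sp; have [[fQ szf] _ _ _] := sphi.
pose h a := lam a *: fs psi (2 * a).-1 + g a.
set sg : R := (-1) ^+ b / (m q)%:R.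
pose inE a := `[< forall c, supp (y a) c -> c \in E >].
pose outE a := `[< forall c, supp (y a) c -> c \notin E >].
pose cut a := ~~ inE a && ~~ outE a.
(* The first pair is set aside because the index of its average is not a code. *)
pose bad a := (a == 0%N) || cut a.
have sg1 : `|sg| <= 1.
  rewrite /sg normrM normrX normrN normr1 expr1n mul1r ger0_norm ?invr_ge0 //.
  exact: minv_le1.
have cut2 : cnt k cut <= 2.
  apply: (cut_le2 (E := E) y_succ) => a _ /andP[/asboolPn /existsNP[c /not_implyP[yc cE]]].
  move=> /asboolPn /existsNP[d /not_implyP[yd dE]]; split; [exists d|exists c]; split => //.
    by apply: contrapT => H; apply: dE; apply/negP.
  by apply/negP.
have bad3 : cnt k bad <= 3.
  apply: (@le_trans _ _ (cnt k (pred1 0%N) + cnt k cut)).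
    rewrite /cnt (big_mkcond (fun a : 'I_k => bad a)) (big_mkcond (fun a : 'I_k => pred1 0%N a)).
    rewrite (big_mkcond (fun a : 'I_k => cut a)) -big_split /=; apply: ler_sum => a _.
    by rewrite /bad; case: eqP; case: (cut a) => /=; lra.
  have : cnt k (pred1 0%N) <= 1 by apply: cnt_le1 => a c /andP[ac _] /eqP a0 /eqP c0; lia.
  by move: cut2; lra.
pose Q a := [&& P a, ~~ bad a & inE a].
set F := \sum_(1 <= a < k.+1) h a.
set S := \sum_(a < k | Q a) y a.
rewrite pairing_sumr (bigID (fun a : 'I_k => bad a)) /=.
have bound1 : `|\sum_(a < k | P a && bad a) pairing f (y a)| <= 4 * 3.
  apply: (@le_trans _ _ (4 * cnt k bad)); last by move: bad3; lra.
  rewrite /cnt mulr_sumr; apply: (le_trans (ler_norm_sum _ _ _)).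
  rewrite [leLHS]big_mkcond [leRHS]big_mkcond /=; apply: ler_sum => a _.
  case: (P a) => /=; case: (bad a) => //=; rewrite mulr1 //.
  by have := y_nle (ltn_ord a); apply; apply: Kset_K Kf.
have mid2 : `|\sum_(a < k | P a && ~~ bad a) pairing f (y a)| <= `|pairing F S|.
  have -> : \sum_(a < k | P a && ~~ bad a) pairing f (y a) = sg * pairing F S.
    rewrite /S pairing_sumr mulr_sumr fE -/sg.
    rewrite [LHS]big_mkcond [RHS]big_mkcond /=; apply: eq_bigr => a _; rewrite /Q.
    case: (P a) => //=; case: (boolP (bad a)) => //=; rewrite /bad /cut negb_or negb_and !negbK.
    case: (boolP (inE a)) => [/asboolP yE _|_ /andP[_ /= /asboolP yE]].
      by rewrite pairingZl pairing_restr_id.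
    by rewrite pairingZl pairing_eq0 ?mulr0 // => c /supp_restr[cE _] /yE; rewrite cE.
  by rewrite normrM -[leRHS]mul1r ler_wpM2r.
apply: (le_trans (ler_normD _ _)).
suff : `|pairing F S| <= 10 by move: bound1 mid2; lra.
(* The pair at which the two special sequences part. *)
pose mid a := (take (2 * a).-2 psi == take (2 * a).-2 phi) &&
              (take (2 * a) psi != take (2 * a) phi).
have midS : cnt k (fun a => mid a.+1) <= 1.
  apply: cnt_le1 => a c /andP[ac ck] /andP[_ /eqP ne] /andP[/eqP e _]; apply: ne.
  by have := congr1 (take (2 * a.+1)) e; rewrite !take_takel //; linlia.
have nk : (2 * k)%:R = (n q)%:R :> R by rewrite nq.
have n0 : (0 : R) < (n q)%:R by exact: n_gt0R.
have QS a : Q a -> a != 0%N by case/and3P=> _; rewrite /bad negb_or => /andP[].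
have piece a : (0 < a <= k)%N ->
    `|pairing (h a) S| <= (if mid a then 8 else 0) + 4 / (n q)%:R.
  move=> ak; have [p [p1 ep ba pE pk]] := special_odd C sp ak.
  have [p'1 ep'] := special_q C sp ak.
  have [Kga sg' xg] := Kg a ak.
  have la := lam_le1 G C (ltnW q2) sp ak Kga xg (lamE a ak).
  have Kfa := basis_average_K sigma G p1 ep ba.
  have [_ w1] := Kset_weighted G C (ltnW p1) Kfa.
  have [_ w2] := Kset_weighted G C (ltnW p'1) Kga.
  have B1 : polar_ball (lam a *: fs psi (2 * a).-1) by apply/ballZ/K_ball => //; exact: Kset_K Kfa.
  have B2 : polar_ball (g a) by apply: K_ball; exact: Kset_K Kga.
  have {}w1 := weightedZ la w1.
  have mp : ((2 * k) ^ 2 <= m p)%N.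
    have [a1|a1] := eqVneq a 1%N; first by apply/ltnW/(@ltr_sqrt_nat R)/pk.
    have a2 : (1 < a)%N by linlia.
    by rewrite (pE a2); apply: (special_weight G C sp); linlia.
  have mp' : ((2 * k) ^ 2 <= m (sigma (take (2 * a).-1 psi)))%N.
    by apply: (special_weight G C sp); linlia.
  have {mp} [b1 b1'] := weighted_sum Q (weight_small mp) j_small p1 B1 w1.
  have {mp'} [b2 b2'] := weighted_sum Q (weight_small mp') j_small p'1 B2 w2.
  have etaQ : 2 * (2 / N2) * cnt k Q <= 2 / (n q)%:R.
    apply: (@le_trans _ _ (2 * (2 / N2) * k%:R)).
      by rewrite ler_wpM2l ?cnt_leN // mulr_ge0 // divr_ge0.
    rewrite natrX -nk natrM; have : (0 : R) < k%:R by rewrite ltr0n k_gt0.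
    by move=> k0; rewrite le_eqVlt; apply/orP; left; apply/eqP; field; rewrite gt_eqF.
  have [/eqP good|ngood] := boolP (take (2 * a) psi == take (2 * a) phi).
    rewrite /mid good eqxx andbF add0r.
    have tk l : (0 < l <= 2 * a)%N -> nth (0, 0) psi l.-1 = nth (0, 0) phi l.-1.
      move=> la'; have := congr1 (fun t => nth (0, 0) t l.-1) good.
      by rewrite /= !nth_take //; linlia.
    have e1 : fs psi (2 * a).-1 = fs phi (2 * a).-1 by rewrite /fs tk //; linlia.
    have e2 : fs psi (2 * a) = fs phi (2 * a) by rewrite /fs tk //; linlia.
    have e3 : xs psi (2 * a) = xs phi (2 * a) by rewrite /xs tk //; linlia.
    have jq : sigma (take (2 * a).-1 psi) = j (2 * a).
      rewrite jE; last by linlia.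
      by have := congr1 (take (2 * a).-1) good; rewrite !take_takel; try linlia; move=> ->.
    have z0 c : (c < k)%N -> c != a.-1 -> pairing (h a) (y c) = 0.
      move=> ck ca; apply: pairing_eq0 => d hd /(y_hull ck)[l' [l'1 l'2 hl']].
      have [l [l1 l2 hl]] : exists l, [/\ (2 * a).-1 <= l, l <= 2 * a & hull2 phi l d]%N.
        case: (suppD hd) => [/suppZ|]; rewrite ?sg' ?e1 ?e2 => fd.
          by exists (2 * a).-1; split; try linlia; right; apply: hull_suppS.
        by exists (2 * a)%N; split; try linlia; right; apply: hull_suppS.
      have [ll|ll] : (l < l')%N \/ (l' < l)%N by move: ca; linlia.
        have := Qs_lt fQ _ ll _ hl hl'; rewrite szf ltnn => H.
        by have := H ltac:(linlia) ltac:(linlia).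
      have := Qs_lt fQ _ ll _ hl' hl; rewrite szf ltnn => H.
      by have := H ltac:(linlia) ltac:(linlia).
    have ak' : (a.-1 < k)%N by linlia.
    rewrite /S pairing_sumr big_mkcond (bigD1 (Ordinal ak')) //= big1 ?addr0; last first.
      by move=> c; rewrite -val_eqE /= => ca; rewrite z0 // if_same.
    have hy : `|pairing (h a) (y a.-1)| <= N2^-1.
      have -> : (2 * a.-1).+1 = (2 * a).-1 by linlia.
      have -> : (2 * a).-1.+1 = (2 * a)%N by linlia.
      rewrite /h e1; apply: (@zcancel a i') => //; rewrite -?jq -?e2 -?e3 //.
      by have := lamE a ak; rewrite e3 jq.
    have N2n : N2^-1 <= 4 / (n q)%:R.
      rewrite -[leLHS]mul1r ler_pM ?invr_ge0 ?ler0n //; first by lra.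
      rewrite lef_pV2 ?posrE ?N2_gt0 // ler_nat expnS expn1 leq_pmulr //.
      by rewrite -(ltr_nat R).
    by case: ifP => _; [apply: (le_trans hy)|rewrite normr0 divr_ge0 // ltW].
  have [/eqP near|far] := boolP (take (2 * a).-2 psi == take (2 * a).-2 phi).
    have -> : mid a by rewrite /mid near eqxx.
    rewrite pairingDl; apply: (le_trans (ler_normD _ _)); apply: (le_trans (lerD b1 b2)).
    by move: etaQ; lra.
  rewrite /mid (negbTE far) add0r pairingDl; apply: (le_trans (ler_normD _ _)).
  have a1 : (1 < a)%N.
    rewrite ltnNge; apply: contra far => a1; have -> : a = 1%N by linlia.
    by rewrite !take0.
  apply: le_trans; first apply: lerD; [apply: (b1' QS)|apply: (b2' QS)|by move: etaQ; lra] => l lk.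
    rewrite jE // pE //; apply/eqP => e; apply: (negP far).
    have [||ee e2] := code_eq C sphi sp _ _ e; try linlia.
    by rewrite -ee e2.
  rewrite jE //; apply/eqP => e; apply: (negP far).
  have [||ee e2] := code_eq C sphi sp _ _ e; try linlia.
  have := congr1 (take (2 * a).-2) e2; rewrite !take_takel; try linlia.
  by move=> ->.
rewrite /F pairing_suml big_add1 big_mkord /=; apply: (le_trans (ler_norm_sum _ _ _)).
have : \sum_(a < k) `|pairing (h a.+1) S| <=
    \sum_(a < k) ((if mid a.+1 then 8 else 0) + 4 / (n q)%:R).
  by apply: ler_sum => a _; apply: piece; have := ltn_ord a; linlia.
move/le_trans; apply; rewrite big_split /= sumr_const card_ord.
have -> : \sum_(a < k) (if mid a.+1 then 8 else 0) = 8 * cnt k (fun a => mid a.+1).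
  by rewrite /cnt mulr_sumr -big_mkcond /=; apply: eq_bigr => l _; rewrite mulr1.
have -> : 4 / (n q)%:R *+ k = 2 :> R.
  rewrite -mulr_natr -nk natrM; have : (0 : R) < k%:R by rewrite ltr0n; move: n0; rewrite ltr0n; linlia.
  by move=> k0; field; rewrite gt_eqF.
by move: midS; lra.
Qed.

(** The general estimate for averages, with 2 ^ t = m_q ^ 2: the bound on functionals
    of index q exactly is what allows the square, where a general sequence would
    only have m_q. The constant is 22 * (1 + 2), since M ^ t <= 2 k / m_q ^ 2. *)
Theorem dependent_estimate :
  nle (\sum_(a < k) y a) (66 * k%:R / (m q)%:R ^+ 2).
Proof.
have q1 : (1 < q)%N by apply: ltnW.
have q0 : (0 < q)%N by apply: ltnW.
pose e := (5 ^ q.-1)%N; pose M : R := (4 * n q.-1)%:R.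
have mE : (m q)%:R = 2 ^+ e :> R by rewrite (m_exp G q0) natrX.
have mq0 : (0 : R) < (m q)%:R by rewrite ltr0n (m_gt0 G).
have mq1 : (1 : R) <= (m q)%:R by rewrite ler1n (m_gt0 G).
have qj l : (0 < l <= 2 * k)%N -> (q < j l)%N.
  move=> /j_weight[j0 jl]; rewrite ltnNge; apply/negP => jq.
  have := m_mono G (ltnW j0) jq; have := m2_le_n G q0; rewrite nq => m1 m2.
  have m3 : (m q < m q ^ 2)%N by rewrite -{1}(expn1 (m q)) ltn_exp2l // (m_ge2 G).
  have := leq_ltn_trans (leq_trans jl m2) (leq_trans m3 m1).
  have kk := k_gt0; rewrite ltnNge => /negP; apply.
  by rewrite -[X in (X <= _)%N]expn1 leq_pexp2l //; lia.
have big P w i f : (q <= w)%N -> Kset i w f ->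
    `|pairing f (\sum_(a < k | P a) y a)| <= 22 * (1 + cnt k P / 2 ^+ (2 * e)).
  rewrite mulnC exprM -mE => qw Kf.
  have c0 : 0 <= cnt k P / (m q)%:R ^+ 2 by rewrite divr_ge0 ?cnt_ge0 ?exprn_ge0 // ltW.
  move: qw; rewrite leq_eqVlt => /orP[/eqP qw|qw].
    by rewrite -qw in Kf; apply: (le_trans (special_bound P Kf)); lra.
  have [w1 wf] := Kset_weighted G C (leq_trans q0 (ltnW qw)) Kf.
  have mw v : ((m q) ^ 5 <= v)%N -> 2 / v%:R <= 2 / (m q)%:R ^+ 2 :> R.
    move=> vq; have mv : (m q ^ 2 <= v)%N.
      by apply: leq_trans vq; rewrite leq_pexp2l // (m_gt0 G).
    rewrite -natrX ler_wpM2l // lef_pV2 ?posrE ?ler_nat // ltr0n ?expn_gt0 ?(m_gt0 G) //.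
    by apply: leq_trans mv; rewrite expn_gt0 (m_gt0 G).
  have mj l : (0 < l <= 2 * k)%N -> 2 / (m (j l))%:R ^+ 4 <= 2 / (m q)%:R ^+ 2 :> R.
    move=> lk; rewrite -natrX; apply: mw; apply: (leq_trans (m5_le G q0 (qj l lk))).
    by rewrite -{1}(expn1 (m _)) leq_pexp2l // (m_gt0 G) // (ltn_trans q0 (qj l lk)).
  have [b1 _] := weighted_sum P (mw _ (m5_le G q0 qw)) mj w1 (K_ball (Kset_K Kf)) wf.
  by apply: (le_trans b1); move: c0; lra.
have yc a : (a < k)%N -> nle (y a) 22 by move=> ak; apply: nle_le (y_nle ak); lra.
have yw a w f : (a < k)%N -> (1 < w < q)%N -> weighted w f ->
    `|pairing f (y a)| <= 22 / (m w)%:R.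
  move=> ak /andP[w1 wq] wf.
  have i0 : (0 : R) <= (m w)%:R^-1 by rewrite invr_ge0.
  have b1 : (0 < (2 * a).+1 <= 2 * k)%N by lia.
  have b2 : (0 < (2 * a).+2 <= 2 * k)%N by lia.
  have [_ z1 _] := zex b1; have [_ z2 _] := zex b2.
  have {}z1 := z1 w f _ wf; have {}z2 := z2 w f _ wf.
  rewrite pairingDr; apply: (le_trans (ler_normD _ _)).
  apply: le_trans; first apply: lerD; [apply: z1|apply: z2|by lra].
    by rewrite w1 (ltn_trans wq (qj _ b1)).
  by rewrite w1 (ltn_trans wq (qj _ b2)).
have := ris_estimate G C q1 _ y_succ yc yw (fun w i f P => @big P w i f) xpredT (leqnn _).
rewrite cntT => H; apply: nle_le (H _); last by lra.
rewrite -/M [(2 * e)%N]mulnC [2 ^+ (e * 2)]exprM -mE.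
have npM : M ^+ (3 * e) <= (n q)%:R by rewrite /M -natrX ler_nat (pow3_le_n G).
have mpM : (m q)%:R ^+ 2 <= M ^+ e by rewrite /M -!natrX ler_nat (m2_le_pow G).
have key : M ^+ (e * 2) <= (2 * k)%:R / (m q)%:R ^+ 2.
  rewrite ler_pdivlMr ?exprn_gt0 // -nq; apply: le_trans npM.
  apply: (@le_trans _ _ (M ^+ (e * 2) * M ^+ e)); first by rewrite ler_wpM2l // exprn_ge0.
  by rewrite -exprD; have -> : (e * 2 + e = 3 * e)%N by lia.
move: key; rewrite natrM.
have -> : 66 * k%:R / (m q)%:R ^+ 2 = 22 * (2 * k%:R / (m q)%:R ^+ 2 + k%:R / (m q)%:R ^+ 2) :> R.
  by field; rewrite gt_eqF.
by lra.
Qed.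

End Estimate.
End DependentSequences.

(** * Construction of special sequences *)

Section Construction.
Variables (R : realType) (m n s : nat -> nat).
Variable sigma : seq (c00 R * c00 R) -> nat.
Hypotheses (G : growth m n s) (C : coding m sigma).
Implicit Types (x f g h w : c00 R) (phi : seq (c00 R * c00 R)).

Notation Kset := (Kset m n sigma).
Notation K := (norming_set m n sigma).
Notation nle := (nle m n sigma).
Notation exact_vec := (exact_vec m n sigma).
Notation special_seq := (special_seq m n sigma).
Notation basis_average := (basis_average m n).

Lemma greedy_seq (A : Type) (a0 : A) (step : seq A -> A -> Prop) :
  (forall r, (forall l, (l < size r)%N -> step (take l r) (nth a0 r l)) ->
     exists a, step r a) ->
  forall l, exists2 r, size r = l &
    forall l', (l' < l)%N -> step (take l' r) (nth a0 r l').
Proof.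
move=> H; elim=> [|l [r sr rs]]; first by exists [::].
have [|a ra] := H r; first by rewrite sr.
exists (rcons r a); first by rewrite size_rcons sr.
move=> l'; rewrite ltnS leq_eqVlt => /orP[/eqP ->|l'l].
  by rewrite -sr -cats1 take_size_cat // nth_cat ltnn subnn.
by rewrite nth_rcons sr l'l -cats1 takel_cat ?sr ?(ltnW l'l) //; apply: rs.
Qed.

Lemma norm_oo_le f (b : R) : (forall k, `|f k| <= b) -> norm_oo f <= b.
Proof.
move=> fb; apply: ge_sup; first by exists `|f 0%N|, 0%N.
by move=> _ [k _ <-].
Qed.

Lemma basis_sum_at (L : seq nat) c : uniq L -> (forall l, l \in L -> (1 <= l)%N) ->
  (\sum_(l <- L) basis_vec R l) c = (c \in L)%:R.
Proof.
move=> uL L1; rewrite c00_sumE; have [cL|cL] := boolP (c \in L).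
  rewrite (big_rem c) // basis_vecE (L1 _ cL) eqxx.
  have -> : \sum_(l <- rem c L) basis_vec R l c = 0.
    apply: big1_seq => i /andP[_ ir]; rewrite basis_vecE.
    case: eqP => [ci|]; last by rewrite andbF.
    by rewrite -ci mem_rem_uniq // inE eqxx in ir.
  by rewrite /= addr0.
apply: big1_seq => i /andP[_ iL]; rewrite basis_vecE.
by case: eqP => [ci|]; rewrite ?andbF //; rewrite ci iL in cL.
Qed.

Lemma basis_average_pairing p x f : (0 < p)%N -> basis_average p x f ->
  (m p)%:R * pairing f x = 1.
Proof.
move=> p0 [L [[uL sL] L1 -> ->]]; rewrite pairingZl pairingZr pairing_suml.
have -> : \sum_(l <- L) pairing (basis_vec R l) (\sum_(l <- L) basis_vec R l) = (n p)%:R :> R.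
  rewrite -sL -sum1_size natr_sum big_seq [RHS]big_seq; apply: eq_bigr => l lL.
  by rewrite pairing_basisl basis_sum_at // lL.
have m0 : (0 : R) < (m p)%:R by rewrite ltr0n (m_gt0 G).
have n0 : (0 : R) < (n p)%:R by rewrite ltr0n (n_gt0 G).
by field; rewrite !gt_eqF.
Qed.

Section Run.
Variables (q k p0 : nat).
Hypotheses (oq : odd q) (q2 : (2 < q)%N) (nq : n q = (2 * k)%N).
Hypotheses (p01 : (1 < p0)%N) (ep0 : ~~ odd p0) (p0k : ((2 * k) ^ 2 < m p0)%N).
Variables (PO : nat -> c00 R -> c00 R -> Prop) (PE : nat -> c00 R -> c00 R -> c00 R -> Prop).

(** An entry (x, f, w) contributes the pair (x, f) to the coded sequence. The vector w
    is recorded beside it so that the later entries are supported beyond w too. *)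
Definition entry := (c00 R * c00 R * c00 R)%type.

Definition top (r : seq entry) : nat :=
  \max_(e <- r) maxn (maxn (bound e.1.1) (bound e.1.2)) (bound e.2).

Definition code (r : seq entry) : nat := if r is [::] then p0 else sigma (map fst r).

Definition even_entry p x f w : Prop :=
  [/\ exists i, Kset i p f, forall i g, Kset i p g -> `|pairing g x| <= (m p)%:R^-1 & PE p x f w].

Definition odd_entry p x f : Prop := basis_average p x f /\ PO p x f.

Definition step (r : seq entry) (e : entry) : Prop :=
  [/\ forall c, supp e.1.1 c \/ supp e.1.2 c \/ supp e.2 c -> (top r < c)%N,
      Qset e.1.1, Qset e.1.2 &
      if odd (size r) then even_entry (code r) e.1.1 e.1.2 e.2
      else odd_entry (code r) e.1.1 e.1.2].

Lemma top_gt (r : seq entry) e c : (e : entry) \in r ->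
  supp e.1.1 c \/ supp e.1.2 c \/ supp e.2 c -> (c < top r)%N.
Proof.
move=> er ec; apply: (@leq_trans (maxn (maxn (bound e.1.1) (bound e.1.2)) (bound e.2))).
  by case: ec => [|[]] /supp_lt_bound; rewrite !leq_max => -> //; rewrite !orbT.
exact: (@leq_bigmax_seq _ r xpredT (fun e : entry => maxn (maxn (bound e.1.1) (bound e.1.2)) (bound e.2)) e er).
Qed.

Notation e0 := ((0, 0, 0) : entry).

Definition run (r : seq entry) : Prop :=
  forall l, (l < size r)%N -> step (take l r) (nth e0 r l).

Lemma run_supp_lt r a b c d : run r -> (a < b < size r)%N ->
  (let e := nth e0 r a in supp e.1.1 c \/ supp e.1.2 c \/ supp e.2 c) ->
  (let e := nth e0 r b in supp e.1.1 d \/ supp e.1.2 d \/ supp e.2 d) -> (c < d)%N.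
Proof.
move=> rr /andP[ab br] ca db; have [H _ _ _] := rr b br.
apply: ltn_trans (H _ db); apply: top_gt ca.
by rewrite -(nth_take _ ab) mem_nth // size_take br.
Qed.

Lemma run_xs (r : seq entry) l : xs (map fst r) l.+1 = (nth e0 r l).1.1.
Proof.
rewrite /xs /=; have [lr|lr] := ltnP l (size r); first by rewrite (nth_map e0).
by rewrite !nth_default // size_map.
Qed.

Lemma run_fs (r : seq entry) l : fs (map fst r) l.+1 = (nth e0 r l).1.2.
Proof.
rewrite /fs /=; have [lr|lr] := ltnP l (size r); first by rewrite (nth_map e0).
by rewrite !nth_default // size_map.
Qed.

Lemma run_Qs r : run r -> (0 < size r)%N -> Qs (map fst r).
Proof.
move=> rr r0; split; rewrite size_map //.
  by move=> [|i] // ir; rewrite run_xs run_fs; have [] := rr i ir.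
move=> [|i] // /andP[_ ir]; rewrite !run_xs !run_fs => c d.
have L : forall c d, (supp (nth e0 r i).1.1 c \/ supp (nth e0 r i).1.2 c) ->
   (supp (nth e0 r i.+1).1.1 d \/ supp (nth e0 r i.+1).1.2 d) -> (c < d)%N.
  move=> c' d' hc hd; apply: (@run_supp_lt r i i.+1) => //=; first by rewrite ltnSn.
    by case: hc; tauto.
  by case: hd; tauto.
move=> hc hd.
have [c' [cc' hc']] : exists c', (c <= c')%N /\ (supp (nth e0 r i).1.1 c' \/ supp (nth e0 r i).1.2 c').
  by case: hc => -[_ [c' [_ sc /andP[_ cc]]]]; exists c'; split => //; [left|right].
have [d' [dd' hd']] : exists d', (d' <= d)%N /\ (supp (nth e0 r i.+1).1.1 d' \/ supp (nth e0 r i.+1).1.2 d').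
  by case: hd => -[d' [_ [sd _ /andP[dd _]]]]; exists d'; split => //; [left|right].
by have := L _ _ hc' hd'; lia.
Qed.

Lemma code_take r l : run r -> (0 < l <= size r)%N -> code (take l r) = sigma (take l (map fst r)).
Proof. by move=> rr lr; rewrite /code -map_take; case: r rr lr => [|e r] _; case: l. Qed.

Lemma code_even r : run r -> (1 < code r)%N /\ ~~ odd (code r).
Proof.
move=> rr; rewrite /code; case: r rr => [//|e r] rr.
by apply: (coding_gt1 C); apply: run_Qs.
Qed.

Hypothesis odd_provider : forall N p, (1 < p)%N -> ~~ odd p ->
  exists x f, [/\ forall c, supp x c \/ supp f c -> (N < c)%N, basis_average p x f & PO p x f].
Hypothesis even_provider : forall N p, (1 < p)%N -> ~~ odd p ->
  exists x f w, [/\ forall c, supp x c \/ supp f c \/ supp w c -> (N < c)%N, Qset x, Qset f &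
    even_entry p x f w].

Lemma basis_average_Q p x f : (1 < p)%N -> basis_average p x f -> Qset x /\ Qset f.
Proof.
move=> p1 [L [[uL sL] L1 -> ->]].
have Lb c : ratnum ((\sum_(l <- L) basis_vec R l) c) /\ `|(\sum_(l <- L) basis_vec R l) c| <= 1.
  by rewrite basis_sum_at // normr_nat; split; [exact: ratnum_nat|case: (c \in L)].
have np0 : (0 < n p)%N by rewrite (n_gt0 G) // ltnW.
have mp0 : (0 < m p)%N by rewrite (m_gt0 G) // ltnW.
have [l lL _] := big_element uL sL np0 L1.
have scal v : (0 < v)%N -> Qset (v%:R^-1 *: \sum_(l <- L) basis_vec R l : c00 R).
  move=> v0; split.
    exists l; rewrite suppE c00_ZE mulf_neq0 //; last exact: supp_basis_sum.
    by rewrite invr_eq0 pnatr_eq0 -lt0n.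
  move=> c; have [rc lc] := Lb c; rewrite c00_ZE; split.
    by apply: ratnumM => //; apply/ratnumV/ratnum_nat.
  rewrite normrM -[leRHS]mulr1; apply: ler_pM => //.
  by rewrite ger0_norm ?invr_ge0 // invf_le1 ?ltr0n // ler1n.
by split; apply: scal.
Qed.

Lemma run_exists : exists2 r, size r = (2 * k)%N & run r.
Proof.
have [r|r sr rr] := @greedy_seq entry e0 step _ (2 * k)%N; last first.
  by exists r => // l; rewrite sr; exact: rr.
move=> /code_even[c1 ec]; rewrite /step; case: (boolP (odd (size r))) => osr.
  have [x [f [w [sup Qx Qf e]]]] := even_provider (top r) c1 ec.
  by exists (x, f, w).
have [x [f [sup ba po]]] := odd_provider (top r) c1 ec.
have [Qx Qf] := basis_average_Q c1 ba.
exists (x, f, 0); split => //= c [sx|[sf|/nsuppP //]]; apply: sup; by [left|right].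
Qed.

Lemma run_special r : run r -> size r = (2 * k)%N -> special_seq k (map fst r).
Proof.
move=> rr sr.
have k0 : (0 < k)%N by have := n_gt0 G (ltnW (ltnW q2)); lia.
have pQ : Qs (map fst r) by apply: run_Qs => //; rewrite sr; lia.
have r0 : (0 < size r)%N by rewrite sr; lia.
split.
- by rewrite size_map.
- have [_ _ _] := rr 0%N r0; rewrite take0 /= => -[ba _].
  exists p0./2; have -> : (2 * p0./2 = p0)%N by lia.
  split; [lia| |by rewrite run_xs run_fs].
  have -> : (2 * k)%:R = Num.sqrt ((2 * k) ^ 2)%:R :> R.
    by rewrite natrX sqrtr_sqr ger0_norm.
  by rewrite ltr_sqrt; [rewrite ltr_nat|rewrite ltr0n; exact: leq_ltn_trans p0k].
- move=> i ik q'; have ir : ((2 * i).-1 < size r)%N by rewrite sr; lia.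
  have [_ _ _] := rr _ ir; rewrite size_take ir; have -> : odd (2 * i).-1 by lia.
  have -> : (2 * i)%N = (2 * i).-1.+1 by lia.
  rewrite run_xs run_fs code_take //; last by move: ir; clear -ik; lia.
  have -> : (2 * i).-1.+1 = (2 * i)%N by lia.
  rewrite -/q' => -[[i' Kf] gx _]; split; last exact: gx Kf.
  have q'0 : (0 < q')%N.
    by have [|q'1 _] := @coding_gt1 _ _ _ C (take (2 * i).-1 (map fst r)); [apply: Qs_take => //; lia|apply: ltnW].
  have [_ wf] := Kset_weighted G C q'0 Kf.
  apply: norm_oo_le => c. exact (weighted_coord G C c wf).
- move=> i ik; have ir : (2 * i < size r)%N by rewrite sr; lia.
  have [_ _ _] := rr _ ir; rewrite size_take ir; have -> : odd (2 * i) = false by lia.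
  by rewrite run_xs run_fs code_take; [case|exact: rr|move: ir; clear -ik; lia].
Qed.

(* The two uses. For rho = 1 the pieces lambda f_(2i-1) + f_(2i) cancel on the pairs
   m x_(2i-1) - m x_(2i), since lambda is f_(2i) (m x_(2i)). For rho = 0 they vanish on
   m x_(2i), because all functionals that may replace f_(2i) have the support of f_(2i),
   which is off x_(2i). *)
Variable rho : R.
Hypothesis PO_exact : forall p x f, PO p x f -> exact_vec p 2 ((rho * (m p)%:R) *: x).
Hypothesis PE_exact : forall p x f w, PE p x f w -> exact_vec p 2 ((m p)%:R *: x).
Hypothesis cancellation : rho = 1 \/
  rho = 0 /\ forall p x f w, PE p x f w -> forall c, supp x c -> supp f c -> False.

(** The combination of odd and even entries has norm of order k / m_q ^ 2 only, while
    the functional H built on the same special sequence reaches the order k / m_q on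
    vectors v_a that the functionals f_a of the even entries norm. *)
Theorem dependent_pair : exists (po pe : nat -> nat) (xo fo xe fe we : nat -> c00 R),
  [/\ forall a, (a < k)%N -> PO (po a) (xo a) (fo a),
      forall a, (a < k)%N -> PE (pe a) (xe a) (fe a) (we a),
      successive k xe,
      nle (\sum_(a < k) ((rho * (m (po a))%:R) *: xo a - (m (pe a))%:R *: xe a))
          (66 * k%:R / (m q)%:R ^+ 2) &
      exists2 H, K H & forall v : nat -> c00 R,
        (forall a c, (a < k)%N -> supp (v a) c -> supp (xe a) c \/ supp (we a) c) ->
        pairing H (\sum_(a < k) v a) = (m q)%:R^-1 * \sum_(a < k) pairing (fe a) (v a)].
Proof.
have [r sr rr] := run_exists.
have sp := run_special rr sr.
have k0 : (0 < k)%N by have := n_gt0 G (ltnW (ltnW q2)); lia.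
have r0 : (0 < size r)%N by rewrite sr; lia.
pose phi := map fst r; pose X l : c00 R := (nth e0 r l).1.1.
pose F l : c00 R := (nth e0 r l).1.2; pose W l : c00 R := (nth e0 r l).2.
pose j l := code (take l.-1 r).
pose z l : c00 R := if odd l then (rho * (m (j l))%:R) *: xs phi l else - ((m (j l))%:R *: xs phi l).
have XE l : xs phi l.+1 = X l by exact: run_xs.
have FE l : fs phi l.+1 = F l by exact: run_fs.
have Ho l : (l < 2 * k)%N -> ~~ odd l -> basis_average (j l.+1) (X l) (F l) /\ PO (j l.+1) (X l) (F l).
  move=> lk ol; have lr : (l < size r)%N by rewrite sr.
  by have [_ _ _] := rr l lr; rewrite size_take lr (negbTE ol).
have He l : (l < 2 * k)%N -> odd l -> even_entry (j l.+1) (X l) (F l) (W l).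
  move=> lk ol; have lr : (l < size r)%N by rewrite sr.
  by have [_ _ _] := rr l lr; rewrite size_take lr ol.
have slt a b c d : (a < b < 2 * k)%N -> supp (X a) c \/ supp (F a) c \/ supp (W a) c ->
    supp (X b) d \/ supp (F b) d \/ supp (W b) d -> (c < d)%N.
  by rewrite -sr => ab; exact: (run_supp_lt rr ab).
have j1 : j 1%N = p0 by rewrite /j take0.
have [ba0 _] := Ho 0%N ltac:(lia) isT.
have jE l : (1 < l <= 2 * k)%N -> j l = sigma (take l.-1 phi).
  by move=> lk; rewrite /j code_take // sr; lia.
have jj l : (0 < l <= 2 * k)%N -> (1 < j l)%N.
  move=> lk; have [->|l1] := eqVneq l 1%N; first by rewrite j1.
  rewrite jE; last by lia.
  have [[pQ _] _ _ _] := sp.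
  by have [] := coding_gt1 C (@Qs_take _ phi l.-1 pQ ltac:(lia)).
have de a : (a < k)%N -> (2 * a < 2 * k)%N by rewrite ltn_pmul2l.
have dO a : (a < k)%N -> ((2 * a).+1 < 2 * k)%N by clear; lia.
have oe a : ~~ odd (2 * a) by rewrite oddM.
have oO a : odd (2 * a).+1 by rewrite /= oddM.
have est := @dependent_estimate R m n s sigma G C q k phi z j oq q2 nq sp.
rewrite j1 in est; have {}est := est p01 (ltnW p0k).
have j12 : (p0 < sigma (take 1 phi))%N.
  by apply: (code_first G C sp k0 p01); rewrite XE FE -j1.
have {}est := est j12 jE.
have zex l : (0 < l <= 2 * k)%N -> exact_vec (j l) 2 (z l).
  case: l => // l lk; rewrite /z XE; case: ifP => ol.
    by have [_] := Ho l lk ol; exact: PO_exact.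
  have [_ _ /PE_exact] := He l lk (negbFE ol).
  by move=> /(exact_vecZ (-1)); rewrite normrN1 mul1r scaleN1r.
have zsupp l a : (0 < l <= 2 * k)%N -> supp (z l) a -> hull2 phi l a.
  by case: l => // l lk; rewrite /z; case: ifP => _; rewrite ?suppN => /suppZ ?; left; apply: hull_suppS.
have {}est := est zex zsupp.
exists (fun a => j (2 * a).+1), (fun a => j (2 * a).+2), (fun a => X (2 * a)%N), (fun a => F (2 * a)%N),
  (fun a => X (2 * a).+1), (fun a => F (2 * a).+1), (fun a => W (2 * a).+1).
split.
- by move=> a ak; have [] := Ho _ (de _ ak) (oe a).
- by move=> a ak; have [] := He _ (dO _ ak) (oO a).
- move=> a b /andP[ab bk] c d sc sd.
  by apply: (slt (2 * a).+1 (2 * b).+1); [lia|left|left].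
- have -> : \sum_(a < k) ((rho * (m (j (2 * a).+1))%:R) *: X (2 * a)%N -
      (m (j (2 * a).+2))%:R *: X (2 * a).+1) = \sum_(a < k) (z (2 * a).+1 + z (2 * a).+2).
    apply: eq_bigr => a _; rewrite /z !XE.
    have -> : odd (2 * a).+1 by lia.
    by have -> : odd (2 * a).+2 = false by lia.
  apply: est => -[//|a] i' g l /andP[_ ak] Kg sg.
  have -> : (2 * a.+1).-1 = (2 * a).+1 by clear; lia.
  have e2 : (2 * a.+1)%N = (2 * a).+2 by clear; lia.
  rewrite e2 in Kg sg *; rewrite XE FE /z !XE.
  have -> : odd (2 * a).+1 by exact: oO.
  have -> : odd (2 * a).+2 = false by rewrite /= oddM.
  rewrite FE in sg; have [ba _] := Ho _ (de _ ak) (oe a).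
  have [_ _ pe] := He _ (dO _ ak) (oO a).
  have := basis_average_pairing (ltnW (jj (2 * a).+1 (de _ ak))) ba.
  set mo : R := (m (j _))%:R; set me : R := (m (j _))%:R; set xo := X (2 * a)%N.
  set xe := X (2 * a).+1; set fo := F (2 * a)%N => av.
  have fo_xe : pairing fo xe = 0.
    apply: pairing_eq0 => c sc sc'; have := slt (2 * a)%N (2 * a).+1 c c.
    by rewrite ltnn ltnSn => H; have := H (dO _ ak) (or_intror (or_introl sc)) (or_introl sc').
  have g_xo : pairing g xo = 0.
    apply: pairing_eq0 => c; rewrite sg => sc sc'; have := slt (2 * a)%N (2 * a).+1 c c.
    by rewrite ltnn ltnSn => H; have := H (dO _ ak) (or_introl sc') (or_intror (or_introl sc)).
  have -> : pairing (l *: fo + g) ((rho * mo) *: xo - me *: xe) = rho * l - me * pairing g xe.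
    rewrite pairingDl pairingZl !pairingDr !pairingNr !pairingZr fo_xe g_xo.
    have -> : l * (rho * mo * pairing fo xo - me * 0) = rho * l * (mo * pairing fo xo) by ring.
    by rewrite av; ring.
  have n2 : 0 <= (n q ^ 2)%:R^-1 :> R by rewrite invr_ge0.
  case: cancellation => [->|[-> disj]].
    rewrite mul1r pairingZr; case: ifP => [_ ->|/negbFE/eqP -> lE]; first by rewrite subrr normr0.
    by rewrite mulr0 subr0; case: lE => ->; rewrite ?normrN ger0_norm.
  rewrite mul0r sub0r normrN pairing_eq0 ?mulr0 ?normr0 // => c; rewrite sg => sf sx.
  exact: disj pe c sx sf.
have [lev levP] : exists lev : nat -> nat, forall a, (a < k)%N -> Kset (lev a) (j (2 * a).+2) (F (2 * a).+1).
  have ex a : exists i, (a < k)%N -> Kset i (j (2 * a).+2) (F (2 * a).+1).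
    have [ak|ak] := boolP (a < k)%N; last by exists 0%N.
    by have [[i Ki] _ _] := He _ (dO _ ak) (oO a); exists i.
  by have [lev levP] := boolp.choice ex; exists lev.
pose I := \max_(a < k) lev a.
have KI a : (a < k)%N -> Kset I (j (2 * a).+2) (F (2 * a).+1).
  move=> ak; apply: (@Kset_mono _ _ _ _ (lev a)); last exact: levP.
  exact: (leq_bigmax (Ordinal ak)).
pose lam i : R := let q' := sigma (take (2 * i).-1 phi) in
  if pairing (fs phi (2 * i)) (xs phi (2 * i)) != 0
  then pairing (fs phi (2 * i)) ((m q')%:R *: xs phi (2 * i)) else (n q ^ 2)%:R^-1.
have qE i : (0 < i <= k)%N -> sigma (take (2 * i).-1 phi) = j (2 * i.-1).+2.
  by move=> ik; rewrite jE; [congr (sigma (take _ _))|]; clear -ik; lia.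
have FE2 i : (0 < i)%N -> fs phi (2 * i) = F (2 * i.-1).+1.
  by move=> i0; rewrite -FE; congr fs; clear -i0; lia.
have XE2 i : (0 < i)%N -> xs phi (2 * i) = X (2 * i.-1).+1.
  by move=> i0; rewrite -XE; congr xs; clear -i0; lia.
have KIi i : (0 < i <= k)%N -> Kset I (sigma (take (2 * i).-1 phi)) (fs phi (2 * i)).
  by move=> ik; rewrite qE // FE2; [apply: KI|]; clear -ik; lia.
exists ((m q)%:R^-1 *: \sum_(1 <= i < k.+1) (lam i *: fs phi (2 * i).-1 + fs phi (2 * i))).
  apply: (@Kset_K _ _ _ _ I.+1 q); rewrite /= /K_step; have -> : (q == 0)%N = false by clear -q2; lia.
  rewrite oq q2 /=; right; exists phi => //.
  exists k, false, `]-oo, +oo[, (fun i => fs phi (2 * i)), lam; split => //.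
  - move=> i ik; split => //; first exact: KIi.
    move=> g; rewrite qE // XE2 ?(proj1 (andP ik)) //.
    have ik' : (i.-1 < k)%N by clear -ik; lia.
    by have [_ gx _] := He _ (dO _ ik') (oO _); exact: gx.
  - move=> i ik; case E: (pairing (fs phi (2 * i)) (xs phi (2 * i)) != 0); rewrite /lam E /=.
      by [].
    by left.
  - rewrite expr0 mul1r; congr (_ *: _); apply: c00_ext => c.
    by rewrite restrE in_itv.
have e1 a : (2 * a.+1).-1 = (2 * a).+1 by clear; lia.
have e2 a : (2 * a.+1)%N = (2 * a).+2 by clear; lia.
move=> v vs; rewrite pairingZl; congr (_ * _); rewrite pairing_suml big_add1 big_mkord.
apply: eq_bigr => a _; rewrite e1 e2 !FE pairing_sumr (bigD1 a) // big1 ?Monoid.mulm1.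
  rewrite pairingDl pairingZl [pairing (F (2 * a)%N) _]pairing_eq0 ?mulr0 ?add0r // => c sf.
  move=> /(vs a c (ltn_ord a)) sv; have := slt (2 * a)%N (2 * a).+1 c c.
  rewrite ltnn ltnSn => H; have := H (dO _ (ltn_ord a)) (or_intror (or_introl sf)).
  by case: sv => sv H'; have := H' ltac:(tauto).
move=> b ba; apply: pairing_eq0 => c sf /(vs b c (ltn_ord b)) sv.
have [l [l1 l2 sl]] : exists l, [/\ (2 * a <= l)%N, (l <= (2 * a).+1)%N & supp (F l) c].
  case: (suppD sf) => [/suppZ|] sl; [exists (2 * a)%N|exists (2 * a).+1]; split => //; clear; lia.
have ak := ltn_ord a; have bk := ltn_ord b.
have [ll|ll] : (l < (2 * b).+1)%N \/ ((2 * b).+1 < l)%N.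
  have {ba} [ba|ba] : (b < a)%N \/ (a < b)%N by apply/orP; rewrite -neq_ltn.
    by right; apply: leq_trans l1; clear -ba; lia.
  by left; apply: (leq_ltn_trans l2); clear -ba; lia.
  have := slt l (2 * b).+1 c c; rewrite ltnn ll (dO _ bk) => H.
  by have := H isT (or_intror (or_introl sl)); case: sv => sv H'; have := H' ltac:(tauto).
have := slt (2 * b).+1 l c c; rewrite ltnn ll => H.
have lk : (l < 2 * k)%N by clear -l2 ak; lia.
by have := H lk; case: sv => sv H'; have := H' ltac:(tauto) (or_intror (or_introl sl)).
Qed.

End Run.
End Construction.

(** * Averages of basis vectors and averages in a subspace *)

Section Providers.
Variables (R : realType) (m n s : nat -> nat).
Variable sigma : seq (c00 R * c00 R) -> nat.
Hypotheses (G : growth m n s) (C : coding m sigma).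
Implicit Types (f g h v : c00 R).

Notation Kset := (Kset m n sigma).
Notation K := (norming_set m n sigma).
Notation nle := (nle m n sigma).
Notation weighted := (weighted m n sigma).
Notation exact_vec := (exact_vec m n sigma).
Notation basis_average := (basis_average m n).
Notation cnt := (@cnt R).

Lemma chain (A : Type) (Q : nat -> A -> Prop) (beta : A -> nat) :
  (forall N, exists a, Q N a) -> forall N0, exists (a : nat -> A) (N : nat -> nat),
  N 0%N = N0 /\ forall i, [/\ Q (N i) (a i), (N i <= N i.+1)%N & (beta (a i) <= N i.+1)%N].
Proof.
move=> /boolp.choice[pick pickP] N0.
pose N := fix N i := if i is i'.+1 then maxn (N i') (beta (pick (N i'))) else N0.
exists (fun i => pick (N i)), N; split => // i; split => //=; first exact: leq_maxl.
exact: leq_maxr.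
Qed.

Lemma chain_le (N : nat -> nat) i j : (forall i, (N i <= N i.+1)%N) -> (i <= j)%N -> (N i <= N j)%N.
Proof.
move=> H /subnK <-; elim: (j - i)%N => [|d IH]; first by rewrite add0n.
by apply: (leq_trans IH); rewrite addSn.
Qed.

Lemma window_succ (N : nat -> nat) (v : nat -> c00 R) d :
  (forall i, (N i <= N i.+1)%N) -> (forall i c, supp (v i) c -> (N i < c < N i.+1)%N) ->
  successive d v.
Proof.
move=> NN vN a b /andP[ab _] c e /vN/andP[_ c2] /vN/andP[e1 _].
by apply: (leq_trans c2); apply: leq_trans (ltnW e1); exact: chain_le.
Qed.

Lemma window_pairing (N : nat -> nat) (f v : nat -> c00 R) d :
  (forall i, (N i <= N i.+1)%N) -> (forall i c, supp (f i) c -> (N i < c < N i.+1)%N) ->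
  (forall i c, supp (v i) c -> (N i < c < N i.+1)%N) ->
  pairing (\sum_(k < d) f k) (\sum_(k < d) v k) = \sum_(k < d) pairing (f k) (v k).
Proof.
move=> NN fS vS; rewrite pairing_suml; apply: eq_bigr => k _.
rewrite pairing_sumr (bigD1 k) // big1 ?Monoid.mulm1 // => k' kk.
apply: pairing_eq0 => c /fS/andP[c1 c2] /vS/andP[c3 c4].
have [lt|lt] : (k < k')%N \/ (k' < k)%N by apply/orP; rewrite -neq_ltn eq_sym.
  by have := chain_le NN lt; clear -c2 c3; lia.
by have := chain_le NN lt; clear -c1 c4; lia.
Qed.

Lemma signed_basis_exact p (l : nat -> nat) (eps : nat -> R) : (1 < p)%N ->
  (forall i j, (i < j)%N -> (l i < l j)%N) -> (forall i, `|eps i| <= 1) ->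
  exact_vec p 2 (((m p)%:R / (n p)%:R) *: \sum_(i < n p) eps i *: basis_vec R (l i)).
Proof.
move=> p1 ll e1.
have -> : (2 : R) = 2 * 1 by rewrite mulr1.
have wb w f i : weighted w f -> `|pairing f (eps i *: basis_vec R (l i))| <= 1 / (m w)%:R.
  move=> wf; rewrite pairingZr normrM; apply: ler_pM => //.
  by rewrite pairing_basisr; exact (weighted_coord G C (l i) wf).
have sum w f (P : pred nat) : weighted w f ->
    `|pairing f (\sum_(i < n p | P i) eps i *: basis_vec R (l i))| <= 1 / (m w)%:R * cnt (n p) P.
  move=> wf; rewrite pairing_sumr /cnt mulr_sumr; apply: (le_trans (ler_norm_sum _ _ _)).
  by apply: ler_sum => i _; rewrite mulr1; exact: wb.
apply: (average_exact (y := fun i => eps i *: basis_vec R (l i)) G C p1 ler01) => //.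
- by move=> a b /andP[ab _] c e /suppZ /supp_basis -> /suppZ /supp_basis ->; exact: ll.
- move=> i _; apply: nle_le (nleZ _ (nle_basis G C _)); by rewrite mulr1.
- by move=> i w f _ _; exact: wb.
- move=> f P _ wf; apply: (le_trans (sum _ _ P wf)).
  by rewrite !mul1r mulrC lerDr.
- move=> w f P pw _ wf; apply: (le_trans (sum _ _ P wf)); rewrite !mul1r mulrC.
  apply: (@le_trans _ _ (cnt (n p) P / (m p)%:R ^+ 5)); last by rewrite lerDr.
  have p0 := ltnW p1; have m0 := m_gt0 G p0.
  rewrite ler_wpM2l ?cnt_ge0 // lef_pV2 ?posrE ?exprn_gt0 ?ltr0n ?(m_gt0 G) //; last by lia.
  by rewrite -natrX ler_nat (m5_le G).
Qed.

Lemma signed_basis_average p (l : nat -> nat) : (forall i j, (i < j)%N -> (l i < l j)%N) ->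
  (forall i, (0 < l i)%N) ->
  basis_average p ((n p)%:R^-1 *: \sum_(i < n p) basis_vec R (l i))
                  ((m p)%:R^-1 *: \sum_(i < n p) basis_vec R (l i)).
Proof.
move=> ll l0; exists [seq l i | i <- iota 0 (n p)]; split.
- rewrite size_map size_iota; split => //; rewrite map_inj_uniq ?iota_uniq // => i j e.
  by apply/eqP; apply/negPn/negP; rewrite neq_ltn => /orP[] /ll; rewrite e ltnn.
- by move=> c /mapP[i _ ->].
- by rewrite big_map -(big_mkord xpredT (fun i => basis_vec R (l i))) /index_iota subn0.
- by rewrite big_map -(big_mkord xpredT (fun i => basis_vec R (l i))) /index_iota subn0.
Qed.

Lemma supp_basis_average (N : nat) (a : R) d (l : nat -> nat) c :
  (forall i, (N < l i)%N) -> supp (a *: \sum_(i < d) basis_vec R (l i)) c -> (N < c)%N.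
Proof. by move=> lN /suppZ /supp_sum[i [_ _ /supp_basis ->]]. Qed.

(** Finitely many functionals of the norming set have a common level. *)
Lemma even_K p d (f : nat -> c00 R) : (1 < p)%N -> ~~ odd p -> (0 < d <= n p)%N ->
  (forall k, (k < d)%N -> K (f k)) -> successive d f ->
  exists i, Kset i p ((m p)%:R^-1 *: \sum_(k < d) f k).
Proof.
move=> p1 ep dn fK fs.
have ex k : exists i, (k < d)%N -> exists j, Kset i j (f k).
  have [kd|kd] := boolP (k < d)%N; last by exists 0%N.
  by have [i _ [j _ Kf]] := fK k kd; exists i => _; exists j.
have [lev levP] := boolp.choice ex; exists (\max_(k < d) lev k).+1.
rewrite /= /K_step ep; case: eqP => [p0|_]; first by rewrite p0 in p1.
right; exists d, (fun i => f i.-1); split => //.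
- move=> [//|i] /= id; have [j Kf] := levP i id; exists j => //.
  by apply: Kset_mono Kf; exact: (leq_bigmax (Ordinal id)).
- by move=> [|i] // [|i'] // _; rewrite ltnS /= => ii id; apply: fs; rewrite ii.
- by rewrite big_add1 big_mkord.
Qed.

Lemma not_nle v b : ~ nle v b -> exists2 f, K f & b < pairing f v.
Proof.
move=> nb; apply: contrapT => H; apply: nb => f Kf; rewrite ler_norml.
apply/andP; split; rewrite leNgt; apply/negP => lt; apply: H.
  exists (- f); first exact: K_opp.
  by rewrite pairingNl; lra.
by exists f.
Qed.

(** Restriction to an interval leads out of the norming set only to 0. *)
Lemma norming_window v b lo hi : 0 <= b -> ~ nle v b ->
  (forall c, supp v c -> (lo < c < hi)%N) ->
  exists f, [/\ K f, b < pairing f v & forall c, supp f c -> (lo < c < hi)%N].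
Proof.
move=> b0 /not_nle[f Kf bf] vs; exists (restr `]lo, hi[ f).
have e : pairing (restr `]lo, hi[ f) v = pairing f v.
  by apply: pairing_restr_id => c /vs; rewrite in_itv.
split; [|by rewrite e|by move=> c /supp_restr[]; rewrite in_itv].
case: Kf => i _ [j _ Kf]; have [/Kset_K //|z] := Kset_restr `]lo, hi[ Kf.
by move: bf; rewrite -e z pairing0l ltNge b0.
Qed.

Section InSubspace.
Variable nrm : c00 R -> R.
Hypothesis nrmP : forall v b, nle v b <-> nrm v <= b.
Hypothesis nrmZ : forall a v, nrm (a *: v) = `|a| * nrm v.
Variable W : c00 R -> Prop.
Hypothesis WZ : forall a v, W v -> W (a *: v).
Hypothesis WD : forall u v, W u -> W v -> set_lt (supp u) (supp v) -> W (u + v).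
Hypothesis Wex : forall N, exists v,
  [/\ W v, v != 0, ratvec v & forall c, supp v c -> (N < c)%N].

Lemma W_sum d (v : nat -> c00 R) : (0 < d)%N -> (forall k, (k < d)%N -> W (v k)) ->
  successive d v -> W (\sum_(k < d) v k).
Proof.
case: d => // d _; elim: d => [|d IH] vW vs; first by rewrite big_ord1; apply: vW.
rewrite big_ord_recr /=; apply: WD; [|exact: vW|].
  apply: IH => [k kd|a b /andP[ab bd]]; first by apply: vW; lia.
  by apply: vs; lia.
move=> a b /supp_sum[i [_ _ vi]] vb; apply: (vs i d.+1) vi vb.
by have := ltn_ord i; lia.
Qed.

Lemma W_normalized N : exists v,
  [/\ W v, ratvec v, forall c, supp v c -> (N < c)%N, nle v 1 & ~ nle v (2^-1)].
Proof.
have [v [Wv v0 rv vN]] := Wex N.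
have [c vc] := supp_nonempty v0.
have t0 : 0 < nrm v.
  apply: (@lt_le_trans _ _ `|v c|); first by rewrite normr_gt0.
  by apply: nle_coord; apply/nrmP.
(* The scaling factor is rational, so that v stays rational; hence a norm between
   1/2 and 1 and not the norm 1. *)
have [|r] := @rat_in_itvoo R ((2 * nrm v)^-1) (nrm v)^-1.
  by rewrite ltf_pV2 ?posrE ?mulr_gt0 //; lra.
rewrite in_itv /= => /andP[r1 r2].
have r0 : 0 < ratr r :> R by apply: lt_trans r1; rewrite invr_gt0 mulr_gt0.
exists (ratr r *: v); split.
- exact: WZ.
- by apply: ratvecZ => //; exists r.
- by move=> a /suppZ; exact: vN.
- by apply/nrmP; rewrite nrmZ gtr0_norm // -ler_pdivlMr // mul1r ltW.
- move=> /nrmP; rewrite nrmZ gtr0_norm // leNgt => /negP; apply.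
  by rewrite -ltr_pdivrMr // -invfM.
Qed.

Lemma sum_blocks (b : nat -> c00 R) D d i :
  \sum_(j < d) \sum_((i + j) * D <= k < (i + j).+1 * D) b k =
  \sum_(i * D <= k < (i + d) * D) b k.
Proof.
elim: d => [|d IH]; first by rewrite big_ord0 addn0 big_geq.
rewrite big_ord_recr /= IH addnS [RHS](@big_cat_nat _ _ _ ((i + d) * D)) //.
  by rewrite leq_mul2r leq_addr orbT.
by rewrite leq_mul2r leqnSn orbT.
Qed.

(** Let l = 4 n_(p-1) and s = s_(p-1), so that n_p = l ^ s. If averaging l successive
    vectors always halved the norm, a sum of n_p blocks would have norm at most
    n_p / 2 ^ s, whereas the operation of index p shows that it is at least of order
    n_p / m_p, and 2 ^ s is much larger than m_p. So at some stage r the average keeps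
    half of the norm; being an average of l vectors, it is small on functionals of
    weight w with n_w ^ 2 <= l. *)
Lemma l1_average p N : (1 < p)%N -> ~~ odd p -> exists v,
  [/\ W v /\ ratvec v, forall c, supp v c -> (N < c)%N, nle v 1, ~ nle v (2^-1) &
    forall w f, (1 < w)%N -> (w < p.-1)%N -> weighted w f -> `|pairing f v| <= 2 / (m w)%:R].
Proof.
move=> p1 ep; have [b [M [M0 bM]]] := chain (@bound R) W_normalized N.
have bW i : W (b i) by have [[]] := bM i.
have bR i : ratvec (b i) by have [[]] := bM i.
have b1 i : nle (b i) 1 by have [[]] := bM i.
have b2 i : ~ nle (b i) 2^-1 by have [[]] := bM i.
have MM i : (M i <= M i.+1)%N by have [] := bM i.
have bS i c : supp (b i) c -> (M i < c < M i.+1)%N.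
  have [[_ _ bN _ _] _ bb] := bM i => bc; rewrite bN //=.
  exact: leq_trans (supp_lt_bound bc) bb.
set l := (4 * n p.-1)%N; set r0 := s p.-1.
have l0 : (0 < l)%N by rewrite /l muln_gt0 (n_gt0 G) //; lia.
have lR : (0 : R) < l%:R by rewrite ltr0n.
pose u r i := \sum_(i * l ^ r <= k < i.+1 * l ^ r) b k.
have uS r i : u r.+1 i = \sum_(j < l) u r (i * l + j)%N.
  rewrite /u sum_blocks; have -> : (i * l * l ^ r = i * l ^ r.+1)%N by rewrite expnS mulnA.
  by have -> : ((i * l + l) * l ^ r = i.+1 * l ^ r.+1)%N by rewrite -mulSnr -mulnA expnS.
have uW r i : [/\ W (u r i), ratvec (u r i) &
    forall c, supp (u r i) c -> (M (i * l ^ r) < c < M (i.+1 * l ^ r))%N].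
  have lr : (0 < l ^ r)%N by rewrite expn_gt0 l0.
  have uE : u r i = \sum_(k < l ^ r) b (i * l ^ r + k)%N.
    rewrite /u mulSn addnC -{1}[(i * l ^ r)%N]add0n big_addn addnC addnK big_mkord.
    by apply: eq_bigr => k _; rewrite addnC.
  split.
  - rewrite uE; apply: (W_sum (v := fun k => b (i * l ^ r + k)%N)) => // a c ac.
    apply: (window_succ (d := (i * l ^ r + l ^ r)%N) MM bS).
    by rewrite ltn_add2l ltn_add2l.
  - by rewrite uE; apply: ratvec_sum => k _ _; exact: bR.
  - move=> c; rewrite uE => /supp_sum[k [_ _ /bS/andP[c1 c2]]].
    rewrite (leq_ltn_trans _ c1) /=; last by apply: chain_le => //; exact: leq_addr.
    by apply: (leq_trans c2); apply: chain_le => //; rewrite mulSn addnC ltn_add2r.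
have u_succ r d i : successive d (fun j => u r (i + j)%N).
  move=> j j' /andP[jj _] c e uc ue.
  have [_ _ /(_ _ uc)/andP[_ c2]] := uW r (i + j)%N.
  have [_ _ /(_ _ ue)/andP[e1 _]] := uW r (i + j')%N.
  apply: (leq_trans c2); apply: leq_trans (ltnW e1); apply: chain_le => //.
  by rewrite leq_mul2r -addnS leq_add2l jj orbT.
have [r [i [ub un]]] : exists r i, (forall i', nle (u r i') ((l%:R / 2) ^+ r)) /\
    ~ nle (u r.+1 i) ((l%:R / 2) ^+ r.+1).
  apply: contrapT => H.
  have all r i : nle (u r i) ((l%:R / 2) ^+ r).
    elim: r i => [|r IH] i; last first.
      by apply: contrapT => un; apply: H; exists r, i.
    by rewrite /u expn0 !muln1 big_nat1 expr0.
  have small : nle (\sum_(k < n p) b k) ((l%:R / 2) ^+ r0).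
    by have := all r0 0%N; rewrite /u mul0n mul1n -(nE G p1) big_mkord.
  have ex k : exists f, [/\ K f, 2^-1 < pairing f (b k) & forall c, supp f c -> (M k < c < M k.+1)%N].
    by apply: norming_window => //; exact: bS.
  have [f fP] := boolp.choice ex.
  have fK k : K (f k) by have [] := fP k.
  have fS k c : supp (f k) c -> (M k < c < M k.+1)%N by have [_ _] := fP k; apply.
  have np : (0 < n p <= n p)%N by rewrite (n_gt0 G) ?leqnn //; lia.
  have [lev Kf] := even_K p1 ep np (fun k _ => fK k) (window_succ (d := n p) MM fS).
  have := small _ (Kset_K Kf); rewrite pairingZl (window_pairing _ MM fS bS).
  set S := \sum_(k < n p) _.
  have Sn : (n p)%:R / 2 <= S.
    have -> : (n p)%:R / 2 = \sum_(k < n p) 2^-1 :> R by rewrite sumr_const card_ord mulr_natl.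
    by apply: ler_sum => k _; have [_ /ltW] := fP k.
  have p0 : (0 < p)%N by lia.
  have m2 : (2 : R) <= (m p)%:R by rewrite ler_nat (m_ge2 G).
  have m0 : (0 : R) < (m p)%:R by lra.
  have n0 : (0 : R) < (n p)%:R by rewrite ltr0n (n_gt0 G).
  have nl : (n p)%:R = l%:R ^+ r0 :> R by rewrite (nE G p1) natrX.
  have ms : (m p)%:R ^+ 3 <= 2 ^+ r0 :> R.
    rewrite -!natrX ler_nat; have := growth_s G (j := p.-1).
    by rewrite prednK //; apply; lia.
  rewrite normrM ger0_norm ?invr_ge0 ?ler0n // => le.
  have {}le : (m p)%:R^-1 * ((n p)%:R / 2) <= (n p)%:R / 2 ^+ r0 :> R.
    apply: (@le_trans _ _ ((m p)%:R^-1 * `|S|)).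
      by apply: ler_wpM2l; [rewrite invr_ge0 ltW|exact: le_trans Sn (ler_norm _)].
    by apply: (le_trans le); rewrite nl expr_div_n.
  have : (m p)%:R^-1 * ((n p)%:R / 2) <= (n p)%:R / (m p)%:R ^+ 3 :> R.
    by apply: (le_trans le); rewrite ler_pM2l // lef_pV2 ?posrE ?exprn_gt0.
  rewrite ler_pdivlMr ?exprn_gt0 //.
  have -> : (m p)%:R^-1 * ((n p)%:R / 2) * (m p)%:R ^+ 3 = (n p)%:R * ((m p)%:R * (m p)%:R / 2) :> R.
    by field; rewrite gt_eqF.
  by rewrite -[leRHS]mulr1 ler_pM2l //; move: m2; nra.
pose v j := (2 / l%:R) ^+ r *: u r (i * l + j)%N.
have c0 : (0 : R) < 2 / l%:R by rewrite divr_gt0.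
have c1 : (2 / l%:R) ^+ r * (l%:R / 2) ^+ r = 1 :> R.
  by rewrite -exprMn; have -> : 2 / l%:R * (l%:R / 2) = 1 :> R;
    [by field; rewrite gt_eqF|rewrite expr1n].
have v1 j : nle (v j) 1.
  by rewrite -c1 -[X in X * _]ger0_norm ?exprn_ge0 ?ltW //; apply: nleZ; apply: ub.
have vsum : \sum_(j < l) v j = (2 / l%:R) ^+ r *: u r.+1 i by rewrite uS scaler_sumr.
have vs : successive l v.
  by move=> a c ac; apply: set_ltS (u_succ r l (i * l)%N a c ac) => e; exact: suppZ.
exists (l%:R^-1 *: \sum_(j < l) v j); split.
- split; first by rewrite vsum scalerA; apply: WZ; have [] := uW r.+1 i.
  apply: ratvecZ; first by apply/ratnumV/ratnum_nat.
  rewrite vsum; apply: ratvecZ; last by have [] := uW r.+1 i.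
  rewrite expr_div_n -!natrX; apply: ratnumM; first exact: ratnum_nat.
  by apply/ratnumV/ratnum_nat.
- move=> c; rewrite vsum => /suppZ /suppZ uc; have [_ _ /(_ _ uc)/andP[uc1 _]] := uW r.+1 i.
  by apply: leq_ltn_trans uc1; rewrite -M0; apply: chain_le.
- have : nle (\sum_(j < l) v j) (\sum_(j < l) 1) by apply: nle_sum.
  rewrite sumr_const card_ord => /(nleZ l%:R^-1).
  by rewrite ger0_norm ?invr_ge0 // mulVf // gt_eqF.
- move=> ny; apply: un; have := nleZ ((l%:R / 2) ^+ r * l%:R) ny.
  rewrite !scalerA vsum scalerA mulfK ?gt_eqF // [X in X *: _]mulrC c1 scale1r.
  rewrite ger0_norm; first by rewrite exprSr mulrA.
  by rewrite mulr_ge0 // exprn_ge0 // divr_ge0.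
- move=> w f w1 wp wf; have w0 : (0 < w)%N by lia.
  have mi : (0 : R) <= (m w)%:R^-1 by rewrite invr_ge0.
  have be : (0 : R) <= (m w)%:R^-1 * ((n w)%:R * 1) by rewrite mulr_ge0 // mulr_ge0.
  have H : `|pairing f (\sum_(j < l) v j)| <= (n w)%:R * ((m w)%:R^-1 * ((n w)%:R * 1)) +
      (m w)%:R^-1 * ((n w)%:R * 0 + 1 * cnt l xpredT).
    apply: (split_estimate (P := xpredT) w0 wf be (lexx 0) ler01 _ vs) => [j jl _|Q _].
      exact: weighted_bound wf (v1 j).
    by rewrite add0r mul1r; apply: nle_sum.
  rewrite cntT in H; rewrite pairingZr normrM ger0_norm ?invr_ge0 ?ler0n //.
  rewrite mulrC ler_pdivrMr //; apply: (le_trans H).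
  have nw : (n w)%:R * (n w)%:R <= l%:R :> R.
    rewrite -natrM ler_nat /l; apply: (leq_trans (n_sqr_le G w0 wp)).
    by rewrite leq_pmull.
  have -> : (n w)%:R * ((m w)%:R^-1 * ((n w)%:R * 1)) + (m w)%:R^-1 * ((n w)%:R * 0 + 1 * l%:R) =
    (m w)%:R^-1 * ((n w)%:R * (n w)%:R + l%:R) :> R by ring.
  have -> : 2 / (m w)%:R * l%:R = (m w)%:R^-1 * (2 * l%:R) :> R by ring.
  by apply: ler_wpM2l => //; lra.
Qed.

(** The average of n_p such vectors y_k, chosen so sparsely that a functional of large
    weight w acts on at most one of them noticeably: it is averaged out on the y_k
    with w < M_k, and on those with support below w / m_(p+1) its coordinates 1 / m_w are
    too small. The factor 1/4 of x and the bound 1/8 come from average_exact and from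
    the normalization of y_k. *)
Theorem subspace_average p N : (1 < p)%N -> ~~ odd p -> exists x f,
  [/\ forall c, supp x c \/ supp f c -> (N < c)%N, Qset x /\ Qset f,
    (exists i, Kset i p f) /\ forall i g, Kset i p g -> `|pairing g x| <= (m p)%:R^-1,
    exact_vec p 2 ((m p)%:R *: x) & W x /\ 8^-1 <= pairing f ((m p)%:R *: x)].
Proof.
move=> p1 ep.
have p0 : (0 < p)%N by lia.
have step M : exists v, [/\ W v /\ ratvec v, forall c, supp v c -> (M < c)%N, nle v 1, ~ nle v (2^-1) &
    forall w f, (1 < w < M)%N -> weighted w f -> `|pairing f v| <= 2 / (m w)%:R].
  have q1 : (1 < M.+1.*2)%N by lia.
  have eq : ~~ odd M.+1.*2 by rewrite odd_double.
  have [v [Wv vM v1 v2 vw]] := l1_average M q1 eq.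
  by exists v; split => // w f wM; apply: vw; lia.
have [y [M [M0 yM]]] := chain (fun v => bound v * m p.+1)%N step (maxn N p.+1).
have yW i : W (y i) by have [[[]]] := yM i.
have yR i : ratvec (y i) by have [[[]]] := yM i.
have y1 i : nle (y i) 1 by have [[]] := yM i.
have y2 i : ~ nle (y i) 2^-1 by have [[]] := yM i.
have yw i w f : (1 < w < M i)%N -> weighted w f -> `|pairing f (y i)| <= 2 / (m w)%:R.
  by have [[_ _ _ _ H] _ _] := yM i; exact: H.
have yb i : (bound (y i) * m p.+1 <= M i.+1)%N by have [] := yM i.
have MM i : (M i <= M i.+1)%N by have [] := yM i.
have m1 : (0 < m p.+1)%N by rewrite (m_gt0 G).
have yS i c : supp (y i) c -> (M i < c < M i.+1)%N.
  have [[_ yN _ _ _] _ _] := yM i => yc; rewrite yN //=; apply: leq_trans (yb i).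
  by apply: (leq_trans (supp_lt_bound yc)); rewrite leq_pmulr.
have pM i : (p < M i)%N by apply: leq_trans (chain_le MM (leq0n i)); rewrite M0 leq_maxr.
have NM i : (N <= M i)%N by apply: leq_trans (chain_le MM (leq0n i)); rewrite M0 leq_maxl.
have mp0 : (0 : R) < (m p)%:R by rewrite ltr0n (m_gt0 G).
have np0 : (0 : R) < (n p)%:R by rewrite ltr0n (n_gt0 G).
have ys : successive (n p) y by exact: window_succ MM yS.
have m5 w : (p < w)%N -> 2 / (m w)%:R <= 2 / (m p)%:R ^+ 5 :> R.
  move=> pw; rewrite ler_wpM2l // lef_pV2 ?posrE ?exprn_gt0 ?ltr0n ?(m_gt0 G) //; last by lia.
  by rewrite -natrX ler_nat (m5_le G).
have ex : exact_vec p 4 (((m p)%:R / (n p)%:R) *: \sum_(k < n p) y k).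
  have -> : (4 : R) = 2 * 2 by lra.
  apply: (average_exact (y := y) G C p1 _ ys) => //.
  - by move=> k _; apply: nle_le (y1 k); lra.
  - by move=> k w f _ /andP[w1 wp]; apply: yw; rewrite w1 (ltn_trans wp).
  - move=> f P _ wf; rewrite pairing_sumr; apply: (le_trans (ler_norm_sum _ _ _)).
    apply: (@le_trans _ _ (\sum_(k < n p | P k) 2 / (m p)%:R)).
      by apply: ler_sum => k _; apply: yw => //; rewrite p1 pM.
    rewrite mulrDr mulr1 /cnt mulr_suml mulr_sumr.
    by under [in leRHS]eq_bigr do rewrite mul1r; rewrite lerDr.
  - move=> w f P pw Bf wf.
    pose ex k := (M k <= w < M k.+1)%N.
    have ex1 : cnt (n p) ex <= 1.
      apply: cnt_le1 => a b /andP[ab _] /andP[_ a2] /andP[b1 _].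
      by have := leq_trans a2 (chain_le MM ab); rewrite ltnNge b1.
    apply: (@le_trans _ _ (cnt (n p) ex + 2 / (m p)%:R ^+ 5 * cnt (n p) P)); last first.
      have -> : 2 / (m p)%:R ^+ 5 * cnt (n p) P = 2 * (cnt (n p) P / (m p)%:R ^+ 5) :> R by ring.
      by rewrite mulrDr mulr1 lerD2r; move: ex1; lra.
    rewrite pairing_sumr; apply: (le_trans (ler_norm_sum _ _ _)).
    rewrite /cnt mulr_sumr [leLHS]big_mkcond /= (big_mkcond (fun k : 'I_(n p) => ex k)).
    rewrite (big_mkcond (fun k : 'I_(n p) => P k)) -big_split /=; apply: ler_sum => k _.
    have i0 : 0 <= 2 / (m p)%:R ^+ 5 :> R by rewrite divr_ge0 // exprn_ge0 // ltW.
    case: (P k); last by rewrite addr0; case: ifP.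
    rewrite mulr1; have [wM|Mw] := ltnP w (M k).
      have -> : ex k = false by rewrite /ex leqNgt wM.
      by rewrite add0r; apply: le_trans (m5 _ pw); apply: yw => //; rewrite wM andbT; lia.
    have [wM|Mw'] := ltnP w (M k.+1).
      have -> : ex k by rewrite /ex Mw wM.
      have e1 : `|pairing f (y k)| <= 1 by apply: Bf; exact: y1.
      by apply: (le_trans e1); rewrite lerDl.
    have -> : ex k = false by rewrite /ex Mw ltnNge Mw'.
    have mw0 : (0 : R) < (m w)%:R by rewrite ltr0n (m_gt0 G) //; lia.
    have yc c : `|y k c| <= 1 by exact: nle_coord (y1 k).
    have := pairing_bound (fun c => weighted_coord G C c wf) yc.
    rewrite add0r => /le_trans; apply; rewrite mulrC ler_pdivrMr // mulrAC ler_pdivlMr ?exprn_gt0 //.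
    rewrite -natrX -!natrM ler_nat -(growth_mS G) //; apply: (leq_trans (yb k)).
    apply: (leq_trans Mw'); have := m_gt G (ltn_trans p0 pw); lia.
set z := (m p)%:R / (n p)%:R *: _ in ex.
pose x := 4^-1 *: ((n p)%:R^-1 *: \sum_(k < n p) y k) : c00 R.
have mx : (m p)%:R *: x = 4^-1 *: z.
  by rewrite /x /z !scalerA; congr (_ *: _); field; rewrite !gt_eqF.
have xex : exact_vec p 1 ((m p)%:R *: x).
  rewrite mx; have := exact_vecZ 4^-1 ex; rewrite ger0_norm ?invr_ge0 //.
  by rewrite mulVf.
have fex k : exists f, [/\ K f, 2^-1 < pairing f (y k) &
    forall c, supp f c -> (M k < c < M k.+1)%N].
  by apply: norming_window => //; exact: yS.
have [f fP] := boolp.choice fex.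
have fK k : K (f k) by have [] := fP k.
have fS k c : supp (f k) c -> (M k < c < M k.+1)%N by have [_ _] := fP k; apply.
have np : (0 < n p <= n p)%N by rewrite (n_gt0 G) ?leqnn.
have [lev Kf] := even_K p1 ep np (fun k _ => fK k) (window_succ (d := n p) MM fS).
set h := (m p)%:R^-1 *: _ in Kf.
have hx : 8^-1 <= pairing h ((m p)%:R *: x).
  rewrite mx /z /h !pairingZr pairingZl (window_pairing _ MM fS yS).
  set S := \sum_(k < n p) _.
  have Sn : (n p)%:R / 2 <= S.
    have -> : (n p)%:R / 2 = \sum_(k < n p) 2^-1 :> R by rewrite sumr_const card_ord mulr_natl.
    by apply: ler_sum => k _; have [_ /ltW] := fP k.
  have -> : 4^-1 * ((m p)%:R / (n p)%:R * ((m p)%:R^-1 * S)) = 4^-1 * (S / (n p)%:R).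
    by field; rewrite !gt_eqF.
  have : 2^-1 <= S / (n p)%:R by rewrite ler_pdivlMr // mulrC.
  by lra.
have [xc _ _] := xex.
have gx i g : Kset i p g -> `|pairing g x| <= (m p)%:R^-1.
  move=> /Kset_K /xc; rewrite pairingZr normrM gtr0_norm // => gx.
  by rewrite -[leRHS]mul1r ler_pdivlMr // mulrC.
exists x, h; split.
- move=> c [/suppZ /suppZ|/suppZ] /supp_sum[k [_ _]].
    by move=> /yS/andP[kc _]; exact: leq_ltn_trans (NM k) kc.
  by move=> /fS/andP[kc _]; exact: leq_ltn_trans (NM k) kc.
- split; split.
  + apply: supp_nonempty; apply/eqP => x0; move: hx; rewrite x0 scaler0 pairing0r; lra.
  + move=> c; split; first by apply: ratvecZ; [apply/ratnumV/ratnum_nat|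
      apply: ratvecZ; [apply/ratnumV/ratnum_nat|apply: ratvec_sum => k _ _; exact: yR]].
    have := nle_coord c xc; rewrite c00_ZE normrM gtr0_norm // => mxc.
    by apply: le_trans mxc; rewrite ler_peMl // ler1n (m_gt0 G).
  + apply: supp_nonempty; apply/eqP => h0; move: hx; rewrite h0 pairing0l; lra.
  + by move=> c; split; [exact: (Kset_rat Kf)|exact (K_coord_le1 G C c (Kset_K Kf))].
- by split => //; exists lev.
- by apply: exact_vec_le xex; lra.
- split => //; apply/WZ/WZ/W_sum => //; exact: n_gt0 G _ p0.
Qed.

End InSubspace.
End Providers.

(** * Coordinates on the completion *)

Section LargeIndices.
Variables (R : realType) (m n s : nat -> nat) (G : growth m n s).

Lemma large_odd (B : R) : exists q k, [/\ odd q, (2 < q)%N, n q = (2 * k)%N & B < (m q)%:R].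
Proof.
have tB := truncnS_gt B; move: (Num.truncn B) tB => t tB.
have q2 : (2 < t.*2.+3)%N by lia.
have q3 : ((n t.*2.+3) = 2 * (n t.*2.+3)./2)%N.
  by have := n_even G (ltnW q2); move: (n _) => N; lia.
exists t.*2.+3, (n t.*2.+3)./2; split => //; first by rewrite /= odd_double.
apply: (lt_trans tB); rewrite ltr_nat; apply: leq_ltn_trans (m_gt G _) => //.
by rewrite -addnn; lia.
Qed.

Lemma large_even k : exists p, [/\ (1 < p)%N, ~~ odd p & (k < m p)%N].
Proof.
have k2 : (k < k.+1.*2)%N by rewrite -addnn; lia.
exists (k.+1).*2; rewrite odd_double; split => //.
by apply: (ltn_trans k2); apply: m_gt G _ _.
Qed.

End LargeIndices.

Section Completion.
Variables (R : realType) (m n s : nat -> nat).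
Variable sigma : seq (c00 R * c00 R) -> nat.
Hypotheses (G : growth m n s) (C : coding m sigma).
Variables (X : completeNormedModType R) (iota : {linear c00 R -> X}).
Hypothesis compl : is_completion (norm_K m n sigma) iota.
Implicit Types (f g v : c00 R) (x y : X).

Notation K := (norming_set m n sigma).
Notation nle := (nle m n sigma).

Lemma nle_norm v b : nle v b <-> `|iota v| <= b.
Proof.
have E : `|iota v|%:E = norm_K m n sigma v by have [H _] := compl; exact: H.
split => [vb|vb f Kf].
  rewrite -lee_fin E; apply: ge_ereal_sup => _ [f Kf <-]; rewrite lee_fin.
  exact: le_trans (ler_norm _) (vb f Kf).
have up g : K g -> pairing g v <= `|iota v|.
  by move=> Kg; rewrite -lee_fin E; apply: ereal_sup_ubound; exists g.
rewrite ler_norml; apply/andP; split; last exact: le_trans (up _ Kf) vb.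
by rewrite lerNl; apply: le_trans vb; rewrite -pairingNl; apply/up/K_opp.
Qed.

Lemma norm_coord v k : `|v k| <= `|iota v|.
Proof. by apply: (@nle_coord R m n sigma); apply/nle_norm. Qed.

Lemma approx x (e : R) : 0 < e -> exists v, `|x - iota v| < e.
Proof.
move=> e0; have [_ /(_ (ball x e))] := compl.
case; [by exists x; exact: ballxx|exact: ball_open|].
by move=> y [yb [v _ vy]]; exists v; move: yb; rewrite -vy -ball_normE.
Qed.

(** The coordinates are 1-Lipschitz on the dense subspace, and this is McShane's formula
    for the extension of such a function. Additivity and homogeneity follow by
    approximation. *)
Definition coord k x : R := sup [set v k - `|x - iota v| | v in [set: c00 R]].

Lemma coordP k x v : `|v k - coord k x| <= `|x - iota v|.
Proof.
have ub (u u' : c00 R) : u k - `|x - iota u| <= u' k + `|x - iota u'|.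
  rewrite lerBlDr -addrA -lerBlDl.
  apply: (le_trans (ler_norm (u k - u' k))).
  apply: (le_trans (norm_coord (u - u') k)); rewrite linearB /=.
  have -> : iota u - iota u' = (x - iota u') - (x - iota u) by rewrite opprB [RHS]addrC subrKA.
  exact: ler_normB.
have hs (u' : c00 R) : has_ubound [set u k - `|x - iota u| | u in [set: c00 R]].
  by exists (u' k + `|x - iota u'|) => _ [u _ <-].
rewrite ler_norml; apply/andP; split.
  rewrite lerBrDr addrC -lerBrDr opprK; apply: ge_sup.
    by exists (v k - `|x - iota v|), v.
  by move=> _ [u _ <-]; exact: ub.
rewrite lerBlDr -lerBlDl; apply: (@le_trans _ _ (v k - `|x - iota v|)); first by lra.
by apply: ub_le_sup; [exact: (hs v)|exists v].
Qed.

Lemma coord_unique k x r :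
  (forall e : R, 0 < e -> exists v, `|x - iota v| < e /\ `|v k - r| < e) -> coord k x = r.
Proof.
move=> H; apply/eqP; rewrite -subr_eq0 -normr_eq0 eq_le normr_ge0 andbT.
apply/ler_addgt0Pl => e e0; rewrite addr0.
have [|v [xv vr]] := H (e / 2); first by lra.
have -> : coord k x - r = (v k - r) - (v k - coord k x) by lra.
apply: (le_trans (ler_normB _ _)); have := coordP k x v; lra.
Qed.

Lemma coord_iota k v : coord k (iota v) = v k.
Proof. by apply: coord_unique => e e0; exists v; rewrite !subrr !normr0. Qed.

Lemma coordD k x y : coord k (x + y) = coord k x + coord k y.
Proof.
apply: coord_unique => e e0; have e2 : 0 < e / 2 by lra.
have [u xu] := approx x e2; have [v yv] := approx y e2; exists (u + v); split.
  rewrite linearD /= opprD addrACA; apply: (le_lt_trans (ler_normD _ _)); lra.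
rewrite c00_DE opprD addrACA; apply: (le_lt_trans (ler_normD _ _)).
have := coordP k x u; have := coordP k y v; lra.
Qed.

Lemma coordZ k a x : coord k (a *: x) = a * coord k x.
Proof.
apply: coord_unique => e e0.
have a1 : 0 < `|a| + 1 by have := normr_ge0 a; lra.
have e2 : 0 < e / (`|a| + 1) by rewrite divr_gt0.
have key t : t < e / (`|a| + 1) -> 0 <= t -> `|a| * t < e.
  move=> te t0; have : t * (`|a| + 1) < e by rewrite -ltr_pdivlMr.
  by have := normr_ge0 a; nra.
have [u xu] := approx x e2; exists (a *: u); split.
  by rewrite linearZ /= -scalerBr normrZ; apply: key.
by rewrite c00_ZE -mulrBr normrM; apply: key => //; exact: le_lt_trans (coordP k x u) xu.
Qed.

Lemma coord_norm k x : `|coord k x| <= `|x|.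
Proof. by have := coordP k x 0; rewrite linear0 subr0 sub0r normrN. Qed.

Lemma bounded_bound (T : {linear X -> X}) : bounded_fun_norm T ->
  exists2 M : R, 0 < M & forall x, `|T x| <= M * `|x|.
Proof.
move=> /(_ 1)[M TM]; exists (`|M| + 1); first by have := normr_ge0 M; lra.
move=> x; have [->|x0] := eqVneq x 0; first by rewrite linear0 !normr0 mulr0.
have nx : 0 < `|x| by rewrite normr_gt0.
have : `|T (`|x|^-1 *: x)| <= M.
  by apply: TM; rewrite normrZ gtr0_norm ?invr_gt0 // mulVf // gt_eqF.
rewrite linearZ /= normrZ gtr0_norm ?invr_gt0 // mulrC ler_pdivrMr // => H.
by apply: (le_trans H); rewrite ler_wpM2r // ?(ltW nx) //; have := ler_norm M; lra.
Qed.

(** Signed averages of n_p basis vectors have norm at most 2 / m_p. If h were larger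
    than e on infinitely many basis vectors, it would be larger than e on such
    averages for every p. *)
Lemma weak_null (h : X -> R) (M : R) :
  (forall x y, h (x + y) = h x + h y) -> (forall a x, h (a *: x) = a * h x) ->
  (forall x, `|h x| <= M * `|x|) ->
  forall e : R, 0 < e -> exists N, forall l, (N < l)%N -> `|h (iota (basis_vec R l))| <= e.
Proof.
move=> hD hZ hM e e0; apply: contrapT => H.
have big N : exists l, (N < l)%N /\ e < `|h (iota (basis_vec R l))|.
  apply: contrapT => H'; apply: H; exists N => l Nl; rewrite leNgt; apply/negP => el.
  by apply: H'; exists l.
have hsum (I : Type) (r : seq I) (P : pred I) (F : I -> X) :
    h (\sum_(i <- r | P i) F i) = \sum_(i <- r | P i) h (F i).
  elim/big_rec2: _ => [|i a b _ <-]; last exact: hD.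
  by rewrite -(scale0r 0) hZ mul0r.
have [l [N [_ lN]]] := chain (fun l => l.+1) big 0%N.
have NN i : (N i <= N i.+1)%N by have [] := lN i.
have ll i j : (i < j)%N -> (l i < l j)%N.
  move=> ij; have [_ _ h1] := lN i; have [[h2 _] _ _] := lN j.
  by apply: (leq_trans h1); apply: leq_trans (ltnW h2); exact: chain_le.
have le i : e < `|h (iota (basis_vec R (l i)))| by have [[]] := lN i.
pose eps i := Num.sg (h (iota (basis_vec R (l i)))).
have eps1 i : `|eps i| <= 1 by rewrite normr_sg; case: (_ == _).
have [p [p1 pM]] : exists p, (1 < p)%N /\ 2 * M < p%:R * e.
  exists (Num.truncn (2 * M / e)).+2; split => //.
  rewrite -ltr_pdivrMr //; apply: (lt_trans (truncnS_gt _)).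
  by rewrite ltr_nat.
have [zn _ _] := signed_basis_exact G C p1 ll eps1.
have p0 : (0 < p)%N by apply: ltnW.
have mp0 : (0 : R) < (m p)%:R by rewrite ltr0n (m_gt0 G).
have np0 : (0 : R) < (n p)%:R by rewrite ltr0n (n_gt0 G).
have M0 : 0 <= M.
  have x1 : 0 < `|iota (basis_vec R (l 0%N))|.
    rewrite normr_gt0; apply/eqP => z; have := le 0%N; rewrite z -(scale0r 0) hZ mul0r normr0; lra.
  rewrite -(pmulr_lge0 _ x1); apply: le_trans (hM _) => //.
have : (m p)%:R * e <= 2 * M.
  move: zn => /nle_norm; set z := _ *: _ => zn.
  apply: (@le_trans _ _ (h (iota z))); last first.
    apply: (le_trans (ler_norm _)); apply: (le_trans (hM _)).
    by rewrite mulrC ler_wpM2r.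
  rewrite /z linearZ /= hZ linear_sum hsum.
  have -> : (m p)%:R * e = (m p)%:R / (n p)%:R * ((n p)%:R * e) by field; rewrite gt_eqF.
  apply: ler_wpM2l; first by rewrite divr_ge0 // ltW.
  rewrite mulr_natl -[X in e *+ X]card_ord -sumr_const; apply: ler_sum => i _.
  by rewrite linearZ /= hZ /eps -normrEsg ltW.
apply/negP; rewrite -ltNge; apply: (lt_le_trans pM).
by rewrite ler_pM2r // ler_nat; apply/ltnW/(m_gt G).
Qed.

End Completion.

(** * Bounded operators are nearly diagonal on the basis *)

Section NearDiagonal.
Variables (R : realType) (m n s : nat -> nat).
Variable sigma : seq (c00 R * c00 R) -> nat.
Hypotheses (G : growth m n s) (C : coding m sigma).
Variables (X : completeNormedModType R) (iota : {linear c00 R -> X}).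
Hypothesis compl : is_completion (norm_K m n sigma) iota.
Variables (T : {linear X -> X}) (M : R).
Hypotheses (M0 : 0 < M) (TM : forall x, `|T x| <= M * `|x|).
Implicit Types (f g v : c00 R).

Notation Kset := (Kset m n sigma).
Notation K := (norming_set m n sigma).
Notation nle := (nle m n sigma).
Notation exact_vec := (exact_vec m n sigma).
Notation basis_average := (basis_average m n).
Notation e_ l := (basis_vec R l).

Lemma uniform_weak_null N (e : R) : 0 < e -> exists N', forall c l, (c <= N)%N -> (N' < l)%N ->
  `|coord iota c (T (iota (e_ l)))| <= e.
Proof.
move=> e0; have ex c : exists N', forall l, (N' < l)%N -> `|coord iota c (T (iota (e_ l)))| <= e.
  apply: (weak_null G C compl (h := fun x => coord iota c (T x)) (M := M)) => //.
  - by move=> x y; rewrite linearD; exact: coordD compl _ _ _.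
  - by move=> a x; rewrite linearZ; exact: coordZ compl _ _ _.
  - by move=> x; apply: le_trans (TM x); exact: coord_norm compl _ _.
have [N' N'P] := boolp.choice ex; exists (\max_(c < N.+1) N' c) => c l cN Nl.
apply: N'P; apply: leq_ltn_trans Nl.
by rewrite -ltnS in cN; exact: (leq_bigmax (Ordinal cN)).
Qed.

Section Contradiction.
Variables (delta : R) (N0 : nat).
Hypothesis delta0 : 0 < delta.
Let a_ l := coord iota l (T (iota (e_ l))).
Hypothesis far : forall l, (N0 < l)%N -> delta < `|T (iota (e_ l)) - a_ l *: iota (e_ l)|.

(** By weak nullity T e_l is close to a finitely supported vector v whose coordinates up
    to N are small; w is v without these and without its coordinate l. A functional g0
    that norms w is restricted to one side of l, since the norming set is stable under
    restriction to intervals only; half of the norm survives. *)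
Lemma off_diagonal N (e : R) : 0 < e -> e <= delta / 4 -> exists l w g,
  [/\ (N < l)%N, K g, forall c, supp w c \/ supp g c -> (N < c)%N /\ c <> l,
      `|T (iota (e_ l)) - iota (a_ l *: e_ l + w)| <= e & delta / 4 <= pairing g w].
Proof.
move=> e0 ed; pose e' := e / (2 * N + 4)%:R.
have N4 : (0 : R) < (2 * N + 4)%:R by rewrite ltr0n addnS.
have e'0 : 0 < e' by rewrite divr_gt0.
(* The error is e' for v, twice e' for each of N + 1 initial coordinates, and e' for
   the coordinate l. *)
have [N' N'P] := uniform_weak_null N e'0.
pose l := (maxn N (maxn N0 N')).+1.
have Nl : (N < l)%N by rewrite /l ltnS leq_maxl.
have N0l : (N0 < l)%N by rewrite /l ltnS !leq_max leqnn orbT.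
have N'l : (N' < l)%N by rewrite /l ltnS !leq_max leqnn !orbT.
have [v vT] := approx compl (T (iota (e_ l))) e'0.
pose w := restr `]N, +oo[ v - v l *: e_ l.
have wE c : w c = if (N < c)%N && (c != l) then v c else 0.
  rewrite /w c00_DE c00_NE c00_ZE restrE basis_vecE in_itv /= andbT ltEnat /=.
  have [->|cl] := eqVneq c l; last by rewrite !andbF mulr0 subr0 andbT.
  by rewrite Nl (leq_ltn_trans (leq0n N) Nl) /= mulr1 subrr.
have ws c : supp w c -> (N < c)%N /\ c <> l.
  by rewrite suppE wE; case: ifP => [/andP[Nc /eqP cl] //|]; rewrite eqxx.
have vE : v - (a_ l *: e_ l + w) = \sum_(c < N.+1) v c *: e_ c + (v l - a_ l) *: e_ l.
  have vS : v = \sum_(c < N.+1) v c *: e_ c + restr `]N, +oo[ v.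
    have -> : \sum_(c < N.+1) v c *: e_ c = v - restr `]N, +oo[ v; last by rewrite subrK.
    rewrite [RHS](@c00_expand R _ N.+1) => [|c Nc].
      apply: eq_bigr => c _; congr (_ *: _).
      rewrite c00_DE c00_NE restrE in_itv /= andbT ltEnat /= ltnNge -ltnS ltn_ord.
      by rewrite subr0.
    by rewrite c00_DE c00_NE restrE in_itv /= andbT ltEnat /= Nc subrr.
  rewrite {1}vS /w; set S := \sum_(c < _) _; set r := restr _ _.
  apply: c00_ext => c; rewrite !(c00_DE, c00_NE, c00_ZE); ring.
clearbody w.
have small : nle (v - (a_ l *: e_ l + w)) ((2 * N + 3)%:R * e').
  rewrite vE; apply: nle_le; last first.
    apply: nleD; last exact: nleZ (nle_basis G C l).
    by apply: nle_sum => c _; exact: nleZ (nle_basis G C c).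
  have -> : (2 * N + 3)%:R * e' = \sum_(c < N.+1) (2 * e') + e' :> R.
    by rewrite sumr_const card_ord -[_ *+ N.+1]mulr_natl -natr1 natrD natrM; ring.
  apply: lerD; last by rewrite mulr1; apply: ltW; apply: le_lt_trans vT; exact: coordP compl _ _ _.
  apply: ler_sum => c _; rewrite mulr1.
  have c1 := coordP compl c (T (iota (e_ l))) v.
  have c2 : `|coord iota c (T (iota (e_ l)))| <= e' by apply: N'P => //; rewrite -ltnS.
  have -> : v c = (v c - coord iota c (T (iota (e_ l)))) + coord iota c (T (iota (e_ l))) by lra.
  by apply: (le_trans (ler_normD _ _)); move: vT; lra.
have close : `|T (iota (e_ l)) - iota (a_ l *: e_ l + w)| <= e.
  have -> : T (iota (e_ l)) - iota (a_ l *: e_ l + w) =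
      (T (iota (e_ l)) - iota v) + iota (v - (a_ l *: e_ l + w)).
    by rewrite [iota (v - _)]linearB /= subrKA.
  have := (nle_norm compl _ _).1 small => small'.
  apply: (le_trans (ler_normD _ _)).
  have -> : e = (2 * N + 3)%:R * e' + e'.
    have N3 : (2 * N + 4)%:R = (2 * N + 3)%:R + 1 :> R by rewrite !natrD; ring.
    by rewrite -[X in _ + X]mul1r -mulrDl -N3 mulrC divfK // gt_eqF.
  by move: vT small'; lra.
have wbig : ~ nle w (delta / 2).
  move=> /(nle_norm compl) wn; have := far N0l.
  have -> : T (iota (e_ l)) - a_ l *: iota (e_ l) =
     (T (iota (e_ l)) - iota (a_ l *: e_ l + w)) + iota w.
    have -> : iota (a_ l *: e_ l + w) = a_ l *: iota (e_ l) + iota w by rewrite linearD linearZ.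
    by rewrite opprD addrA subrK.
  by apply/negP; rewrite -leNgt; apply: (le_trans (ler_normD _ _)); lra.
have [g0 Kg0 g0w] := not_nle wbig.
have g0E : pairing g0 w = pairing (restr `]N, l[ g0) w + pairing (restr `]l, +oo[ g0) w.
  rewrite !pairing_restr -pairingDr; congr pairing; apply: c00_ext => c.
  rewrite [RHS]c00_DE !restrE !in_itv /= andbT !ltEnat /= wE.
  have [cl|cl|cl] := ssrnat.ltngtP c l; rewrite ?andbT ?andbF ?add0r ?addr0 //.
  by case: (N < c)%N.
have restrK E : 0 < pairing (restr E g0) w -> K (restr E g0).
  case: Kg0 => i _ [j _ Kg]; have [/Kset_K //|->] := Kset_restr E Kg.
  by rewrite pairing0l ltxx.
have [big|big] : delta / 4 <= pairing (restr `]N, l[ g0) w \/ delta / 4 <= pairing (restr `]l, +oo[ g0) w.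
  rewrite g0E in g0w; have [|lt] := leP (delta / 4) (pairing (restr `]N, l[ g0) w); [by left|right].
  by move: lt g0w; lra.
exists l, w, (restr `]N, l[ g0); split => //; first by apply: restrK; lra.
  move=> c [/ws //|/supp_restr[]]; rewrite in_itv /= !ltEnat /= => /andP[c1 c2] _.
  by split => //; apply/eqP; rewrite ltn_eqF.
exists l, w, (restr `]l, +oo[ g0); split => //; first by apply: restrK; lra.
move=> c [/ws //|/supp_restr[]]; rewrite in_itv /= andbT ltEnat /= => lc _.
by split; [exact: ltn_trans lc|apply/eqP; rewrite gtn_eqF].
Qed.

(** The even entries: the functional f has the index p of the basis average x, vanishes
    on x and on everything supported on x, and yet is large on T (m_p x), which is
    close to m_p (d + w). *)
Definition off_diagonal_average (eta : R) p (x f w : c00 R) : Prop :=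
  [/\ exact_vec p 2 ((m p)%:R *: x), forall c, supp x c -> supp f c -> False &
    exists d, [/\ forall c, supp d c -> supp x c,
      `|T (iota ((m p)%:R *: x)) - iota ((m p)%:R *: (d + w))| <= eta &
      delta / 4 <= pairing f ((m p)%:R *: (d + w))]].

Lemma off_diagonal_provider (eta : R) N p : 0 < eta -> (1 < p)%N -> ~~ odd p ->
  exists x f w : c00 R, [/\ forall c, supp x c \/ supp f c \/ supp w c -> (N < c)%N, Qset x, Qset f &
    even_entry m n sigma (off_diagonal_average eta) p x f w].
Proof.
move=> eta0 p1 ep; have p0 : (0 < p)%N by apply: ltnW.
have mp0 : (0 : R) < (m p)%:R by rewrite ltr0n (m_gt0 G).
have np0 : (0 : R) < (n p)%:R by rewrite ltr0n (n_gt0 G).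
pose e := Num.min (eta / (m p)%:R) (delta / 4).
have e0 : 0 < e by rewrite lt_min !divr_gt0.
have e1 : e <= eta / (m p)%:R by rewrite ge_min lexx.
have e2 : e <= delta / 4 by rewrite ge_min lexx orbT.
pose Q k (a : nat * c00 R * c00 R) := let: (l, w, g) := a in
  [/\ (k < l)%N, K g, forall c, supp w c \/ supp g c -> (k < c)%N /\ c <> l,
      `|T (iota (e_ l)) - iota (a_ l *: e_ l + w)| <= e & delta / 4 <= pairing g w].
have Qex k : exists a, Q k a.
  by have [l [w [g H]]] := off_diagonal k e0 e2; exists (l, w, g).
have [a [L [L0 aL]]] := chain (fun a : nat * c00 R * c00 R =>
  maxn a.1.1.+1 (maxn (bound a.1.2) (bound a.2))) Qex N.
pose l i := (a i).1.1; pose w i := (a i).1.2; pose g i := (a i).2.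
have aP i : [/\ (L i < l i)%N, K (g i), forall c, supp (w i) c \/ supp (g i) c -> (L i < c)%N /\ c <> l i,
      `|T (iota (e_ (l i))) - iota (a_ (l i) *: e_ (l i) + w i)| <= e & delta / 4 <= pairing (g i) (w i)].
  by have [] := aL i; rewrite /l /w /g; case: (a i) => [[]].
have LL i : (L i <= L i.+1)%N by have [] := aL i.
have lS i : (L i < l i < L i.+1)%N.
  have [-> _ _ _ _] := aP i; have [_ _] := aL i.
  by apply: leq_trans; rewrite leq_max leqnn.
have wS i c : supp (w i) c -> (L i < c < L i.+1)%N.
  move=> wc; have [_ _ /(_ c (or_introl wc))[-> _] _ _] := aP i; have [_ _] := aL i.
  by apply: leq_trans; rewrite !leq_max (supp_lt_bound wc) orbT.
have gS i c : supp (g i) c -> (L i < c < L i.+1)%N.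
  move=> gc; have [_ _ /(_ c (or_intror gc))[-> _] _ _] := aP i; have [_ _] := aL i.
  by apply: leq_trans; rewrite !leq_max (supp_lt_bound gc) !orbT.
have ll i j : (i < j)%N -> (l i < l j)%N.
  move=> ij; have /andP[_ h1] := lS i; have /andP[h2 _] := lS j.
  by apply: (leq_trans h1); apply: leq_trans (ltnW h2); exact: chain_le.
have Nl i : (N < l i)%N.
  by have /andP[h _] := lS i; apply: leq_ltn_trans h; rewrite -L0; exact: chain_le.
have l0 i : (0 < l i)%N by apply: leq_ltn_trans (Nl i).
have gK i : K (g i) by have [] := aP i.
have np : (0 < n p <= n p)%N by rewrite (n_gt0 G) ?leqnn.
pose x : c00 R := (n p)%:R^-1 *: \sum_(i < n p) e_ (l i).
pose d : c00 R := (n p)%:R^-1 *: \sum_(i < n p) a_ (l i) *: e_ (l i).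
pose ws : c00 R := (n p)%:R^-1 *: \sum_(i < n p) w i.
have [lev Kf] := even_K p1 ep np (fun i _ => gK i) (window_succ (d := n p) LL gS).
set f := (m p)%:R^-1 *: _ in Kf.
have ba := @signed_basis_average R m n p l ll l0.
have [Qx _] := basis_average_Q G p1 ba.
have sx i : (i < n p)%N -> supp x (l i).
  move=> ip; rewrite suppE /x c00_ZE mulf_neq0 ?invr_eq0 ?pnatr_eq0 -?lt0n ?(n_gt0 G) //.
  have pos : 0 < (\sum_(i < n p) e_ (l i)) (l i).
    rewrite c00_sumE (bigD1 (Ordinal ip)) //; apply: ltr_pwDl.
      by rewrite basis_vecE eqxx l0 ltr01.
    by apply: sumr_ge0 => j _; rewrite basis_vecE ler0n.
  by rewrite gt_eqF.
have xl c : supp x c -> exists2 i, (i < n p)%N & c = l i.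
  by move=> /suppZ /supp_sum[i [_ _ /supp_basis ->]]; exists i.
have disj c : supp x c -> supp f c -> False.
  move=> /xl[i ip ->] /suppZ /supp_sum[j [_ _ gc]].
  have [ij|ij|ij] := ssrnat.ltngtP i j.
  - have /andP[h1 _] := gS _ _ gc; have /andP[_ h2] := lS i.
    by have := leq_trans h2 (chain_le LL ij); rewrite ltnNge ltnW.
  - have /andP[_ h1] := gS _ _ gc; have /andP[h2 _] := lS i.
    by have := leq_trans h1 (chain_le LL ij); rewrite ltnNge ltnW.
  - have [_ _ /(_ _ (or_intror gc))[_ +] _ _] := aP j; rewrite ij; exact.
have dx c : supp d c -> supp x c.
  by move=> /suppZ /supp_sum[i [_ _ /suppZ /supp_basis ->]]; apply: sx.
have fv : delta / 4 <= pairing f ((m p)%:R *: (d + ws)).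
  rewrite pairingZr pairingDr [pairing f d]pairing_eq0 ?add0r; last first.
    by move=> c fc /dx xc; exact: disj xc fc.
  rewrite /ws /f pairingZr pairingZl (window_pairing _ LL gS wS).
  set S := \sum_(i < n p) _.
  have Sn : (n p)%:R * (delta / 4) <= S.
    rewrite -[X in X%:R * _]card_ord mulr_natl -sumr_const; apply: ler_sum => i _.
    by have [] := aP i.
  have -> : (m p)%:R * ((n p)%:R^-1 * ((m p)%:R^-1 * S)) = S / (n p)%:R.
    by field; rewrite !gt_eqF.
  by rewrite ler_pdivlMr // mulrC.
have Terr : `|T (iota ((m p)%:R *: x)) - iota ((m p)%:R *: (d + ws))| <= eta.
  pose r : R := (m p)%:R / (n p)%:R.
  have r0 : 0 <= r by rewrite divr_ge0 // ltW.
  have -> : T (iota ((m p)%:R *: x)) = r *: \sum_(i < n p) T (iota (e_ (l i))).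
    by rewrite /x scalerA -/r linearZ /= linearZ /= !linear_sum.
  have -> : iota ((m p)%:R *: (d + ws)) = r *: \sum_(i < n p) iota (a_ (l i) *: e_ (l i) + w i).
    by rewrite /d /ws -scalerDr -big_split /= scalerA -/r linearZ /= linear_sum.
  rewrite -scalerBr -sumrB normrZ ger0_norm //.
  apply: (@le_trans _ _ (r * \sum_(i < n p) e)).
    apply: ler_wpM2l => //; apply: (le_trans (ler_norm_sum _ _ _)).
    by apply: ler_sum => i _; have [] := aP i.
  rewrite sumr_const card_ord -[_ *+ n p]mulr_natl /r mulrA divfK ?gt_eqF //.
  by rewrite mulrC -ler_pdivlMr.
exists x, f, ws; split => //.
- move=> c [/xl[i _ ->] //|[/suppZ|/suppZ] /supp_sum[i [_ _]]].
    by move=> /gS/andP[h _]; apply: leq_ltn_trans h; rewrite -L0; exact: chain_le.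
  by move=> /wS/andP[h _]; apply: leq_ltn_trans h; rewrite -L0; exact: chain_le.
- split; last by move=> c; split; [exact: (Kset_rat Kf)|exact (K_coord_le1 G C c (Kset_K Kf))].
  apply: supp_nonempty; apply/eqP => f0; move: fv; rewrite f0 pairing0l; move: delta0; lra.
- split; first by exists lev.
    move=> i h Kh; have [_ wh] := Kset_weighted G C p0 Kh.
    rewrite /x pairingZr pairing_sumr normrM ger0_norm ?invr_ge0 // mulrC ler_pdivrMr //.
    apply: (le_trans (ler_norm_sum _ _ _)).
    rewrite -[X in _ * X%:R]card_ord mulr_natr -sumr_const; apply: ler_sum => j _.
    by rewrite pairing_basisr; exact (weighted_coord G C _ wh).
  split => //; last by exists d.
  have := @signed_basis_exact R m n s sigma G C p l (fun=> 1) p1 ll.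
  have -> : (m p)%:R / (n p)%:R *: \sum_(i < n p) 1 *: e_ (l i) = (m p)%:R *: x.
    by rewrite /x scalerA; congr (_ *: _); apply: eq_bigr => i _; rewrite scale1r.
  by apply => i; rewrite normr1.
Qed.

(** On the dependent sequence with rho = 0 the vector D has norm of order k / m_q ^ 2,
    but H makes T D as large as k delta / (4 m_q). The error eta takes half of this
    lower bound, and m_q > 8 * 66 * M / delta contradicts the boundedness of T. *)
Lemma off_diagonal_absurd : False.
Proof.
have [q [k [oq q2 nq Bq]]] := large_odd G (528 * M / delta + 1).
have k0 : (0 < k)%N by have := n_gt0 G (ltnW (ltnW q2)); lia.
have [p0 [p01 ep0 p0k]] := large_even G ((2 * k) ^ 2).
have mq0 : (0 : R) < (m q)%:R by rewrite ltr0n (m_gt0 G) //; lia.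
pose eta := delta / (8 * (m q)%:R).
have eta0 : 0 < eta by rewrite divr_gt0 // mulr_gt0.
pose PO (p : nat) (x f : c00 R) := True.
have odd_prov N p : (1 < p)%N -> ~~ odd p ->
  exists x f, [/\ forall c, supp x c \/ supp f c -> (N < c)%N, basis_average p x f & PO p x f].
  move=> p1 _; pose l i := (N + i.+1)%N.
  have ll i j : (i < j)%N -> (l i < l j)%N by rewrite /l ltn_add2l.
  have Nl i : (N < l i)%N by rewrite /l -addSnnS leq_addr.
  have l0 i : (0 < l i)%N by apply: leq_ltn_trans (Nl i).
  exists ((n p)%:R^-1 *: \sum_(i < n p) e_ (l i)), ((m p)%:R^-1 *: \sum_(i < n p) e_ (l i)).
  split => //; last exact: signed_basis_average.
  by move=> c [] /supp_basis_average; apply.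
have PO_ex p x f : PO p x f -> exact_vec p 2 ((0 * (m p)%:R) *: x).
  by move=> _; rewrite mul0r scale0r; apply: exact_vec0.
have PE_ex p x f w : off_diagonal_average eta p x f w -> exact_vec p 2 ((m p)%:R *: x) by case.
have canc : (0 : R) = 1 \/ (0 : R) = 0 /\ forall p x f w, off_diagonal_average eta p x f w ->
    forall c, supp x c -> supp f c -> False.
  by right; split => // p x f w [].
have [po [pe [xo [fo [xe [fe [we [_ PEa _ Dn [H KH HE]]]]]]]]] :=
  dependent_pair G C oq q2 nq p01 ep0 p0k odd_prov (fun N p => @off_diagonal_provider eta N p eta0)
    PO_ex PE_ex canc.
have dex a : exists d : c00 R, (a < k)%N ->
   [/\ forall c, supp d c -> supp (xe a) c,
      `|T (iota ((m (pe a))%:R *: xe a)) - iota ((m (pe a))%:R *: (d + we a))| <= eta &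
      delta / 4 <= pairing (fe a) ((m (pe a))%:R *: (d + we a))].
  have [ak|ak] := boolP (a < k)%N; last by exists 0.
  by have [_ _ [d dP]] := PEa a ak; exists d.
have [d dP] := boolp.choice dex.
pose v a := (m (pe a))%:R *: (d a + we a).
have vs a c : (a < k)%N -> supp (v a) c -> supp (xe a) c \/ supp (we a) c.
  by move=> ak /suppZ /suppD[dc|]; [left; have [H' _ _] := dP a ak; exact: H'|right].
have HV := HE v vs.
set V := \sum_(a < k) v a in HV.
pose D := \sum_(a < k) (m (pe a))%:R *: xe a.
have Dn' : `|iota D| <= 66 * k%:R / (m q)%:R ^+ 2.
  rewrite -normrN -linearN; apply/(nle_norm compl).
  have -> : - D = \sum_(a < k) ((0 * (m (po a))%:R) *: xo a - (m (pe a))%:R *: xe a); last by [].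
  by rewrite /D -sumrN; apply: eq_bigr => a _; rewrite mul0r scale0r add0r.
have lower : k%:R * (delta / 4) / (m q)%:R <= `|iota V|.
  apply: (@le_trans _ _ (pairing H V)); last first.
    apply: (le_trans (ler_norm _)).
    by have /(_ H KH) := (nle_norm compl V `|iota V|).2 (lexx _).
  rewrite HV mulrC; apply: ler_wpM2l; first by rewrite invr_ge0 ltW.
  rewrite -[X in X%:R * _]card_ord mulr_natl -sumr_const; apply: ler_sum => a _.
  by have [] := dP a (ltn_ord a).
have upper : `|iota V| <= M * (66 * k%:R / (m q)%:R ^+ 2) + k%:R * eta.
  have -> : iota V = T (iota D) - \sum_(a < k) (T (iota ((m (pe a))%:R *: xe a)) - iota (v a)).
    have -> : T (iota D) = \sum_(a < k) T (iota ((m (pe a))%:R *: xe a)).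
      by rewrite /D [iota _]linear_sum linear_sum.
    have -> : iota V = \sum_(a < k) iota (v a) by rewrite /V linear_sum.
    by rewrite sumrB subKr.
  apply: (le_trans (ler_normB _ _)); apply: lerD.
    by apply: (le_trans (TM _)); apply: ler_wpM2l => //; exact: ltW.
  rewrite -[X in X%:R * _]card_ord mulr_natl -sumr_const.
  apply: (le_trans (ler_norm_sum _ _ _)); apply: ler_sum => a _.
  by have [] := dP a (ltn_ord a).
have kR : (0 : R) < k%:R by rewrite ltr0n.
have := le_trans lower upper.
have -> : k%:R * (delta / 4) / (m q)%:R = k%:R / (m q)%:R * (delta / 4) by ring.
have -> : M * (66 * k%:R / (m q)%:R ^+ 2) + k%:R * eta =
   k%:R / (m q)%:R * (66 * M / (m q)%:R + delta / 8) by rewrite /eta; field; rewrite gt_eqF.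
rewrite ler_pM2l ?divr_gt0 // => ineq.
have : delta / 8 <= 66 * M / (m q)%:R by move: ineq; lra.
rewrite ler_pdivlMr // => ineq2.
have : 528 * M < (m q)%:R * delta.
  by rewrite -ltr_pdivrMr //; move: Bq; lra.
by move: ineq2; lra.
Qed.

End Contradiction.

Theorem near_diagonal (e : R) N : 0 < e -> exists2 l, (N < l)%N &
  `|T (iota (e_ l)) - coord iota l (T (iota (e_ l))) *: iota (e_ l)| <= e.
Proof.
move=> e0; apply: contrapT => H; apply: (@off_diagonal_absurd e N e0) => l Nl.
by rewrite ltNge; apply/negP => le; apply: H; exists l.
Qed.

End NearDiagonal.

(** * Cluster values and infinite dimensional subspaces *)

Section ClusterValue.
Variable R : realType.

Lemma bounded_cluster (a : nat -> R) (M : R) : (forall j, `|a j| <= M) ->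
  exists lambda, forall (e : R) N, 0 < e -> exists2 j, (N <= j)%N & `|a j - lambda| < e.
Proof.
move=> aM; have [|lambda [_ cl]] := @segment_compact R (- M) M (a @ \oo) _.
  by exists 0%N => // j _; rewrite /= in_itv /= -ler_norml.
exists lambda => e N e0.
have FA : (a @ \oo) [set a j | j in [set j | (N <= j)%N]].
  by exists N => // j Nj; exists j.
have [_ [[j Nj <-]]] := cl _ _ FA (nbhsx_ballx lambda e e0).
by rewrite -ball_normE /= => aj; exists j => //; rewrite distrC.
Qed.

Lemma geometric_le2 d : \sum_(i < d) (2 ^+ i)^-1 <= 2 :> R.
Proof.
suff -> : \sum_(i < d) (2 ^+ i)^-1 = 2 - 2 / 2 ^+ d :> R.
  by rewrite gerBl divr_ge0 // exprn_ge0.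
elim: d => [|d IH]; first by rewrite big_ord0 expr0 divr1 subrr.
have : (2 : R) ^+ d != 0 by rewrite expf_neq0.
by rewrite big_ord_recr /= IH exprS => d0; field.
Qed.

End ClusterValue.

Section FiniteDimension.
Variables (R : realType) (X : normedModType R).
Implicit Types (Y : set X) (h : X -> R).

Lemma submodD Y x y : submod_closed [in Y] -> Y x -> Y y -> Y (x + y).
Proof.
move=> [_ H] /mem_set Yx /mem_set Yy; apply: set_mem.
by have := H 1 x y Yx Yy; rewrite scale1r.
Qed.

Lemma submod0 Y : submod_closed [in Y] -> Y 0.
Proof. by move=> [Y0 _]; exact: set_mem. Qed.

Lemma submodZ Y a x : submod_closed [in Y] -> Y x -> Y (a *: x).
Proof.
move=> Ys /mem_set Yx; have /mem_set Y0 := submod0 Ys; apply: set_mem.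
by have [_ H] := Ys; have := H a x 0 Yx Y0; rewrite addr0.
Qed.

Lemma submod_sum Y d (F : 'I_d -> X) : submod_closed [in Y] ->
  (forall i, Y (F i)) -> Y (\sum_i F i).
Proof.
move=> Ys YF; elim/big_ind: _ => // [|x y]; [exact: submod0|exact: submodD].
Qed.

(** A vector of Y outside the kernel completes a spanning family of the kernel. *)
Lemma finite_dim_ker Y h : submod_closed [in Y] ->
  (forall x y, h (x + y) = h x + h y) -> (forall a x, h (a *: x) = a * h x) ->
  finite_dim (Y `&` [set x | h x = 0]) -> finite_dim Y.
Proof.
move=> Ys hD hZ [d [v [vY vS]]].
have [[y0 [Yy0 hy0]]|H] := pselect (exists y, Y y /\ h y != 0); last first.
  exists d, v; split=> [i|y Yy]; first by have [] := vY i.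
  apply: vS; split => //=; apply/eqP/negPn/negP => hy; apply: H; by exists y.
exists d.+1, (fun i => if unlift ord0 i is Some j then v j else y0); split.
  by move=> i; case: unliftP => [j _|_] //; have [] := vY j.
move=> y Yy; have [] := vS (y - (h y / h y0) *: y0).
  split => /=; first by apply: submodD => //; rewrite -scaleNr; apply: submodZ.
  by rewrite hD -scaleNr hZ mulNr divfK // subrr.
move=> a aE; exists (fun i => if unlift ord0 i is Some j then a j else h y / h y0).
rewrite big_ord_recl unlift_none; under eq_bigr do rewrite liftK.
by rewrite -aE addrC subrK.
Qed.

(** Continuity of the inverse at 0, made uniform by homogeneity. *)
Lemma iso_bounded_below (f : {linear X -> X}) Y : submod_closed [in Y] ->
  iso_onto_image Y f -> exists2 c : R, 0 < c & forall y, Y y -> c * `|y| <= `|f y|.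
Proof.
move=> Ys [_ [g [gf /subspace_continuousP gc]]].
have f0 : (f @` Y) 0 by exists 0; [exact: submod0|exact: linear0].
have g0 : g 0 = 0 by rewrite -{1}(linear0 f) gf //; exact: submod0.
have /cvgrPdist_lt /(_ 1 ltr01) := gc 0 f0.
rewrite near_withinE => /nbhs_ballP[delta /= d0 gd].
exists (delta / 2); first by rewrite divr_gt0.
move=> y Yy; have [fy|fy] := eqVneq (f y) 0.
  by rewrite -(gf y Yy) fy g0 normr0 mulr0.
have nf : 0 < `|f y| by rewrite normr_gt0.
pose t := delta / 2 / `|f y|.
have t0 : 0 < t by rewrite !divr_gt0.
have Yt : Y (t *: y) by exact: submodZ.
have ft : `|f (t *: y)| = delta / 2.
  by rewrite linearZ normrZ gtr0_norm // divfK // gt_eqF.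
have : `|g (f (t *: y))| < 1.
  have := gd (f (t *: y)); rewrite -ball_normE /= sub0r normrN ft => H.
  have {}H : `|g 0 - g (f (t *: y))| < 1 by apply: H; [lra|exists (t *: y)].
  by rewrite g0 sub0r normrN in H.
by rewrite gf // normrZ gtr0_norm // /t mulrAC ltr_pdivrMr // mul1r => /ltW.
Qed.

End FiniteDimension.

(** * Block subspaces *)

Section Subspaces.
Variables (R : realType) (m n s : nat -> nat).
Variable sigma : seq (c00 R * c00 R) -> nat.
Hypotheses (G : growth m n s) (C : coding m sigma).
Variables (X : completeNormedModType R) (iota : {linear c00 R -> X}).
Hypothesis compl : is_completion (norm_K m n sigma) iota.
Variable Y : set X.
Hypotheses (Ys : submod_closed [in Y]) (Yinf : ~ finite_dim Y).
Implicit Types (u v : c00 R).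

Notation nle := (nle m n sigma).
Notation e_ l := (basis_vec R l).

(** Each coordinate that is required to vanish lowers the dimension by at most 1. *)
Lemma vanishing_infinite N :
  let Z := Y `&` [set x | forall c, (c < N)%N -> coord iota c x = 0] in
  submod_closed [in Z] /\ ~ finite_dim Z.
Proof.
elim: N => [|N [Zs Zi]] Z.
  have -> : Z = Y by apply/seteqP; split => [x []|x Yx] //; split.
  by [].
have ZE : Z = (Y `&` [set x | forall c, (c < N)%N -> coord iota c x = 0]) `&`
    [set x | coord iota N x = 0].
  apply/seteqP; split => x /=; last first.
    by move=> [[Yx xN] x0]; split => // c; rewrite ltnS leq_eqVlt => /orP[/eqP ->|/xN].
  by move=> [Yx xN]; split; [split => // c cN; apply: xN; exact: ltnW|exact: xN].
rewrite ZE; split; last first.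
  by move/(finite_dim_ker Zs (coordD compl N) (coordZ compl N)).
split; first by apply: mem_set; split; [exact: submod0|rewrite /= -(linear0 iota) (coord_iota compl)].
move=> a x y /set_mem[Zx x0] /set_mem[Zy y0]; apply: mem_set; split.
  by apply: submodD => //; exact: submodZ.
by rewrite /= (coordD compl) (coordZ compl) x0 y0 mulr0 addr0.
Qed.

Lemma exists_vanishing N : exists y, [/\ Y y, `|y| = 1 & forall c, (c < N)%N -> coord iota c y = 0].
Proof.
have [Zs Zi] := vanishing_infinite N.
have [y [[Yy yN] y0]] : exists y, (Y `&` [set x | forall c, (c < N)%N -> coord iota c x = 0]) y /\ y != 0.
  apply: contrapT => H; apply: Zi; exists 0%N, (fun=> 0); split=> [[]|y Zy] //.
  exists (fun=> 0); rewrite big_ord0; apply/eqP/negPn/negP => y0; apply: H.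
  by exists y.
have ny : 0 < `|y| by rewrite normr_gt0.
exists (`|y|^-1 *: y); split.
- exact: submodZ.
- by rewrite normrZ gtr0_norm ?invr_gt0 // mulVf // gt_eqF.
- by move=> c /yN yc; rewrite (coordZ compl) yc mulr0.
Qed.

(** A unit vector of Y with vanishing initial coordinates is approximated by v; the
    initial coordinates of v are then small and can be dropped, and the others are
    replaced by rational numbers. *)
Lemma exists_block N (e : R) : 0 < e -> exists y u,
  [/\ Y y, ratvec u, forall c, supp u c -> (N < c)%N, `|y - iota u| <= e & 2^-1 <= `|iota u|].
Proof.
move=> e0; have [y [Yy y1 yN]] := exists_vanishing N.+1.
pose e' := Num.min e 2^-1 / (N + 3)%:R.
have N3 : (0 : R) < (N + 3)%:R by rewrite ltr0n addnS.
have e'0 : 0 < e' by rewrite divr_gt0 // lt_min e0 invr_gt0 ltr0n.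
have [v vy] := approx compl y e'0.
pose B := bound v; pose e2 := e' / B.+1%:R.
have e20 : 0 < e2 by rewrite divr_gt0 // ltr0n.
have ex c : exists q : rat, `|v c - ratr q| <= e2.
  have [|q] := @rat_in_itvoo R (v c - e2) (v c + e2); first by lra.
  rewrite in_itv /= => /andP[q1 q2]; exists q; rewrite ler_norml; lra.
have [r rP] := boolp.choice ex.
pose t c : R := if (N < c)%N then ratr (r c) else 0.
pose u : c00 R := \sum_(c < B) t c *: e_ c.
have us c : supp u c -> (N < c)%N.
  move=> /supp_sum[i [_ _]]; rewrite /t; case: ifP => [Ni /suppZ /supp_basis -> //|_].
  by rewrite scale0r suppE eqxx.
have close : nle (v - u) ((N + 2)%:R * e').
  have -> : v - u = \sum_(c < B) (v c - t c) *: e_ c.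
    rewrite {1}(@c00_expand R v B); last by move=> c; exact: boundP.
    by rewrite /u -sumrB; apply: eq_bigr => c _; rewrite scalerBl.
  apply: nle_le; last by apply: nle_sum => c _; exact: nleZ (nle_basis G C c).
  apply: (@le_trans _ _ (\sum_(c < B) ((if (c < N.+1)%N then e' else 0) + e2))).
    apply: ler_sum => c _; rewrite mulr1 /t ltnS.
    have [Nc|cN] := ltnP N c; first by rewrite add0r; exact: rP.
    have v1 : `|v c| <= `|y - iota v| by have := coordP compl c y v; rewrite yN // subr0.
    by rewrite subr0; move: vy v1 e20; lra.
  rewrite big_split /= sumr_const card_ord.
  have -> : \sum_(c < B) (if (c < N.+1)%N then e' else 0) = e' * cnt R B (fun c => (c < N.+1)%N).
    by rewrite /cnt mulr_sumr -big_mkcond /=; apply: eq_bigr => c _; rewrite mulr1.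
  have c1 : cnt R B (fun c => (c < N.+1)%N) <= N.+1%:R.
    apply: (@cnt_inj R _ _ _ id) => // c c' /andP[cc _] _ _ E; by rewrite E ltnn in cc.
  have c2 : e2 *+ B <= e'.
    rewrite -mulr_natl /e2 mulrA ler_pdivrMr // mulrC ler_pM2l // ler_nat.
    exact: leqnSn.
  have c3 : e' * cnt R B (fun c => (c < N.+1)%N) <= e' * N.+1%:R by rewrite ler_pM2l.
  move: c3; rewrite -natr1 natrD; lra.
have yu : `|y - iota u| <= Num.min e 2^-1.
  have -> : y - iota u = (y - iota v) + iota (v - u) by rewrite linearB /= subrKA.
  apply: (le_trans (ler_normD _ _)).
  have := (nle_norm compl _ _).1 close => close'.
  have -> : Num.min e 2^-1 = (N + 2)%:R * e' + e'.
    have N4 : (N + 3)%:R = (N + 2)%:R + 1 :> R by rewrite !natrD; ring.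
    by rewrite -[X in _ + X]mul1r -mulrDl -N4 mulrC divfK // gt_eqF.
  by move: vy close'; lra.
have [yu1 yu2] : `|y - iota u| <= e /\ `|y - iota u| <= 2^-1.
  by move: yu; rewrite le_min => /andP[].
exists y, u; split => //.
  apply: ratvec_sum => c _ _; apply: ratvecZ; last exact: ratvec_basis.
  by rewrite /t; case: ifP => _; [exists (r c)|exact: ratnum0].
have : `|y| <= `|y - iota u| + `|iota u| by rewrite -{1}(subrK (iota u) y) ler_normD.
by rewrite y1; move: yu2; lra.
Qed.

(** W is the span of blocks u_i close to vectors y_i of Y. A coefficient of v on a block
    is at most 2 |v|, because restricting v to the window of that block does not
    increase the norm, so that the errors, of order 2 ^ (-i), add up to kappa |v|. *)
Lemma block_subspace (kappa : R) : 0 < kappa -> exists W : c00 R -> Prop,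
  [/\ forall a v, W v -> W (a *: v), forall u v, W u -> W v -> W (u + v),
    forall N, exists v, [/\ W v, v != 0, ratvec v & forall c, supp v c -> (N < c)%N] &
    forall v, W v -> exists2 y, Y y & `|y - iota v| <= kappa * `|iota v|].
Proof.
move=> k0; pose Q N (a : X * c00 R) :=
  [/\ Y a.1, ratvec a.2, forall c, supp a.2 c -> (N < c)%N,
      `|a.1 - iota a.2| <= kappa / 4 / 2 ^+ N & 2^-1 <= `|iota a.2|].
have Qex N : exists a, Q N a.
  have [|y [u H]] := @exists_block N (kappa / 4 / 2 ^+ N); first by rewrite !divr_gt0 ?exprn_gt0.
  by exists (y, u).
have [a [L [L0 aL]]] := chain (fun a : X * c00 R => bound a.2) Qex 0%N.
pose y i := (a i).1; pose u i := (a i).2.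
have Yy i : Y (y i) by have [[]] := aL i.
have ru i : ratvec (u i) by have [[]] := aL i.
have LL i : (L i <= L i.+1)%N by have [] := aL i.
have uS i c : supp (u i) c -> (L i < c < L i.+1)%N.
  move=> uc; have [[_ _ /(_ c uc) -> _ _] _] := aL i.
  by apply: leq_trans; exact: supp_lt_bound uc.
have u2 i : 2^-1 <= `|iota (u i)| by have [[]] := aL i.
have yu i : `|y i - iota (u i)| <= kappa / 4 / 2 ^+ L i by have [[]] := aL i.
have u0 i : u i != 0.
  by apply/eqP => z; have := u2 i; rewrite z linear0 normr0; lra.
have Li i : (i <= L i)%N.
  elim: i => // i IH; have [c /uS/andP[c1 c2]] := supp_nonempty (u0 i).
  exact: leq_ltn_trans IH (ltn_trans c1 c2).
pose W v := exists d (b : nat -> R), v = \sum_(i < d) b i *: u i.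
have Wpad v d : W v -> exists D (b : nat -> R), (d <= D)%N /\ v = \sum_(i < D) b i *: u i.
  move=> [d' [b ->]]; exists (maxn d d'), (fun i => if (i < d')%N then b i else 0).
  split; first exact: leq_maxl.
  rewrite (big_ord_widen (maxn d d') (fun i => b i *: u i)) ?leq_maxr // big_mkcond.
  by apply: eq_bigr => i _; case: ifP => // _; rewrite scale0r.
exists W; split.
- move=> t v [d [b ->]]; exists d, (fun i => t * b i).
  by rewrite scaler_sumr; apply: eq_bigr => i _; rewrite scalerA.
- move=> v v' [d [b ->]] /(Wpad _ d)[D [b' [dD ->]]].
  exists D, (fun i => (if (i < d)%N then b i else 0) + b' i).
  rewrite (big_ord_widen D (fun i => b i *: u i)) // big_mkcond -big_split.
  by apply: eq_bigr => i _ /=; rewrite scalerDl; case: ifP => // _; rewrite scale0r.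
- move=> N; exists (u N); split => //; last first.
    by move=> c /uS/andP[h _]; apply: leq_ltn_trans h; exact: Li.
  exists N.+1, (fun i => (i == N)%:R); rewrite big_ord_recr /= eqxx scale1r.
  rewrite big1 ?add0r // => i _; by rewrite ltn_eqF ?scale0r.
- move=> v [d [b vE]]; exists (\sum_(i < d) b i *: y i).
    by apply: submod_sum => // i; exact: submodZ.
  have bv i : (i < d)%N -> `|b i| <= 2 * `|iota v|.
    move=> id; have rE : restr `]L i, L i.+1[ v = b i *: u i.
      rewrite vE restr_sum (bigD1 (Ordinal id)) // big1 ?Monoid.mulm1.
        apply: c00_ext => c; rewrite restrE; case: ifPn => //; rewrite in_itv /= ?ltEnat => nc.
        by apply: esym; apply: (@suppPn R (b i *: u i)) => /suppZ /uS; exact/negP.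
      move=> j ji; apply: c00_ext => c; rewrite restrE; case: ifPn => //.
      rewrite in_itv /= ?ltEnat => /andP[c1 c2]; apply: (@suppPn R (b j *: u j)) => /suppZ /uS/andP[c3 c4].
      have [lt|lt] : (i < j)%N \/ (j < i)%N.
        by apply/orP; rewrite -neq_ltn eq_sym; move: ji; rewrite -val_eqE.
        by have := chain_le LL lt; clear -c2 c3; lia.
      by have := chain_le LL lt; clear -c1 c4; lia.
    have : `|iota (b i *: u i)| <= `|iota v|.
      rewrite -rE; apply/(nle_norm compl)/nle_restr; exact/(nle_norm compl).
    by rewrite linearZ /= normrZ; have := u2 i; have := normr_ge0 (b i); nra.
  have -> : \sum_(i < d) b i *: y i - iota v = \sum_(i < d) b i *: (y i - iota (u i)).
    rewrite vE linear_sum -sumrB; apply: eq_bigr => i _.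
    by rewrite linearZ /= -scalerBr.
  apply: (le_trans (ler_norm_sum _ _ _)).
  apply: (@le_trans _ _ (\sum_(i < d) (kappa / 2 * `|iota v|) * (2 ^+ i)^-1)).
    apply: ler_sum => i _; rewrite normrZ.
    have -> : kappa / 2 * `|iota v| / 2 ^+ i = (2 * `|iota v|) * (kappa / 4 / 2 ^+ i) :> R.
      by have d0 : (2 : R) ^+ i != 0 by [rewrite expf_neq0]; field.
    apply: ler_pM => //; first exact: bv.
    apply: (le_trans (yu i)); rewrite ler_pM2l ?divr_gt0 // lef_pV2 ?posrE ?exprn_gt0 //.
    by rewrite ler_weXn2l // ler1n.
  rewrite -mulr_sumr; have := geometric_le2 R d.
  have : 0 <= kappa / 2 * `|iota v| by rewrite mulr_ge0 // divr_ge0 // ltW.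
  by nra.
Qed.

End Subspaces.

(** * Strict singularity *)

Section StrictSingularity.
Variables (R : realType) (m n s : nat -> nat).
Variable sigma : seq (c00 R * c00 R) -> nat.
Hypotheses (G : growth m n s) (C : coding m sigma).
Variables (X : completeNormedModType R) (iota : {linear c00 R -> X}).
Hypothesis compl : is_completion (norm_K m n sigma) iota.
Variables (S : {linear X -> X}) (M : R).
Hypotheses (M0 : 0 < M) (SM : forall x, `|S x| <= M * `|x|).

Notation exact_vec := (exact_vec m n sigma).
Notation basis_average := (basis_average m n).
Notation e_ l := (basis_vec R l).

Hypothesis S_small : forall (e : R) N, 0 < e ->
  exists l, (N < l)%N /\ `|S (iota (e_ l))| <= e.

(** If S is at most eta / m_p on each basis vector, it is at most eta on m_p times
    their average. *)
Lemma small_average (eta : R) N p : 0 < eta -> (1 < p)%N -> exists x f,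
  [/\ forall c, supp x c \/ supp f c -> (N < c)%N, basis_average p x f &
    exact_vec p 2 ((m p)%:R *: x) /\ `|S (iota ((m p)%:R *: x))| <= eta].
Proof.
move=> eta0 p1; have p0 : (0 < p)%N by apply: ltnW.
have mp0 : (0 : R) < (m p)%:R by rewrite ltr0n (m_gt0 G).
have np0 : (0 : R) < (n p)%:R by rewrite ltr0n (n_gt0 G).
have e0 : 0 < eta / (m p)%:R by rewrite divr_gt0.
have [l [L [L0 lL]]] := chain (fun l => l.+1) (fun N => S_small N e0) N.
have LL i : (L i <= L i.+1)%N by have [] := lL i.
have lS i : (L i < l i < L i.+1)%N by have [[-> _] _] := lL i.
have ll i j : (i < j)%N -> (l i < l j)%N.
  move=> ij; have /andP[_ h1] := lS i; have /andP[h2 _] := lS j.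
  by apply: (leq_trans h1); apply: leq_trans (ltnW h2); exact: chain_le.
have Nl i : (N < l i)%N.
  by have /andP[h _] := lS i; apply: leq_ltn_trans h; rewrite -L0; exact: chain_le.
have l0 i : (0 < l i)%N by apply: leq_ltn_trans (Nl i).
pose x : c00 R := (n p)%:R^-1 *: \sum_(i < n p) e_ (l i).
pose r : R := (m p)%:R / (n p)%:R.
have r0 : 0 <= r by rewrite divr_ge0 // ltW.
have mx : (m p)%:R *: x = r *: \sum_(i < n p) e_ (l i) by rewrite /x scalerA.
exists x, ((m p)%:R^-1 *: \sum_(i < n p) e_ (l i)); split.
- by move=> c [] /supp_basis_average; apply.
- exact: signed_basis_average.
split.
  have := @signed_basis_exact R m n s sigma G C p l (fun=> 1) p1 ll.
  have -> : (m p)%:R / (n p)%:R *: \sum_(i < n p) 1 *: e_ (l i) = (m p)%:R *: x.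
    by rewrite mx; congr (_ *: _); apply: eq_bigr => i _; rewrite scale1r.
  by apply => i; rewrite normr1.
rewrite mx linearZ linearZ normrZ ger0_norm // !linear_sum.
apply: (@le_trans _ _ (r * \sum_(i < n p) (eta / (m p)%:R))).
  apply: ler_wpM2l => //; apply: (le_trans (ler_norm_sum _ _ _)).
  by apply: ler_sum => i _; have [[]] := lL i.
rewrite sumr_const card_ord -[_ *+ n p]mulr_natl /r mulrA divfK ?gt_eqF //.
by rewrite mulrC divfK ?gt_eqF.
Qed.

(** Dependent sequences that alternate between such averages O and averages V in W: the
    norm of O - V is of order k / m_q ^ 2 only, while V keeps a norm of order k / m_q, and
    S nearly vanishes on O. Hence S is much smaller on V than boundedness from below
    permits: eta takes half of c k / (8 m_q), and m_q > 16 * 66 * M / c does the rest. *)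
Lemma not_bounded_below (W : c00 R -> Prop) (c : R) : 0 < c ->
  (forall a v, W v -> W (a *: v)) -> (forall u v, W u -> W v -> W (u + v)) ->
  (forall N, exists v, [/\ W v, v != 0, ratvec v & forall k, supp v k -> (N < k)%N]) ->
  (forall v, W v -> c * `|iota v| <= `|S (iota v)|) -> False.
Proof.
move=> c0 WZ WD Wex WS.
have [q [k [oq q2 nq Bq]]] := large_odd G (1056 * M / c + 1).
have k0 : (0 < k)%N by have := n_gt0 G (ltnW (ltnW q2)); lia.
have [p0 [p01 ep0 p0k]] := large_even G ((2 * k) ^ 2).
have mq0 : (0 : R) < (m q)%:R by rewrite ltr0n (m_gt0 G) //; lia.
pose eta := c / (16 * (m q)%:R).
have eta0 : 0 < eta by rewrite divr_gt0 // mulr_gt0.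
pose PO (p : nat) (x f : c00 R) := exact_vec p 2 ((m p)%:R *: x) /\
  `|S (iota ((m p)%:R *: x))| <= eta.
pose PE (p : nat) (x f w : c00 R) := exact_vec p 2 ((m p)%:R *: x) /\
  (W x /\ 8^-1 <= pairing f ((m p)%:R *: x)).
have odd_prov N p : (1 < p)%N -> ~~ odd p ->
  exists x f, [/\ forall c, supp x c \/ supp f c -> (N < c)%N, basis_average p x f & PO p x f].
  by move=> p1 _; exact: small_average.
have even_prov N p : (1 < p)%N -> ~~ odd p -> exists x f w : c00 R,
    [/\ forall c, supp x c \/ supp f c \/ supp w c -> (N < c)%N, Qset x, Qset f &
    even_entry m n sigma PE p x f w].
  move=> p1 ep.
  have nrmZ a v : `|iota (a *: v)| = `|a| * `|iota v| by rewrite linearZ normrZ.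
  have WD' u v : W u -> W v -> set_lt (supp u) (supp v) -> W (u + v) by move=> ? ? _; exact: WD.
  have [x [f [xf [Qx Qf] [Kf gx] xe Wf]]] :=
    subspace_average G C (nle_norm compl) nrmZ WZ WD' Wex N p1 ep.
  by exists x, f, 0; split => // a [xa|[fa|/nsuppP //]]; apply: xf; [left|right].
have PO_ex p x f : PO p x f -> exact_vec p 2 ((1 * (m p)%:R) *: x) by rewrite mul1r; case.
have PE_ex p x f w : PE p x f w -> exact_vec p 2 ((m p)%:R *: x) by case.
have canc : (1 : R) = 1 \/ (1 : R) = 0 /\ forall p x f w, PE p x f w ->
    forall c, supp x c -> supp f c -> False by left.
have [po [pe [xo [fo [xe [fe [we [POa PEa xs Dn [H KH HE]]]]]]]]] :=
  dependent_pair G C oq q2 nq p01 ep0 p0k odd_prov even_prov PO_ex PE_ex canc.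
pose v a := (m (pe a))%:R *: xe a.
have HV := HE v (fun a c _ vc => or_introl (suppZ vc)).
set V := \sum_(a < k) v a in HV.
have VW : W V.
  rewrite /V; elim/big_ind: _ => [||a _]; last by apply: WZ; have [_ []] := PEa a (ltn_ord a).
    by have [u [Wu _ _ _]] := Wex 0%N; rewrite -(scale0r u); exact: WZ.
  exact: WD.
pose O := \sum_(a < k) (m (po a))%:R *: xo a.
have Dn' : `|iota (O - V)| <= 66 * k%:R / (m q)%:R ^+ 2.
  apply/(nle_norm compl).
  have -> : O - V = \sum_(a < k) ((1 * (m (po a))%:R) *: xo a - (m (pe a))%:R *: xe a); last by [].
  by rewrite /O /V -sumrB; apply: eq_bigr => a _; rewrite mul1r.
have lower : k%:R * 8^-1 / (m q)%:R <= `|iota V|.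
  apply: (@le_trans _ _ (pairing H V)); last first.
    apply: (le_trans (ler_norm _)).
    by have /(_ H KH) := (nle_norm compl V `|iota V|).2 (lexx _).
  rewrite HV mulrC; apply: ler_wpM2l; first by rewrite invr_ge0 ltW.
  rewrite -[X in X%:R * _]card_ord mulr_natl -sumr_const; apply: ler_sum => a _.
  by have [_ []] := PEa a (ltn_ord a).
have upper : `|S (iota V)| <= M * (66 * k%:R / (m q)%:R ^+ 2) + k%:R * eta.
  have -> : S (iota V) = S (iota O) - S (iota (O - V)).
    by rewrite [iota (O - V)]linearB [S (_ - _)]linearB subKr.
  rewrite [leRHS]addrC; apply: (le_trans (ler_normB _ _)); apply: lerD.
    rewrite /O [iota _]linear_sum [S _]linear_sum.
    rewrite -[X in X%:R * _]card_ord mulr_natl -sumr_const.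
    apply: (le_trans (ler_norm_sum _ _ _)); apply: ler_sum => a _.
    by have [] := POa a (ltn_ord a).
  by apply: (le_trans (SM _)); apply: ler_wpM2l => //; exact: ltW.
have kR : (0 : R) < k%:R by rewrite ltr0n.
have := le_trans (ler_wpM2l (ltW c0) lower) (le_trans (WS V VW) upper).
have -> : c * (k%:R * 8^-1 / (m q)%:R) = k%:R / (m q)%:R * (c / 8) by ring.
have -> : M * (66 * k%:R / (m q)%:R ^+ 2) + k%:R * eta =
   k%:R / (m q)%:R * (66 * M / (m q)%:R + c / 16) by rewrite /eta; field; rewrite gt_eqF.
rewrite ler_pM2l ?divr_gt0 // => ineq.
have : c / 16 <= 66 * M / (m q)%:R by move: ineq; lra.
rewrite ler_pdivlMr // => ineq2.
have : 1056 * M < (m q)%:R * c.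
  by rewrite -ltr_pdivrMr //; move: Bq; lra.
by move: ineq2; lra.
Qed.

(** The blocks inherit a lower bound from Y: with kappa <= 1/2 the vector y has at least
    half the norm of v, and with M kappa <= c/4 passing from S y to S v costs at most
    half of the resulting lower bound c/2. *)
Theorem strictly_singular_of_small : strictly_singular S.
Proof.
move=> Y Ys _ Yinf iso; have [c c0 cY] := iso_bounded_below Ys iso.
pose kappa := Num.min 2^-1 (c / (4 * M)).
have k0 : 0 < kappa by rewrite lt_min; apply/andP; split; [rewrite invr_gt0|rewrite divr_gt0 // mulr_gt0].
have k1 : kappa <= 2^-1 by rewrite ge_min lexx.
have k2 : M * kappa <= c / 4.
  apply: (@le_trans _ _ (M * (c / (4 * M)))).
    by apply: ler_wpM2l; [exact: ltW|rewrite ge_min lexx orbT].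
  by rewrite le_eqVlt; apply/orP; left; apply/eqP; field; rewrite gt_eqF.
have [W [WZ WD Wex WY]] := block_subspace G C compl Ys Yinf k0.
apply: (@not_bounded_below W (c / 4)) => // [|v Wv]; first by rewrite divr_gt0.
have [y Yy yv] := WY v Wv.
have S1 : `|S y| <= `|S (iota v)| + M * (kappa * `|iota v|).
  have -> : S y = S (iota v) + S (y - iota v) by rewrite -linearD addrC subrK.
  apply: (le_trans (ler_normD _ _)); apply: lerD => //.
  by apply: (le_trans (SM _)); apply: ler_wpM2l => //; exact: ltW.
have v1 : `|iota v| <= `|y| + kappa * `|iota v|.
  have {1}-> : iota v = y - (y - iota v) by rewrite subKr.
  by apply: (le_trans (ler_normB _ _)); rewrite lerD2l.
have v0 := normr_ge0 (iota v); have cy := cY y Yy.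
have h1 : kappa * `|iota v| <= 2^-1 * `|iota v| by apply: ler_wpM2r.
have h2 : M * (kappa * `|iota v|) <= c / 4 * `|iota v| by rewrite mulrA; apply: ler_wpM2r.
have h3 : c * (2^-1 * `|iota v|) <= c * `|y| by apply: ler_wpM2l; [exact: ltW|lra].
by move: cy S1 h2 h3; lra.
Qed.

End StrictSingularity.

Theorem proposition4p18 (R : realType) (m n s : nat -> nat)
    (sigma : seq (c00 R * c00 R) -> nat)
    (growth_mns : growth m n s) (coding_sigma : coding m sigma)
    (Xius : completeNormedModType R) (iota : {linear c00 R -> Xius})
    (Xius_completion : is_completion (norm_K m n sigma) iota)
    (T : {linear Xius -> Xius}) (T_bounded : bounded_fun_norm T) :
  exists lambda : R, strictly_singular (T \- lambda \*: idfun).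
Proof.
have [M M0 TM] := bounded_bound T_bounded.
have e_le l : `|iota (basis_vec R l)| <= 1.
  by apply/(nle_norm Xius_completion); exact: nle_basis growth_mns coding_sigma l.
pose a l := coord iota l (T (iota (basis_vec R l))).
have near j : exists l, (j < l)%N /\
    `|T (iota (basis_vec R l)) - a l *: iota (basis_vec R l)| <= j.+1%:R^-1.
  have [|l jl Tl] := near_diagonal growth_mns coding_sigma Xius_completion M0 TM
    (e := j.+1%:R^-1) j; first by rewrite invr_gt0 ltr0n.
  by exists l.
have [l lP] := boolp.choice near.
have aM j : `|a (l j)| <= M.
  apply: (le_trans (coord_norm Xius_completion _ _)); apply: (le_trans (TM _)).
  by rewrite -[leRHS]mulr1 ler_wpM2l ?(ltW M0).
have [lambda lamP] := bounded_cluster aM; exists lambda.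
pose S : {linear Xius -> Xius} := T \- lambda \*: idfun.
have SE x : S x = T x - lambda *: x by [].
have M1 : 0 < M + `|lambda| by have := normr_ge0 lambda; lra.
apply: (strictly_singular_of_small growth_mns coding_sigma Xius_completion M1).
  move=> x; rewrite SE; apply: (le_trans (ler_normB _ _)).
  by rewrite normrZ mulrDl lerD2r.
move=> e N e0; have e2 : 0 < e / 2 by rewrite divr_gt0.
have [j Nj aj] := lamP (e / 2) (maxn N (Num.truncn (e / 2)^-1)) e2.
exists (l j); have [jl Tl] := lP j; split.
  by apply: leq_ltn_trans jl; apply: leq_trans Nj; exact: leq_maxl.
have je : j.+1%:R^-1 <= e / 2.
  rewrite -[leRHS]invrK lef_pV2 ?posrE ?invr_gt0 ?ltr0n //.
  apply: (le_trans (ltW (truncnS_gt _))); rewrite ler_nat ltnS.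
  by apply: leq_trans Nj; exact: leq_maxr.
set b := iota (basis_vec R (l j)) in Tl *.
have -> : S b = (T b - a (l j) *: b) + (a (l j) - lambda) *: b.
  by rewrite SE scalerBl addrA subrK.
apply: (le_trans (ler_normD _ _)); rewrite normrZ.
have ab : `|a (l j) - lambda| * `|b| <= e / 2.
  by rewrite -[leRHS]mulr1; apply: ler_pM => //; [exact: ltW|exact: e_le].
by apply: (le_trans (lerD (le_trans Tl je) ab)); lra.
Qed.
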